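(* Let $(\mathcal A,D,\mathcal H)$ be a spectral triple with finite non-zero box dimension $d_B$, and let $d_H$ be its Hausdorff dimension. (a) If the limit $\lim_{n\to\infty}\frac{\log\mu_n(D^{-1})}{\log(1/n)}$ exists, then $d_B=d_H$. (b) If the limit $\lim_{n\to\infty}\frac{\mu_n(D^{-1})}{\mu_{2n}(D^{-1})}$ exists, then $d_B$ is characterized by the property that $|D|^{-d_B}$ is singularly traceable (that is, for $d>0$, $|D|^{-d}$ is singularly traceable if and only if $d=d_B$), and $d_B=d_H$.
   Context: A spectral triple $(\mathcal A,D,\mathcal H)$ consists of an algebra $\mathcal A$ acting on a Hilbert space $\mathcal H$ and a self-adjoint operator $D$ on $\mathcal H$ such that $[D,a]$ is bounded for every $a\in\mathcal A$ and $D$ has compact resolvent. It is assumed that $0$ is not an eigenvalue of $D$ (in general $D$ is replaced by $D|_{\ker(D)^\perp}$), so $|D|^{-1}$ is compact. For a compact operator $T$, $\mu_n(T)$ denotes its $n$-th singular value (singular values arranged in non-increasing order, counted with multiplicity). With $\mathcal K(\mathcal H)$ the compact operators, $\mathcal L^{1,\infty}:=\{T\in\mathcal K(\mathcal H):\sum_{k=1}^n\mu_k(T)=O(\log n)\}$ and $\mathcal L^{1,\infty}_0:=\{T\in\mathcal K(\mathcal H):\sum_{k=1}^n\mu_k(T)=o(\log n)\}$ as $n\to\infty$. Box dimension: $d_B=d_B(\mathcal A,D,\mathcal H):=\left(\liminf_{n\to\infty}\frac{\log\mu_n(D^{-1})}{\log(1/n)}\right)^{-1}$. Hausdorff dimension: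 $d_H=d_H(\mathcal A,D,\mathcal H):=\inf\{d>0:|D|^{-d}\in\mathcal L^{1,\infty}_0\}=\sup\{d>0:|D|^{-d}\notin\mathcal L^{1,\infty}\}$. A singular trace on a two-sided ideal of compact operators in $\mathcal B(\mathcal H)$ is a positive, unitarily invariant linear functional on the ideal which vanishes on finite-rank projections. A positive compact operator $T$ is singularly traceable if there is a (finite, i.e. everywhere defined) non-zero singular trace on the two-sided ideal of $\mathcal B(\mathcal H)$ generated by $T$. *)

(* Defs.v *)
From HB Require Import structures.
From mathcomp Require Import all_boot all_order all_algebra.
From mathcomp Require Import sesquilinear complex.
From mathcomp Require Import all_classical all_reals all_analysis.
Import Order.TTheory GRing.Theory Num.Theory.
Import numFieldNormedType.Exports.

Set Implicit Arguments.
Unset Strict Implicit.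
Unset Printing Implicit Defensive.

Local Open Scope classical_set_scope.
Local Open Scope ring_scope.

(* Inner products are linear in the first argument and conjugate-linear in
   the second one, as in sesquilinear.v. *)

(* A Hilbert space is a complete normed C-module [H] whose norm comes from the
   inner product [ip]. *)
Definition is_hilbert (R : realType) (H : completeNormedModType R[i])
  (ip : {dot H for Num.conj}) : Prop := forall x : H, ip x x = `|x| ^+ 2.

Section BoundedOperators.
Context (R : realType) (H : completeNormedModType R[i]).
Context (ip : {dot H for Num.conj}).
Implicit Types (T U P : H -> H) (J : set (H -> H)).

Definition bounded_operator T : Prop := linear T /\ continuous T.

Definition compact_operator T : Prop :=
  bounded_operator T /\ precompact (T @` [set x : H | `|x| <= 1]).

(* Only meaningful for bounded [T], for which the adjoint exists. *)
Definition adjoint T : H -> H :=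
  xget (fun=> 0) [set S : H -> H | forall x y, ip (T x) y = ip x (S y)].

Definition positive_operator T : Prop := forall x, 0 <= ip (T x) x.

Definition unitary_operator U : Prop :=
  [/\ bounded_operator U, adjoint U \o U = id & U \o adjoint U = id].

Definition finite_rank T : Prop :=
  exists (n : nat) (e : 'I_n -> H), forall x, exists c : 'I_n -> R[i],
    T x = \sum_(i < n) c i *: e i.

Definition finite_rank_projection P : Prop :=
  [/\ bounded_operator P, P \o P = P, adjoint P = P & finite_rank P].

(* The singular values of [T] are the square roots of the eigenvalues of T^*T.
   The [n]-th one (counting from 1, in non-increasing order and with
   multiplicity) is the largest [s] such that there are [n] orthonormal
   eigenvectors of T^*T with eigenvalues t ^+ 2, s <= t; it is 0 if T^*T has
   fewer than [n] such eigenvectors with nonzero eigenvalues.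
   The value at n = 0 is meaningless. *)
Definition singular_value T (n : nat) : R :=
  sup [set s : R | s = 0 \/ 0 < s /\
    exists e : n.-tuple H, orthonormal ip e /\
      forall x, x \in tval e ->
        exists2 t : R, s <= t & adjoint T (T x) = (t ^+ 2)%:C%C *: x].

(* T is compact and \sum_(k <= n) mu_k(T) = o(log n). *)
Definition L1oo_0 T : Prop := compact_operator T /\
  (fun n : nat => \sum_(1 <= k < n.+1) singular_value T k : R^o)
    =o_\oo (fun n : nat => ln n%:R : R^o).

Definition two_sided_ideal J : Prop :=
  [/\ J `<=` bounded_operator,
      J (fun=> 0),
      forall (c : R[i]) S T, J S -> J T -> J (c *: S + T) &
      forall S T, bounded_operator S -> J T -> J (S \o T) /\ J (T \o S)].

Definition ideal_generated T : set (H -> H) := smallest two_sided_ideal [set T].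

(* [tau] is only relevant on [J]. *)
Definition singular_trace J (tau : (H -> H) -> R[i]) : Prop :=
  [/\ forall (c : R[i]) S T, J S -> J T -> tau (c *: S + T) = c * tau S + tau T,
      forall T, J T -> positive_operator T -> 0 <= tau T,
      forall U T, unitary_operator U -> J T ->
        tau (U \o T \o adjoint U) = tau T &
      forall P, J P -> finite_rank_projection P -> tau P = 0].

Definition singularly_traceable T : Prop :=
  [/\ compact_operator T, positive_operator T &
      exists2 tau : (H -> H) -> R[i], singular_trace (ideal_generated T) tau &
        exists2 S, ideal_generated T S & tau S != 0].

End BoundedOperators.

(* A possibly unbounded operator; the values of [op_fun] outside of [dom] are
   irrelevant. *)
Record operator (R : realType) (H : completeNormedModType R[i]) := Operator {
  dom : set H;
  op_fun :> H -> H
}.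

Section SpectralTriple.
Context (R : realType) (H : completeNormedModType R[i]).
Context (ip : {dot H for Num.conj}).
Implicit Types (D : operator H).

Definition linear_operator D : Prop :=
  dom D 0 /\ forall (c : R[i]) x y, dom D x -> dom D y ->
    dom D (c *: x + y) /\ D (c *: x + y) = c *: D x + D y.

(* The last clause says that D and its adjoint have the same graph. *)
Definition self_adjoint D : Prop :=
  [/\ linear_operator D, dense (dom D) &
      forall y z, (forall x, dom D x -> ip (D x) y = ip x z) <->
                  (dom D y /\ z = D y)].

(* [S] is the resolvent of D at [l], i.e. S = (D - l)^-1. *)
Definition is_resolvent D (l : R[i]) (S : H -> H) : Prop :=
  [/\ bounded_operator S,
      forall y, dom D (S y) /\ D (S y) - l *: S y = y &
      forall x, dom D x -> S (D x - l *: x) = x].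

Definition has_compact_resolvent D : Prop :=
  exists (l : R[i]) (S : H -> H), is_resolvent D l S /\ compact_operator S.

(* [A], with the product [mul], is an associative algebra, not necessarily
   unital, acting on [H] through [pi]. *)
Record spectral_triple (A : lmodType R[i]) (mul : {bilinear A -> A -> A})
    (pi : A -> H -> H) D : Prop := SpectralTriple {
  triple_mulA : associative mul;
  triple_bounded : forall a, bounded_operator (pi a);
  triple_linear : linear pi;
  triple_mul : forall a b, pi (mul a b) = pi a \o pi b;
  triple_self_adjoint : self_adjoint D;
  triple_commutator : forall a, exists M : R[i], forall x, dom D x ->
    dom D (pi a x) /\ `|D (pi a x) - pi a (D x)| <= M * `|x|;
  triple_compact_resolvent : has_compact_resolvent D
}.

Definition zero_not_eigenvalue D : Prop :=
  forall x, dom D x -> D x = 0 -> x = 0.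

(* D^-1, for injective D; it is everywhere defined when D is self-adjoint with
   compact resolvent and 0 is not an eigenvalue of D. *)
Definition inverse_operator D : H -> H :=
  fun y => xget 0 [set x | dom D x /\ D x = y].

(* Functional calculus f(D) for a self-adjoint D with compact resolvent and f
   bounded on the spectrum of D. By the spectral theorem, H is the closed span
   of the eigenspaces of D (whose eigenvalues are real), and f(D) is the
   bounded operator which acts as f(l) on the eigenspace of every
   eigenvalue l. *)
Definition functional_calculus D (f : R -> R) : H -> H :=
  xget (fun=> 0) [set T : H -> H | bounded_operator T /\
    forall (l : R) x, dom D x -> D x = l%:C%C *: x -> T x = (f l)%:C%C *: x].

(* |D|^-d *)
Definition abs_power_opp D (d : R) : H -> H :=
  functional_calculus D (fun l : R => `|l| `^ (- d)).

(* log (mu_n(D^-1)) / log (1 / n), with log 0 = -oo *)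
Definition log_ratio D (n : nat) : \bar R :=
  (lne (singular_value ip (inverse_operator D) n)%:E / lne (n%:R^-1)%:E)%E.

Definition singular_value_ratio D (n : nat) : R :=
  singular_value ip (inverse_operator D) n /
  singular_value ip (inverse_operator D) (2 * n).

(* The conventions 0^-1 = +oo and +oo^-1 = 0 are those of the library. *)
Definition box_dim D : \bar R := ((limn_einf (log_ratio D))^-1)%E.

Definition hausdorff_dim D : \bar R :=
  ereal_inf [set d%:E | d in [set d : R | 0 < d /\
    L1oo_0 ip (abs_power_opp D d)]].

End SpectralTriple.

(* Main.v *)
Require Import Defs.
From HB Require Import structures.
From mathcomp Require Import all_boot all_order all_algebra.
From mathcomp Require Import sesquilinear complex ring lra.
From mathcomp Require Import all_classical all_reals all_analysis.
Import Order.TTheory GRing.Theory Num.Theory.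
Import numFieldNormedType.Exports.
Import ComplexField.Normc.

(** Let K be the inverse of D. Because D has compact resolvent and trivial
kernel, K is a compact symmetric operator with dense range, so H has an
orthonormal basis e of eigenvectors of K ([inverse_spectral]); H is
infinite-dimensional since otherwise the box dimension would be 0
([finite_dim_box_dim]). Let t n be the moduli of the eigenvalues in
non-increasing order. They are the singular values of K, shifted by one, and
|D|^-d is the diagonal operator with coefficients t n ^ d
([inverse_operator_spectrum]). Everything becomes a question about the sequence
mu of singular values and about diagonal operators.

(a) If ln (mu n) / ln (1/n) tends to l, then mu n = n^(-l + o(1)). For d l > 1 the
terms mu n ^ d are o(1/n), and for d l < 1 they are eventually at least 1/n;
comparison with the harmonic series shows that the Hausdorff dimension is 1/l
([hausdorff_dim_limit]).

(b) If mu n / mu (2n) tends to L, telescoping along the powers of 2 shows that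
the logarithmic ratio tends to ln L / ln 2 ([ln_ratio_of_doubling]), so (a)
applies. The coefficients t n ^ d have the doubling ratio L^d, and L^d = 2
exactly when d is the box dimension. It remains to see that a positive diagonal
operator T with coefficients t and doubling ratio r is singularly traceable
exactly when r = 2.

If r = 2, put q k = t (2^k - 1). Every A in the ideal of T is approximated, for
every k, by some F k of rank O(2^k) with an error O(q k) in norm. A Banach limit
of (tr F (k+1) - tr F k) / (2^k q k) defines a trace of A: the normalising
weights 2^k q k have successive ratios tending to 1, hence another choice of F
changes the sequence by a telescoping one up to a null sequence, whose Banach
limit is 0 ([dyadic_rep_unique]). This trace is positive, unitarily invariant, zero on
finite-rank projections ([singular_trace_exists]) and nonzero on T
([dyadic_trace_diag_neq0]).

If r <> 2, let tau be a singular trace on the ideal of T. Every bounded operator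
is a linear combination of unitaries ([unitary_span_ind]), so tau (S B) = tau (B S).
Splitting the basis into two halves gives tau T as the sum of the traces of the
diagonal operators with coefficients t (2n) and t (2n+1). These two traces agree,
since the sequences interlace and tau ignores finitely many coefficients, and
the second is tau T / r. So r = 2 or tau T = 0, and in the second case a
Cauchy-Schwarz argument makes tau vanish on the whole ideal
([no_singular_trace]). *)

Set Implicit Arguments.
Unset Strict Implicit.
Unset Printing Implicit Defensive.

Local Open Scope classical_set_scope.
Local Open Scope ring_scope.
Local Open Scope complex_scope.

Local Notation Re := (@complex.Re _).
Local Notation Im := (@complex.Im _).

(** * Modulus of complex numbers *)

Section Complex.
Variable R : realType.
Implicit Types a b : R[i].

(** The library norm on R[i] takes its values in R[i]; real-valued moduli are
needed for the decision procedures of ordered fields. *)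
Definition cabs a : R := normc a.

Lemma cabs0 : cabs 0 = 0. Proof. exact: normc0. Qed.
Lemma cabs1 : cabs 1 = 1. Proof. exact: normc1. Qed.
Lemma cabsM a b : cabs (a * b) = cabs a * cabs b. Proof. exact: normcM. Qed.
Lemma cabsV a : cabs a^-1 = (cabs a)^-1. Proof. exact: normcV. Qed.
Lemma cabsN a : cabs (- a) = cabs a. Proof. exact: normcN. Qed.
Lemma le_cabsD a b : cabs (a + b) <= cabs a + cabs b. Proof. exact: le_normcD. Qed.

Lemma cabsE a : `|a| = (cabs a)%:C :> R[i].
Proof. by rewrite normc_def; case: a. Qed.

Lemma cabsR (r : R) : cabs r%:C = `|r|.
Proof. by rewrite /= expr0n addr0 sqrtr_sqr. Qed.

Lemma cabs_ge0 a : 0 <= cabs a.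
Proof. by case: a => x y; exact: sqrtr_ge0. Qed.

Lemma cabs_conj a : cabs (Num.conj a) = cabs a.
Proof. by apply: complexI; rewrite -!cabsE norm_conjC. Qed.

Lemma Re_cabs a : Re a <= cabs a.
Proof.
case: a => x y /=; apply: le_trans (ler_norm _) _.
by rewrite -sqrtr_sqr ler_sqrt ?lerDl ?addr_ge0 ?sqr_ge0.
Qed.

Lemma normRe_cabs a : `|Re a| <= cabs a.
Proof.
case: a => x y /=.
by rewrite -sqrtr_sqr ler_sqrt ?lerDl ?addr_ge0 ?sqr_ge0.
Qed.

Lemma normIm_cabs a : `|Im a| <= cabs a.
Proof.
case: a => x y /=.
by rewrite -sqrtr_sqr ler_sqrt ?lerDr ?addr_ge0 ?sqr_ge0.
Qed.

Lemma cabs_ReIm a : cabs a <= `|Re a| + `|Im a|.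
Proof.
rewrite [in cabs _](complexE a) (le_trans (le_cabsD _ _))//.
by rewrite cabsM !cabsR /= expr0n add0r expr1n sqrtr1 mul1r.
Qed.

Lemma cabs2 a : a * Num.conj a = (cabs a ^+ 2)%:C.
Proof. by rewrite -normCK cabsE -rmorphXn. Qed.

Lemma ReD a b : Re (a + b) = Re a + Re b.
Proof. by case: a b => ? ? [? ?]. Qed.
Lemma ReN a : Re (- a) = - Re a.
Proof. by case: a => ? ?. Qed.
Lemma ReB a b : Re (a - b) = Re a - Re b.
Proof. by rewrite ReD ReN. Qed.
Lemma ImD a b : Im (a + b) = Im a + Im b.
Proof. by case: a b => ? ? [? ?]. Qed.
Lemma ImN a : Im (- a) = - Im a.
Proof. by case: a => ? ?. Qed.
Lemma ReZ (r : R) a : Re (r%:C * a) = r * Re a.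
Proof. by case: a => x y /=; rewrite mul0r subr0. Qed.
Lemma Re_conj a : Re (Num.conj a) = Re a.
Proof. by case: a. Qed.
Lemma Re_sum (I : Type) (r : seq I) (P : pred I) (F : I -> R[i]) :
  Re (\sum_(i <- r | P i) F i) = \sum_(i <- r | P i) Re (F i).
Proof. by apply: (big_morph _ ReD). Qed.
Lemma cabs_sum (I : Type) (r : seq I) (P : pred I) (F : I -> R[i]) :
  cabs (\sum_(i <- r | P i) F i) <= \sum_(i <- r | P i) cabs (F i).
Proof.
elim/big_ind2 : _ => [|x a y b xa yb|//]; first by rewrite cabs0.
by rewrite (le_trans (le_cabsD _ _))// lerD.
Qed.
Lemma conjcR (r : R) : Num.conj r%:C = r%:C.
Proof. by apply/CrealP; rewrite complex_real. Qed.
Lemma realC_div (r s : R) : (r / s)%:C = r%:C / s%:C :> R[i].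
Proof.
rewrite rmorphM; congr (_ * _); have [->|s0] := eqVneq s 0; first by rewrite !invr0.
have sC : s%:C != 0 by rewrite (inj_eq (@complexI _) _ 0).
by apply: (mulfI sC); rewrite mulfV// -rmorphM mulfV.
Qed.

Lemma conjM a b : Num.conj (a * b) = Num.conj a * Num.conj b.
Proof. exact: rmorphM. Qed.

Lemma conj_i : Num.conj ('i : R[i]) = - 'i.
Proof. by apply/eqP; rewrite eq_complex /= oppr0 !eqxx. Qed.

Lemma succ_inv_small (e : R) : 0 < e ->
  exists N : nat, forall n, (N <= n)%N -> n.+1%:R^-1 < e.
Proof.
move=> e0; exists (Num.truncn e^-1) => n Nn.
by rewrite invf_plt ?posrE// (lt_le_trans (truncnS_gt _))// ler_nat ltnS.
Qed.

Lemma noninc_le (u : nat -> R) m n : (forall n, u n.+1 <= u n) -> (m <= n)%N ->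
  u n <= u m.
Proof. by move=> /nonincreasing_seqP; exact. Qed.

End Complex.

(** * Hilbert space geometry with a real-valued norm *)

Section Hilbert.
Context (R : realType) (H : completeNormedModType R[i]).
Context (ip : {dot H for Num.conj}) (hH : is_hilbert ip).
Implicit Types (x y z : H) (a b : R[i]).

(** The norm of H is a complex number; this is the corresponding real one. *)
Definition nm x : R := Re `|x|.

Lemma nmE x : `|x| = (nm x)%:C :> R[i].
Proof. by rewrite /nm RRe_real// ger0_real. Qed.

Lemma nm_ge0 x : 0 <= nm x.
Proof. by rewrite -ler0c -nmE. Qed.

Lemma nm0 : nm 0 = 0.
Proof. by rewrite /nm normr0. Qed.

Lemma nm_eq0 x : (nm x == 0) = (x == 0).
Proof. by rewrite -[RHS]normr_eq0 nmE (inj_eq (@complexI _)). Qed.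

Lemma nm0_eq0 x : nm x = 0 -> x = 0.
Proof. by move/eqP; rewrite nm_eq0 => /eqP. Qed.

(** Orthonormality gives the squares of norms. *)
Lemma nm2_eq1 x : nm x ^+ 2 = 1 -> nm x = 1.
Proof.
move/eqP; rewrite sqrf_eq1 => /orP[/eqP//|/eqP h].
by have := nm_ge0 x; rewrite h oppr_ge0 ler10.
Qed.

Lemma nmZ a x : nm (a *: x) = cabs a * nm x.
Proof. by apply: complexI; rewrite -nmE normrZ cabsE nmE [RHS]rmorphM. Qed.

Lemma nmN x : nm (- x) = nm x.
Proof. by rewrite /nm normrN. Qed.

Lemma nmD x y : nm (x + y) <= nm x + nm y.
Proof. by rewrite -lecR rmorphD /= -!nmE; exact: ler_normD. Qed.

Lemma nmB x y : nm (x - y) <= nm x + nm y.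
Proof. by rewrite -(nmN y) nmD. Qed.

Lemma nmBC x y : nm (x - y) = nm (y - x).
Proof. by rewrite -nmN opprB. Qed.

Lemma nm_tri z x y : nm (x - y) <= nm (x - z) + nm (z - y).
Proof. by rewrite -[X in nm X](subrKA z) (le_trans (nmD _ _)). Qed.

Lemma nm_sum (I : Type) (r : seq I) (P : pred I) (F : I -> H) :
  nm (\sum_(i <- r | P i) F i) <= \sum_(i <- r | P i) nm (F i).
Proof.
elim/big_ind2 : _ => [|x a y b xa yb|//]; first by rewrite nm0.
by rewrite (le_trans (nmD _ _))// lerD.
Qed.

Lemma ipxx x : ip x x = (nm x ^+ 2)%:C.
Proof. by rewrite hH nmE rmorphXn. Qed.

Lemma Re_ipxx x : Re (ip x x) = nm x ^+ 2.
Proof. by rewrite ipxx. Qed.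

Lemma ipC x y : ip x y = Num.conj (ip y x).
Proof. by rewrite hermC expr0 mul1r. Qed.

Lemma ipDl x y z : ip (x + y) z = ip x z + ip y z.
Proof. exact: linearDl. Qed.
Lemma ipDr x y z : ip z (x + y) = ip z x + ip z y.
Proof. exact: linearDr. Qed.
Lemma ipBl x y z : ip (x - y) z = ip x z - ip y z.
Proof. exact: linearBl. Qed.
Lemma ipBr x y z : ip z (x - y) = ip z x - ip z y.
Proof. exact: linearBr. Qed.
Lemma ipZl a x y : ip (a *: x) y = a * ip x y.
Proof. exact: linearZl_LR. Qed.
Lemma ipZr a x y : ip x (a *: y) = Num.conj a * ip x y.
Proof. exact: linearZr_LR. Qed.
Lemma ip0l x : ip 0 x = 0.
Proof. exact: linear0l. Qed.
Lemma ip0r x : ip x 0 = 0.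
Proof. exact: linear0r. Qed.
Lemma ipNl x y : ip (- x) y = - ip x y.
Proof. exact: linearNl. Qed.
Lemma ipNr x y : ip x (- y) = - ip x y.
Proof. exact: linearNr. Qed.
Lemma ip_suml (I : Type) (r : seq I) (P : pred I) (F : I -> H) y :
  ip (\sum_(i <- r | P i) F i) y = \sum_(i <- r | P i) ip (F i) y.
Proof. exact: linear_sumlz. Qed.
Lemma ip_sumr (I : Type) (r : seq I) (P : pred I) (F : I -> H) y :
  ip y (\sum_(i <- r | P i) F i) = \sum_(i <- r | P i) ip y (F i).
Proof. exact: linear_sumr. Qed.

Lemma nmD2 x y : nm (x + y) ^+ 2 = nm x ^+ 2 + nm y ^+ 2 + 2 * Re (ip x y).
Proof.
by rewrite -!Re_ipxx ipDl !ipDr (ipC y x) !ReD Re_conj; ring.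
Qed.

Lemma nmB2 x y : nm (x - y) ^+ 2 = nm x ^+ 2 + nm y ^+ 2 - 2 * Re (ip x y).
Proof. by rewrite nmD2 nmN ipNr ReN mulrN. Qed.

Lemma nm_orthoD x y : ip x y = 0 -> nm (x + y) ^+ 2 = nm x ^+ 2 + nm y ^+ 2.
Proof. by move=> h; rewrite nmD2 h mulr0 addr0. Qed.

Lemma parallelogram x y :
  nm (x + y) ^+ 2 + nm (x - y) ^+ 2 = 2 * nm x ^+ 2 + 2 * nm y ^+ 2.
Proof. by rewrite nmD2 nmB2; ring. Qed.

(** Expand the square norm of |y|^2 x - <x,y> y, which is nonnegative. *)
Lemma cauchy_schwarz x y : cabs (ip x y) <= nm x * nm y.
Proof.
rewrite -(@ler_pXn2r _ 2) ?nnegrE ?mulr_ge0 ?nm_ge0 ?cabs_ge0//.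
have [->|y0] := eqVneq y 0; first by rewrite ip0r cabs0 nm0 mulr0.
have ny : 0 < nm y by rewrite lt_def nm_eq0 y0 nm_ge0.
have := sqr_ge0 (nm ((nm y ^+ 2)%:C *: x - ip x y *: y)).
rewrite nmB2 ipZl ipZr !nmZ.
rewrite (_ : Re _ = nm y ^+ 2 * cabs (ip x y) ^+ 2); last first.
  by rewrite mulrC [_ * ip x y]mulrC cabs2 -rmorphM /= mulrC.
rewrite cabsR ger0_norm ?sqr_ge0// => h.
have : 0 <= nm y ^+ 2 * (nm x ^+2 * nm y ^+2 - cabs (ip x y) ^+ 2).
  by rewrite (le_trans h)// le_eqVlt; apply/orP; left; apply/eqP; ring.
by rewrite pmulr_rge0 ?exprn_gt0// exprMn subr_ge0.
Qed.

Lemma Re_ip_le x y : Re (ip x y) <= nm x * nm y.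
Proof. exact: le_trans (Re_cabs _) (cauchy_schwarz _ _). Qed.

Lemma ip_eq x y : (forall z, ip x z = ip y z) -> x = y.
Proof.
move=> h; apply/eqP; rewrite -subr_eq0 -nm_eq0 -sqrf_eq0 -Re_ipxx.
by rewrite ipBl h subrr.
Qed.

Lemma ip_eqr x y : (forall z, ip z x = ip z y) -> x = y.
Proof. by move=> h; apply: ip_eq => z; rewrite ipC h -ipC. Qed.

(** The topology of H is defined by balls with radii in R[i]; from here on only
real radii occur. *)
Lemma nbhs_nm x (A : set H) :
  nbhs x A <-> exists2 e : R, 0 < e & forall y, nm (x - y) < e -> A y.
Proof.
split=> [/nbhs_ballP[e /= e0 h]|[e e0 h]].
  move: e e0 h => [e i]; rewrite ltcE /= => /andP[/eqP -> e0] h.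
  by exists e => // y ye; apply: h; rewrite -ball_normE /= nmE ltcR.
apply/nbhs_ballP; exists e%:C; first by rewrite /= ltcR.
by move=> y; rewrite -ball_normE /= nmE ltcR => /h.
Qed.

Lemma cvg_nm (T : Type) (F : set_system T) (FF : Filter F) (f : T -> H) x :
  (f t @[t --> F] --> x) <->
  (forall e : R, 0 < e -> \forall t \near F, nm (x - f t) < e).
Proof.
split=> [h e e0|h A /nbhs_nm[e e0 eA]].
  by apply: (h [set y | nm (x - y) < e]); apply/nbhs_nm; exists e.
by apply: filterS (h e e0) => t /eA.
Qed.

Lemma cvgn_nm (u : nat -> H) x : (u @ \oo --> x) <->
  (forall e : R, 0 < e -> exists N, forall n, (N <= n)%N -> nm (x - u n) < e).
Proof.
split=> [/cvg_nm h e /h[N _ hN]|h]; first by exists N => n Nn; exact: hN.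
by apply/cvg_nm => e /h[N hN]; exists N.
Qed.

Lemma cauchy_nm (F : set_system H) (FF : ProperFilter F) :
  (forall e : R, 0 < e -> exists x, \forall y \near F, nm (x - y) < e) ->
  exists l : H, F --> l.
Proof.
move=> h; suff : cvg F by move/cvg_ex.
apply: cauchy_cvg; apply: cauchy_exP => -[e i].
rewrite ltcE /= => /andP[/eqP -> e0].
have [x hx] := h _ e0; exists x.
by apply: filterS hx => y; rewrite -ball_normE /= nmE ltcR.
Qed.

Lemma complete_seq (u : nat -> H) :
  (forall e : R, 0 < e -> exists N, forall n, (N <= n)%N -> nm (u N - u n) < e) ->
  exists l : H, u @ \oo --> l.
Proof.
move=> h; apply: cauchy_nm => e e0.
have [N hN] := h e e0; exists (u N); exists N => //.
Qed.

Lemma cvg_unique_nm (u : nat -> H) x y :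
  u @ \oo --> x -> u @ \oo --> y -> x = y.
Proof.
move=> /cvgn_nm hx /cvgn_nm hy; apply/eqP; rewrite -subr_eq0 -nm_eq0.
rewrite eq_le nm_ge0 andbT; apply/ler_addgt0Pr => e e0; rewrite add0r.
have e20 : 0 < e / 2 by rewrite divr_gt0.
have [N hN] := hx _ e20; have [M hM] := hy _ e20.
apply: (le_trans (nm_tri (u (maxn N M)) _ _)).
rewrite [e]splitr ltW// ltrD// ?hN ?leq_maxl//.
by rewrite nmBC hM // leq_maxr.
Qed.

Lemma le_nm_eps x y : (forall e : R, 0 < e -> nm (x - y) < e) -> x = y.
Proof.
move=> h; apply/eqP; rewrite -subr_eq0 -nm_eq0.
rewrite eq_le nm_ge0 andbT; apply/ler_addgt0Pr => e e0; rewrite add0r.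
exact/ltW/h.
Qed.

(** Continuity at 0 gives a bound on a small ball, and homogeneity spreads it. *)
Lemma bounded_operatorP (T : H -> H) : bounded_operator T <->
  linear T /\ exists2 M : R, 0 <= M & forall x, nm (T x) <= M * nm x.
Proof.
split=> [[lT cT]|[lT [M M0 hM]]].
  split=> //.
  pose LT := GRing.isLinear.Build _ _ _ _ _ lT.
  pose f : {linear H -> H} := HB.pack T LT.
  have T0 : T 0 = 0 by exact: (raddf0 f).
  have TZ c x : T (c *: x) = c *: T x by exact: (linearZ_LR f).
  have := cT 0; rewrite /continuous_at => /cvg_nm.
  move=> /(_ 1 ltr01); rewrite T0 => /nbhs_nm[e e0 he].
  exists (2 / e); first by rewrite divr_ge0// ltW.
  move=> x; have [->|x0] := eqVneq x 0; first by rewrite T0 nm0 mulr0.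
  have nx : 0 < nm x by rewrite lt_def nm_eq0 x0 nm_ge0.
  have c0 : 0 < e / (2 * nm x) by rewrite divr_gt0// mulr_gt0.
  have := he ((e / (2 * nm x))%:C *: x).
  rewrite !sub0r !nmN TZ !nmZ cabsR ger0_norm; last exact: ltW.
  have -> : e / (2 * nm x) * nm x = e / 2 by field; rewrite gt_eqF.
  have he2 : e / 2 < e by rewrite ltr_pdivrMr // mulr_natr mulr2n ltrDl.
  move=> /(_ he2)/ltW h.
  have -> : nm (T x) = 2 / e * nm x * (e / (2 * nm x) * nm (T x)).
    by field; rewrite !gt_eqF.
  by rewrite ler_piMr// mulr_ge0 ?nm_ge0// divr_ge0// ltW.
split=> // x; apply/cvg_nm => e e0; apply/nbhs_nm.
exists (e / (M + 1)); first by rewrite divr_gt0// ltr_wpDl.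
move=> y; rewrite ltr_pdivlMr ?ltr_wpDl// => h.
have -> : T x - T y = T (x - y).
  by rewrite addrC -scaleN1r -lT scaleN1r addrC.
apply: le_lt_trans h; rewrite (le_trans (hM _))// mulrC ler_wpM2l ?nm_ge0//.
by rewrite lerDl.
Qed.

End Hilbert.

(** * Bounded linear maps *)

Section LinearMaps.
Context (R : realType) (H : completeNormedModType R[i]).
Context (ip : {dot H for Num.conj}) (hH : is_hilbert ip).
Implicit Types (x y z : H) (a b : R[i]) (T S K : H -> H).

Lemma lin0 T : linear T -> T 0 = 0.
Proof.
move=> lT; have := lT (-1) 0 0; rewrite scaleN1r oppr0 addr0 => h.
by rewrite h scaleN1r addNr.
Qed.

Lemma linZ T a x : linear T -> T (a *: x) = a *: T x.
Proof. by move=> lT; have := lT a x 0; rewrite (lin0 lT) !addr0. Qed.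

Lemma linD T x y : linear T -> T (x + y) = T x + T y.
Proof. by move=> lT; have := lT 1 x y; rewrite !scale1r. Qed.

Lemma linN T x : linear T -> T (- x) = - T x.
Proof. by move=> lT; rewrite -scaleN1r linZ// scaleN1r. Qed.

Lemma linB T x y : linear T -> T (x - y) = T x - T y.
Proof. by move=> lT; rewrite linD// linN. Qed.

Lemma lin_sum T (I : Type) (r : seq I) (P : pred I) (F : I -> H) : linear T ->
  T (\sum_(i <- r | P i) F i) = \sum_(i <- r | P i) T (F i).
Proof.
move=> lT; apply: (big_morph T); last exact: lin0.
by move=> x y; exact: linD.
Qed.

Lemma bo_lin T : bounded_operator T -> linear T. Proof. by case. Qed.

Lemma bo_intro T (M : R) : linear T -> (forall x, nm (T x) <= M * nm x) ->
  bounded_operator T.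
Proof.
move=> lT hM; apply/bounded_operatorP; split=> //; exists `|M| => // x.
by rewrite (le_trans (hM x))// ler_wpM2r ?nm_ge0// ler_norm.
Qed.

Lemma bo_norm T : bounded_operator T ->
  exists2 M : R, 0 < M & forall x, nm (T x) <= M * nm x.
Proof.
move=> /bounded_operatorP[_ [M M0 hM]]; exists (M + 1); first by rewrite ltr_wpDl.
by move=> x; rewrite (le_trans (hM x))// ler_wpM2r ?nm_ge0// lerDl.
Qed.

Lemma bo_id : bounded_operator (idfun : H -> H).
Proof. by apply: (@bo_intro _ 1) => // x; rewrite mul1r. Qed.

Lemma bo0 : bounded_operator (fun=> 0 : H).
Proof.
apply: (@bo_intro _ 0) => [a x y|x]; first by rewrite scaler0 addr0.
by rewrite nm0 mul0r.
Qed.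

Lemma bo_comp T S : bounded_operator T -> bounded_operator S ->
  bounded_operator (T \o S).
Proof.
move=> bT bS; have [M M0 hM] := bo_norm bT; have [N N0 hN] := bo_norm bS.
apply: (@bo_intro _ (M * N)) => [a x y|x /=].
  by rewrite /= (bo_lin bS) (bo_lin bT).
by rewrite (le_trans (hM _))// -mulrA ler_wpM2l// ltW.
Qed.

Lemma bo_lincomb a T S : bounded_operator T -> bounded_operator S ->
  bounded_operator (a *: T + S).
Proof.
move=> bT bS; have [M M0 hM] := bo_norm bT; have [N N0 hN] := bo_norm bS.
apply: (@bo_intro _ (cabs a * M + N)) => [b x y|x /=].
  rewrite /= !fctE (bo_lin bS) (bo_lin bT) !scalerDr !scalerA (mulrC a) -!addrA.
  by congr (_ + _); rewrite addrCA.
rewrite (le_trans (nmD _ _))// mulrDl lerD// !fctE nmZ -mulrA ler_wpM2l//.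
exact: cabs_ge0.
Qed.

Lemma boD T S : bounded_operator T -> bounded_operator S ->
  bounded_operator (T + S).
Proof. by move=> bT bS; rewrite -[T]scale1r; exact: bo_lincomb. Qed.

Lemma boZ a T : bounded_operator T -> bounded_operator (a *: T).
Proof.
by move=> bT; rewrite -[_ *: _]addr0; exact: (bo_lincomb _ _ bo0).
Qed.

Lemma boB T S : bounded_operator T -> bounded_operator S ->
  bounded_operator (T - S).
Proof.
by move=> bT bS; rewrite addrC -scaleN1r; exact: bo_lincomb.
Qed.

Lemma bo_cvg T (u : nat -> H) x : bounded_operator T ->
  u @ \oo --> x -> (T \o u) @ \oo --> T x.
Proof.
move=> bT /cvgn_nm h; apply/cvgn_nm => e e0.
have [M M0 hM] := bo_norm bT.
have [N hN] := h _ (divr_gt0 e0 M0); exists N => n /hN.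
rewrite ltr_pdivlMr// => {}hN; rewrite /= -(linB _ _ (bo_lin bT)).
by rewrite (le_lt_trans (hM _))// mulrC.
Qed.

(** The building block of projections and of deflated operators. *)
Lemma bo_rank1 u v : bounded_operator (fun x => ip x u *: v).
Proof.
apply: (@bo_intro _ (nm u * nm v)) => [a x y|x].
  by rewrite ipDl ipZl scalerDl scalerA.
by rewrite nmZ mulrAC ler_wpM2r ?nm_ge0// mulrC cauchy_schwarz.
Qed.

Lemma nm_continuous : continuous (@nm R H).
Proof.
move=> x; apply/cvgrPdist_lt => e e0.
apply/nbhs_nm; exists e => // y; apply: le_lt_trans.
rewrite ler_norml; apply/andP; split.
  rewrite lerBDl -lerBDr opprK -[X in nm X](subrK x y) nmBC.
  by rewrite (le_trans (nmD _ _))// addrC.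
by rewrite lerBlDr -[X in nm X](subrK y x) nmD.
Qed.

Lemma closure_nm (A : set H) x : closure A x <->
  (forall e : R, 0 < e -> exists2 y, A y & nm (x - y) < e).
Proof.
split=> [h e e0|h B /nbhs_nm[e e0 eB]].
  have [|y [Ay hy]] := h [set y | nm (x - y) < e]; last by exists y.
  by apply/nbhs_nm; exists e.
by have [y Ay /eB By] := h e e0; exists y.
Qed.

(** S maps the unit ball into a ball of radius M, whose image under K is M times a
precompact set. *)
Lemma compact_operator_comp K S : compact_operator K -> bounded_operator S ->
  compact_operator (K \o S).
Proof.
move=> [bK cK] bS; split; first exact: bo_comp.
have [M M0 hM] := bo_norm bS.
move: cK; rewrite precompactE => cK.
have sc : continuous (fun x : H => M%:C *: x).
  by apply: (proj2 (_ : bounded_operator _)); exact: boZ bo_id.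
have cMK : compact ((fun x : H => M%:C *: x) @` closure (K @` [set x | `|x| <= 1])).
  by apply: continuous_compact => //; exact: continuous_subspaceT.
apply: precompact_subset (compact_precompact _ cMK); last exact: norm_hausdorff.
move=> _ [x /= x1 <-]; exists (K (M%:C^-1 *: S x)).
  apply: subset_closure; exists (M%:C^-1 *: S x) => //=.
  rewrite nmE nmZ cabsV cabsR gtr0_norm// lecR mulrC ler_pdivrMr// mul1r.
  rewrite (le_trans (hM x))// -[leRHS]mulr1 ler_wpM2l ?(ltW M0)//.
  by move: x1; rewrite nmE lecR.
rewrite (linZ _ _ (bo_lin bK)) scalerA divff ?scale1r//.
by rewrite (inj_eq (@complexI _) _ 0) gt_eqF.
Qed.

End LinearMaps.

(** * Projections, Riesz representation and adjoints *)

Section Projection.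
Context (R : realType) (H : completeNormedModType R[i]).
Context (ip : {dot H for Num.conj}) (hH : is_hilbert ip).
Implicit Types (x y z : H) (a b : R[i]) (T S K : H -> H).

(** Closedness is sequential, as the limits that occur are limits of sequences. *)
Definition closed_subspace (M : set H) : Prop :=
  [/\ M 0, forall a x y, M x -> M y -> M (a *: x + y) &
      forall (u : nat -> H) x, (forall n, M (u n)) -> u @ \oo --> x -> M x].

(** Subtracting from x its projection on z shortens it unless <x, z> = 0. *)
Lemma minimal_orthogonal x z :
  (forall a, nm x <= nm (x - a *: z)) -> ip x z = 0.
Proof.
move=> h; apply/eqP; have [->|z0] := eqVneq z 0; first by rewrite ip0r.
have nz : 0 < nm z by rewrite lt_def nm_eq0 z0 nm_ge0.
have nz2 : 0 < nm z ^+ 2 by rewrite exprn_gt0.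
have := h ((nm z ^+ 2)^-1%:C * ip x z).
rewrite -(@ler_pXn2r _ 2) ?nnegrE ?nm_ge0// (nmB2 hH).
rewrite nmZ ipZr conjM conjcR -mulrA (mulrC (Num.conj _)) cabs2 -rmorphM.
rewrite [Re _]/= cabsM cabsR ger0_norm ?invr_ge0 ?(ltW nz2)//.
have -> : ((nm z ^+ 2)^-1 * cabs (ip x z) * nm z) ^+ 2 =
   (nm z ^+ 2)^-1 * cabs (ip x z) ^+ 2 by field; rewrite gt_eqF.
set t := _^-1 * _ => ht.
have : t <= 0 by lra.
rewrite /t pmulr_rle0 ?invr_gt0// => h0.
have /eqP : cabs (ip x z) ^+ 2 = 0 by apply/eqP; rewrite eq_le h0 sqr_ge0.
by rewrite sqrf_eq0 => /eqP/eq0_normc ->.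
Qed.

(** A minimizing sequence for the distance to M is Cauchy by the parallelogram
law, and the error vector of its limit is orthogonal to M. *)
Lemma projection_theorem (M : set H) x : closed_subspace M ->
  exists2 y, M y & forall z, M z -> ip (x - y) z = 0.
Proof.
move=> [M0 Mlin Mcl].
pose A : set R := [set r | exists2 y, M y & r = nm (x - y)].
have A0 : A !=set0 by exists (nm (x - 0)), 0.
have lbA : lbound A 0 by move=> _ [y _ ->]; exact: nm_ge0.
have hiA : has_inf A by split => //; exists 0.
pose d := inf A.
have d0 : 0 <= d by exact: lb_le_inf.
have dle y : M y -> d <= nm (x - y).
  by move=> My; apply: ge_inf; [exists 0|exists y].
have dlt e : 0 < e -> exists2 y, M y & nm (x - y) < d + e.
  by move=> e0; have [_ [y My ->] hy] := inf_adherent e0 hiA; exists y.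
have Mhalf y z : M y -> M z -> M (2^-1%:C *: (y + z)).
  move=> My Mz; rewrite -[X in M X]addr0; apply: (Mlin) => //.
  by rewrite -[y]scale1r; exact: Mlin.
(* parallelogram law for x - y and x - z, whose midpoint is at distance at
   least d from M *)
have key e y z : M y -> M z -> nm (x - y) < d + e -> nm (x - z) < d + e ->
    nm (y - z) ^+ 2 <= 4 * (2 * d * e + e ^+ 2).
  move=> My Mz hy hz.
  have := parallelogram hH (x - z) (x - y).
  have -> : x - z - (x - y) = y - z by rewrite opprB addrC addrA subrK.
  have -> : x - z + (x - y) = 2%:C *: (x - 2^-1%:C *: (y + z)).
    rewrite scalerBr scalerA -rmorphM divff// scale1r.
    rewrite (_ : 2%:C = 1 + 1 :> R[i]) ?rmorphD// scalerDl scale1r.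
    by rewrite opprD addrACA (addrC (- z)).
  rewrite nmZ cabsR ger0_norm// => E.
  have := dle _ (Mhalf _ _ My Mz).
  set m := nm (x - _ *: _) in E *; move=> dm.
  have e0 : 0 < d + e by exact: le_lt_trans (nm_ge0 _) hy.
  have : nm (x - y) ^+ 2 < (d + e) ^+ 2 by rewrite ltr_pXn2r ?nnegrE ?nm_ge0 ?ltW.
  have : nm (x - z) ^+ 2 < (d + e) ^+ 2 by rewrite ltr_pXn2r ?nnegrE ?nm_ge0 ?ltW.
  have : d ^+ 2 <= m ^+ 2 by rewrite ler_pXn2r ?nnegrE ?nm_ge0.
  move: E; rewrite exprMn; nra.
have {}dlt (n : nat) : {y | M y /\ nm (x - y) < d + n.+1%:R^-1}.
  apply: cid; have [y My hy] := dlt n.+1%:R^-1 (ltac:(by rewrite invr_gt0)).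
  by exists y.
pose u n := sval (dlt n).
have uM n : M (u n) by case: (svalP (dlt n)).
have ud n : nm (x - u n) < d + n.+1%:R^-1 by case: (svalP (dlt n)).
have udN N n : (N <= n)%N -> nm (x - u n) < d + N.+1%:R^-1.
  move=> Nn; rewrite (lt_le_trans (ud n))// lerD2l lef_pV2 ?posrE//.
  by rewrite ler_nat.
have [y uy] : exists y : H, u @ \oo --> y.
  apply: complete_seq => e e0.
  (* with 1/(N+1) = q <= 1 the estimate of key is at most 4 (2 d + 1) q *)
  have c0 : 0 < Num.min 1 (e ^+ 2 / (4 * (2 * d + 1) + 1)).
    rewrite lt_min ltr01 /= divr_gt0 ?exprn_gt0// ltr_wpDl// mulr_ge0//.
    by rewrite addr_ge0// mulr_ge0.
  have [N hN] := succ_inv_small c0; exists N => n Nn.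
  have := key N.+1%:R^-1 (u N) (u n) (uM _) (uM _) (ud _) (udN _ _ Nn).
  have := hN N (leqnn _); rewrite lt_min => /andP[].
  set q := _^-1 => q1 q2 h.
  have q0 : 0 < q by rewrite /q invr_gt0.
  rewrite -(@ltr_pXn2r _ 2) ?nnegrE ?nm_ge0 ?ltW//.
  apply: (le_lt_trans h).
  move: q2; rewrite ltr_pdivlMr; last first.
    by rewrite ltr_wpDl// mulr_ge0// addr_ge0// mulr_ge0.
  apply: le_lt_trans.
  have : q ^+ 2 <= q by rewrite expr2 ler_piMr ?ltW.
  nra.
have My : M y by exact: Mcl uM uy.
have yd : nm (x - y) <= d.
  apply/ler_addgt0Pr => e e0.
  have e20 : 0 < e / 2 by rewrite divr_gt0.
  have /cvgn_nm/(_ _ e20)[N hN] := uy.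
  have [N' hN'] := succ_inv_small e20.
  have := nm_tri (u (maxn N N')) x y.
  have := ud (maxn N N'); have := hN' _ (leq_maxr N N').
  have := hN _ (leq_maxl N N'); rewrite nmBC.
  set a := nm _; set b := nm _; set c := nm _; set f := (maxn N N').+1%:R^-1.
  lra.
exists y => // z Mz; apply: minimal_orthogonal => a.
rewrite (le_trans yd)// -addrA -opprD; apply: dle.
by rewrite addrC; exact: Mlin.
Qed.

Lemma dense_of_orthogonal (M : set H) : closed_subspace M ->
  (forall y, (forall x, M x -> ip x y = 0) -> y = 0) -> forall y, M y.
Proof.
move=> cM h x; have [y My hy] := projection_theorem x cM.
have /h/eqP : forall z, M z -> ip z (x - y) = 0.
  by move=> z /hy; rewrite ipC => /(congr1 Num.conj); rewrite conjCK rmorph0.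
by rewrite subr_eq0 => /eqP ->.
Qed.

(** The representing vector is a multiple of any vector orthogonal to the kernel
of f. *)
Lemma riesz (f : H -> R[i]) (M : R) :
  (forall a x y, f (a *: x + y) = a * f x + f y) ->
  (forall x, cabs (f x) <= M * nm x) -> exists y, forall x, f x = ip x y.
Proof.
move=> lf bf.
have f0 : f 0 = 0.
  by have := lf (-1) 0 0; rewrite scaleN1r oppr0 addr0 mulN1r addNr.
have fB x y : f (x - y) = f x - f y.
  by have := lf (-1) y x; rewrite scaleN1r addrC mulN1r [RHS]addrC.
have fZ a x : f (a *: x) = a * f x by have := lf a x 0; rewrite f0 !addr0.
have cK : closed_subspace [set x | f x = 0].
  split => //= [a x y fx fy|u x fu ux]; first by rewrite lf fx fy mulr0 addr0.
  apply: eq0_normc; apply/eqP; rewrite eq_le cabs_ge0 andbT.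
  apply/ler_addgt0Pr => e e0; rewrite add0r.
  have M1 : 0 < `|M| + 1 by rewrite ltr_wpDl.
  have /cvgn_nm/(_ _ (divr_gt0 e0 M1))[N hN] := ux.
  have := hN N (leqnn _); rewrite ltr_pdivlMr// => h.
  rewrite -[f x]subr0 -(fu N) -fB (le_trans (bf _))// (le_trans _ (ltW h))//.
  rewrite mulrC ler_wpM2l ?nm_ge0// (le_trans (ler_norm M))// lerDl.
  by [].
have [[x0 fx0]|nf] := pselect (exists x, f x != 0); last first.
  exists 0 => x; rewrite ip0r; apply/eqP/negPn/negP => fx; apply: nf.
  by exists x.
have [p fp hp] := projection_theorem x0 cK.
set z := x0 - p in hp.
have fz : f z != 0 by rewrite fB fp subr0.
have nz : nm z ^+ 2 != 0.
  by rewrite sqrf_eq0 nm_eq0; apply: contra_neq fz => ->.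
exists (Num.conj (f z / (nm z ^+ 2)%:C) *: z) => x.
rewrite ipZr conjCK.
have : ip z (f z *: x - f x *: z) = 0.
  by apply: hp => /=; rewrite fB !fZ mulrC subrr.
rewrite ipBr !ipZr (ipxx hH) => /eqP; rewrite subr_eq0 => /eqP.
move=> /(congr1 Num.conj); rewrite !rmorphM /= !conjCK -ipC conjcR => E.
rewrite mulrAC E mulfK//.
by rewrite -rmorphM (inj_eq (@complexI _) _ 0) -expr2.
Qed.

(** [adjoint] is chosen by description; this identifies it from the defining
identity. *)
Lemma adjoint_unique T S : (forall x y, ip (T x) y = ip x (S y)) ->
  adjoint ip T = S.
Proof.
move=> h; have : (forall x y, ip (T x) y = ip x (adjoint ip T y)).
  exact: (xgetPex _ (ex_intro (fun S : H -> H => forall x y, ip (T x) y = ip x (S y)) S h)).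
by move=> h2; apply/funext => y; apply: (ip_eqr hH) => x; rewrite -h2 h.
Qed.

Lemma adjointP T : bounded_operator T ->
  forall x y, ip (T x) y = ip x (adjoint ip T y).
Proof.
move=> bT; have [M M0 hM] := bo_norm bT.
have /choice[S hS] : forall y, exists w, forall x, ip (T x) y = ip x w.
  move=> y; apply: (@riesz (fun x => ip (T x) y) (M * nm y)).
    by move=> a u v; rewrite (bo_lin bT) ipDl ipZl.
  move=> x; rewrite (le_trans (cauchy_schwarz hH _ _))// mulrAC.
  by rewrite ler_wpM2r ?nm_ge0.
by rewrite (@adjoint_unique T S).
Qed.

Lemma adjointP' T : bounded_operator T ->
  forall x y, ip (adjoint ip T x) y = ip x (T y).
Proof. by move=> bT x y; rewrite ipC -adjointP// -ipC. Qed.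

Lemma bo_adjoint T : bounded_operator T -> bounded_operator (adjoint ip T).
Proof.
move=> bT; have [M M0 hM] := bo_norm bT.
apply: (@bo_intro _ _ _ M) => [a x y|x].
  by apply: (ip_eq hH) => z; rewrite ipDl ipZl !adjointP'// ipDl ipZl.
have := Re_ip_le hH (T (adjoint ip T x)) x; rewrite adjointP// (Re_ipxx hH).
have [->|nz] := eqVneq (nm (adjoint ip T x)) 0.
  by move=> _; rewrite mulr_ge0 ?nm_ge0 ?ltW.
have nz0 : 0 < nm (adjoint ip T x) by rewrite lt_def nz nm_ge0.
move=> h.
rewrite -(ler_pM2l nz0) -expr2 (le_trans h)// mulrA ler_wpM2r ?nm_ge0//.
by rewrite mulrC.
Qed.

End Projection.

(** * Orthonormal families *)

Section Orthonormal.
Context (R : realType) (H : completeNormedModType R[i]).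
Context (ip : {dot H for Num.conj}) (hH : is_hilbert ip).
Implicit Types (x y z : H) (a b : R[i]) (T S K : H -> H) (u v e : nat -> H).

(** Zero vectors are allowed so that the Gram-Schmidt process applies to
linearly dependent families without reindexing. *)
Definition suborthonormal u : Prop :=
  (forall i j, i != j -> ip (u i) (u j) = 0) /\ forall i, u i = 0 \/ nm (u i) = 1.

Definition orthonormal_seq e : Prop := forall i j, ip (e i) (e j) = (i == j)%:R.

(** The orthogonal projection on the span of the first n vectors of u; the zero
vectors of a suborthonormal family contribute nothing. *)
Definition oproj u n x : H := \sum_(i < n) ip x (u i) *: u i.

Lemma orthonormal_seq_nm e i : orthonormal_seq e -> nm (e i) = 1.
Proof.
move=> oe; have := oe i i; rewrite eqxx ipxx// => /(congr1 (@complex.Re R)) /=.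
exact: nm2_eq1.
Qed.

Lemma orthonormal_suborthonormal e : orthonormal_seq e -> suborthonormal e.
Proof.
move=> oe; split=> [i j ij|i]; first by rewrite oe (negbTE ij).
by right; exact: orthonormal_seq_nm.
Qed.

Lemma ip_suborthonormal u i x : suborthonormal u ->
  ip x (u i) * ip (u i) (u i) = ip x (u i).
Proof.
move=> [_ /(_ i)[->|u1]]; first by rewrite ip0r mul0r.
by rewrite (ipxx hH) u1 expr1n mulr1.
Qed.

Lemma proj_linear u n : linear (oproj u n).
Proof.
move=> a x y; rewrite /oproj scaler_sumr -big_split /=; apply: eq_bigr => i _.
by rewrite ipDl ipZl scalerDl scalerA.
Qed.

Lemma proj_sym u n x y : ip (oproj u n x) y = ip x (oproj u n y).
Proof.
rewrite /oproj ip_suml ip_sumr; apply: eq_bigr => i _.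
by rewrite ipZl ipZr mulrC -ipC.
Qed.

Lemma ip_proj u n x i : suborthonormal u -> (i < n)%N ->
  ip (oproj u n x) (u i) = ip x (u i).
Proof.
move=> su ni; rewrite /oproj ip_suml (bigD1 (Ordinal ni)) //= big1 ?addr0.
  by rewrite ipZl ip_suborthonormal.
move=> j ji; rewrite ipZl su.1 ?mulr0//.
Qed.

Lemma proj_vec u n i : suborthonormal u -> (i < n)%N -> oproj u n (u i) = u i.
Proof.
move=> su ni; apply: (ip_eq hH) => z; rewrite proj_sym ipC ip_proj//.
by rewrite -ipC.
Qed.

Lemma proj_proj u m n x : suborthonormal u -> (m <= n)%N ->
  oproj u n (oproj u m x) = oproj u m x.
Proof.
move=> su mn; rewrite {2 3}/oproj lin_sum; last exact: proj_linear.
apply: eq_bigr => i _; rewrite linZ ?proj_vec//; last exact: proj_linear.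
exact: leq_trans mn.
Qed.

Lemma pythagoras_proj u n x : suborthonormal u ->
  nm x ^+ 2 = nm (oproj u n x) ^+ 2 + nm (x - oproj u n x) ^+ 2.
Proof.
move=> su; rewrite -[in LHS](subrK (oproj u n x) x) addrC; apply: (nm_orthoD hH).
by rewrite ipBr proj_sym proj_sym proj_proj// subrr.
Qed.

Lemma nm_proj u n x : suborthonormal u -> nm (oproj u n x) <= nm x.
Proof.
move=> su; rewrite -(@ler_pXn2r _ 2) ?nnegrE ?nm_ge0//.
by rewrite (pythagoras_proj n x su) lerDl sqr_ge0.
Qed.

Lemma nm_sub_proj u n x : suborthonormal u -> nm (x - oproj u n x) <= nm x.
Proof.
move=> su; rewrite -(@ler_pXn2r _ 2) ?nnegrE ?nm_ge0//.
by rewrite (pythagoras_proj n x su) lerDr sqr_ge0.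
Qed.

Lemma bo_proj u n : suborthonormal u -> bounded_operator (oproj u n).
Proof.
move=> su; apply: (@bo_intro _ _ _ 1); first exact: proj_linear.
by move=> x; rewrite mul1r nm_proj.
Qed.

Lemma nm2_proj u n x : suborthonormal u ->
  nm (oproj u n x) ^+ 2 = \sum_(i < n) cabs (ip x (u i)) ^+ 2.
Proof.
move=> su; rewrite -(Re_ipxx hH) proj_sym proj_proj// -proj_sym /oproj ip_suml.
rewrite Re_sum; apply: eq_bigr => i _.
by rewrite ipZl [ip (u i) x]ipC cabs2.
Qed.

Lemma bessel u n x : suborthonormal u ->
  \sum_(i < n) cabs (ip x (u i)) ^+ 2 <= nm x ^+ 2.
Proof.
by move=> su; rewrite -nm2_proj// ler_pXn2r ?nnegrE ?nm_ge0// nm_proj.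
Qed.

Lemma nm2_comb u (P : pred nat) (a : nat -> R[i]) n : suborthonormal u ->
  nm (\sum_(i < n | P i) a i *: u i) ^+ 2 <=
  \sum_(i < n | P i) cabs (a i) ^+ 2.
Proof.
move=> su; elim: n => [|n IH].
  by rewrite !big_ord0 nm0 expr0n.
rewrite big_mkcond big_ord_recr /= -big_mkcond /=.
rewrite [leRHS]big_mkcond big_ord_recr /= -big_mkcond /=.
case: ifP => Pn; last by rewrite !addr0.
rewrite (nm_orthoD hH) ?lerD//; last first.
  rewrite ip_suml big1// => i _; rewrite ipZl ipZr su.1 ?mulr0//.
  by rewrite neq_ltn ltn_ord.
rewrite nmZ exprMn; case: (su.2 n) => [->|->]; last by rewrite expr1n mulr1.
by rewrite nm0 expr0n mulr0 sqr_ge0.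
Qed.

(** The zero vector is mapped to itself, as the inverse of 0 is 0. *)
Definition normalize x : H := (nm x)^-1%:C *: x.

Lemma normalize_cases x : normalize x = 0 \/ nm (normalize x) = 1.
Proof.
have [->|x0] := eqVneq x 0; first by left; rewrite /normalize scaler0.
right; rewrite nmZ cabsR ger0_norm ?invr_ge0 ?nm_ge0// mulVf// nm_eq0//.
Qed.

Lemma normalizeK x : ip x (normalize x) *: normalize x = x.
Proof.
have [->|x0] := eqVneq x 0; first by rewrite /normalize !scaler0.
rewrite /normalize ipZr conjcR (ipxx hH) scalerA -!rmorphM /=.
have nx : nm x != 0 by rewrite nm_eq0.
by rewrite (_ : _ * _ = 1) ?scale1r//; field.
Qed.

Section GramSchmidt.
Variable v : nat -> H.

(** The sequence of the vectors built so far is carried along, which makes the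
recursion structural. *)
Fixpoint gs_seq n : seq H :=
  if n is n'.+1 then
    rcons (gs_seq n') (normalize (v n' - \sum_(w <- gs_seq n') ip (v n') w *: w))
  else [::].

Definition gram_schmidt n : H := last 0 (gs_seq n.+1).

Lemma gs_seqE n : gs_seq n = [seq gram_schmidt i | i <- iota 0 n].
Proof.
elim: n => // n IH; rewrite -[n.+1 in RHS]addn1 iotaD map_cat /= cats1 -IH.
by rewrite /gram_schmidt /= last_rcons.
Qed.

Lemma gram_schmidtE n :
  gram_schmidt n = normalize (v n - oproj gram_schmidt n (v n)).
Proof.
rewrite {1}/gram_schmidt /= last_rcons gs_seqE big_map /oproj.
by rewrite -[n in iota 0 n]subn0 -/(index_iota 0 n) big_mkord.
Qed.

(** Orthogonality is proved for the family truncated at n, which makes the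
lemmas on projections available inside the induction. *)
Lemma gram_schmidtP : suborthonormal gram_schmidt /\
  forall i n, (i < n)%N -> oproj gram_schmidt n (v i) = v i.
Proof.
set u := gram_schmidt.
have u01 i : u i = 0 \/ nm (u i) = 1 by rewrite /u gram_schmidtE; exact: normalize_cases.
have uort n : forall i j, (i < n)%N -> (j < n)%N -> i != j -> ip (u i) (u j) = 0.
  elim: n => // n IH.
  pose u' i := if (i < n)%N then u i else 0.
  have su' : suborthonormal u'.
    split=> [i j ij|i]; rewrite /u'; last by case: ifP => _; [exact: u01|left].
    by case: ifP => ni; case: ifP => nj; rewrite ?ip0l ?ip0r//; apply: IH.
  have pu' x : oproj u' n x = oproj u n x.
    by apply: eq_bigr => i _; rewrite /u' ltn_ord.
  have key i : (i < n)%N -> ip (u n) (u i) = 0.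
    move=> ni; rewrite {1}/u gram_schmidtE -/u ipZl -pu'.
    have ui : u i = u' i by rewrite /u' ni.
    by rewrite ui ipBl ip_proj// subrr mulr0.
  move=> i j; rewrite !ltnS (leq_eqVlt i) (leq_eqVlt j) => /orP[/eqP->|ni] /orP[/eqP->|nj] ij.
  - by rewrite eqxx in ij.
  - exact: key.
  - by rewrite ipC key// rmorph0.
  - exact: IH.
have su : suborthonormal u.
  split=> // i j ij; apply: (uort (maxn i j).+1) => //; rewrite ltnS.
    exact: leq_maxl.
  exact: leq_maxr.
split=> // i n ni.
have vi : v i = oproj u i.+1 (v i).
  rewrite /oproj big_ord_recr /= -/(oproj u i (v i)).
  have -> : ip (v i) (u i) = ip (v i - oproj u i (v i)) (u i).
    rewrite ipBl /oproj ip_suml big1 ?subr0// => j _.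
    by rewrite ipZl su.1 ?mulr0// neq_ltn ltn_ord.
  by rewrite (gram_schmidtE i : u i = _) normalizeK addrC subrK.
by rewrite vi proj_proj.
Qed.

End GramSchmidt.

(** The form in which infinite dimension provides the next eigenvector. *)
Definition infinite_dim : Prop := forall n v,
  exists2 x, x != 0 & forall i, (i < n)%N -> ip x (v i) = 0.

Definition complete_seq_basis e : Prop := forall x, (fun n => oproj e n x) @ \oo --> x.

(** Double counting: the squares |<e i, u j>|^2 sum to 1 over j since e i lies in
the span of u, and by Bessel they sum to at most 1 over i. *)
Lemma orthonormal_le_dim u n e m : suborthonormal u ->
  (forall i j, (i < m)%N -> (j < m)%N -> ip (e i) (e j) = (i == j)%:R) ->
  (forall i, (i < m)%N -> oproj u n (e i) = e i) -> (m <= n)%N.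
Proof.
move=> su oe pe.
pose e' i := if (i < m)%N then e i else 0.
have se' : suborthonormal e'.
  split=> [i j ij|i]; rewrite /e'.
    case: ifP => im; case: ifP => jm; rewrite ?ip0l ?ip0r// oe//.
    by rewrite (negbTE ij).
  case: ifP => im; [right|by left].
  have := oe i i im im; rewrite eqxx (ipxx hH) => /(congr1 (@complex.Re R)) /=.
  exact: nm2_eq1.
have e1 i : (i < m)%N -> nm (e i) = 1.
  move=> im; have [h|] := se'.2 i; last by rewrite /e' im.
  have := oe i i im im; move: h; rewrite /e' im => ->.
  by rewrite ip0l eqxx => /esym/eqP; rewrite oner_eq0.
have : (m%:R : R) <= n%:R.
  rewrite -[m in m%:R]card_ord -sum1_card natr_sum.
  have -> : \sum_(i < m) (1%:R : R) = \sum_(i < m) \sum_(j < n) cabs (ip (e i) (u j)) ^+ 2.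
    apply: eq_bigr => i _.
    by rewrite -nm2_proj// pe// e1// expr1n.
  rewrite exchange_big /=.
  apply: (@le_trans _ _ (\sum_(j < n) 1)); last first.
    by rewrite sumr_const card_ord.
  apply: ler_sum => j _.
  apply: (@le_trans _ _ (nm (u j) ^+ 2)); last first.
    by case: (su.2 j) => ->; rewrite ?nm0 ?expr0n ?expr1n.
  apply: le_trans (bessel m _ se').
  apply: ler_sum => i _; rewrite /e' ltn_ord -(cabs_conj (ip (u j) _)) -ipC.
  by [].
by rewrite ler_nat.
Qed.

End Orthonormal.

(** * Compact symmetric operators *)

Section CompactSpectral.
Context (R : realType) (H : completeNormedModType R[i]).
Context (ip : {dot H for Num.conj}) (hH : is_hilbert ip).
Implicit Types (x y z : H) (a b : R[i]) (T S K : H -> H) (u v e : nat -> H).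

Definition symmetric_operator T : Prop := forall x y, ip (T x) y = ip x (T y).

Definition top_eigenpair K (el : H * R) : Prop :=
  [/\ nm el.1 = 1, el.2 != 0, K el.1 = el.2%:C *: el.1 &
      forall x, nm (K x) <= `|el.2| * nm x].

(** The norm is attained on the closure of the image of the unit ball, which is
compact; z is a point where it is maximal. *)
Lemma norm_attained K : compact_operator K ->
  exists z, (forall x, nm (K x) <= nm z * nm x) /\
    forall d : R, 0 < d -> exists2 x, nm x <= 1 & nm (z - K x) < d.
Proof.
move=> [bK cK]; rewrite precompactE in cK.
set B := _ @` _ in cK.
have B0 : B 0 by exists 0; rewrite /= ?normr0 ?ler01// lin0//; exact: bo_lin.
have A0 : closure B !=set0 by exists 0; exact: subset_closure.
have cn : {within closure B, continuous (@nm R H)}.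
  by apply: continuous_subspaceT; exact: nm_continuous.
have [z /set_mem zB zmax] := compact_EVT_max A0 cK cn.
exists z; split.
  move=> x; have [->|x0] := eqVneq x 0.
    by rewrite lin0 ?nm0 ?mulr0//; exact: bo_lin.
  have nx : 0 < nm x by rewrite lt_def nm_eq0 x0 nm_ge0.
  rewrite -ler_pdivrMr// mulrC.
  have -> : (nm x)^-1 * nm (K x) = nm (K ((nm x)^-1%:C *: x)).
    by rewrite linZ ?nmZ ?cabsR ?ger0_norm ?invr_ge0 ?nm_ge0//; exact: bo_lin.
  apply: zmax; apply/mem_set; apply: subset_closure; exists ((nm x)^-1%:C *: x) => //=.
  by rewrite nmE nmZ cabsR ger0_norm ?invr_ge0 ?nm_ge0// mulVf ?gt_eqF.
move=> d d0; have /closure_nm/(_ d d0)[_ [x /= x1 <-] h] := zB.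
by exists x => //; rewrite -lecR -nmE.
Qed.

(** With m the norm of K and K x close to the maximizer z, one has
|K (K x) - m^2 x|^2 <= |K K x|^2 - 2 m^2 |K x|^2 + m^4, which is small. In the
limit K K z = m^2 z, so either K z + m z is an eigenvector for m or z is one
for -m. *)
Lemma top_eigenpair_exists K : compact_operator K -> symmetric_operator K ->
  (exists x, K x != 0) -> exists el, top_eigenpair K el.
Proof.
move=> cK sK [x0 Kx0].
have bK : bounded_operator K by case: cK.
have lK := bo_lin bK.
have [z [hz zapp]] := norm_attained cK.
set m := nm z in hz.
have m0 : 0 < m.
  rewrite lt_def nm_ge0 andbT; apply: contra_neq Kx0 => m0.
  by apply: nm0_eq0; apply/eqP; rewrite eq_le nm_ge0 andbT (le_trans (hz _))// m0 mul0r.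
(* x almost attains the norm of K, so it is almost an eigenvector of K^2 *)
have est (d : R) x : nm x <= 1 -> 0 < d -> nm (z - K x) < d ->
    nm (K (K x) - (m ^+ 2)%:C *: x) ^+ 2 <= 2 * m ^+ 3 * d.
  move=> x1 d0 zd; rewrite (nmB2 hH) ipZr conjcR ReZ sK (Re_ipxx hH) nmZ cabsR.
  rewrite (ger0_norm (sqr_ge0 m)).
  have h1 : nm (K (K x)) <= m * nm (K x) by exact: hz.
  have h2 : nm (K x) <= m by rewrite (le_trans (hz x))// ler_piMr// ltW.
  have h3 : m - d <= nm (K x).
    rewrite lerBlDr addrC -lerBlDr lerBlDl; have := nm_tri (K x) z 0.
    by rewrite !subr0 -/m => /le_trans->//; rewrite addrC lerD2l ltW.
  have k0 := nm_ge0 (K x).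
  set A := nm (K (K x)) in h1 *; set k := nm (K x) in h1 h2 h3 k0 *.
  have A2 : A ^+ 2 <= m ^+ 2 * k ^+ 2.
    by rewrite -exprMn ler_pXn2r ?nnegrE ?mulr_ge0 ?(ltW m0)//; exact: nm_ge0.
  have X2 : (m ^+ 2 * nm x) ^+ 2 <= m ^+ 4.
    rewrite exprMn -exprM ler_piMr ?exprn_ge0 ?(ltW m0)//.
    by rewrite expr_le1// nm_ge0.
  have K2 : m ^+ 2 - 2 * m * d <= k ^+ 2.
    have [md|dm] := leP d m; last first.
      by rewrite (le_trans _ (sqr_ge0 _))// expr2; nra.
    have : (m - d) ^+ 2 <= k ^+ 2 by rewrite ler_pXn2r ?nnegrE ?subr_ge0.
    nra.
  have := ler_wpM2l (sqr_ge0 m) K2.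
  move: A2 X2; rewrite !exprS !expr0 !mulr1; nra.
have KKz : K (K z) = (m ^+ 2)%:C *: z.
  apply: le_nm_eps => e e0.
  have c0 : 0 < 2 * m ^+ 2 + m + 1.
    by rewrite !addr_gt0// mulr_gt0// exprn_gt0.
  (* the final estimate is m^2 d + m q + m^2 d with d <= q *)
  pose q := e / (2 * m ^+ 2 + m + 1).
  have q0 : 0 < q by rewrite divr_gt0.
  pose d := Num.min q (q ^+ 2 / (2 * m ^+ 3)).
  have m3 : 0 < 2 * m ^+ 3 by rewrite mulr_gt0// exprn_gt0.
  have d0 : 0 < d by rewrite lt_min q0 divr_gt0// exprn_gt0.
  have [x x1 xd] := zapp _ d0.
  have := est _ _ x1 d0 xd.
  set w := K (K x) - _ => hw.
  have wq : nm w <= q.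
    rewrite -(@ler_pXn2r _ 2) ?nnegrE ?nm_ge0 ?(ltW q0)// (le_trans hw)//.
    by rewrite mulrC -ler_pdivlMr// ge_min lexx orbT.
  have -> : K (K z) - (m ^+ 2)%:C *: z =
     K (K (z - K x)) + K w + (m ^+ 2)%:C *: (K x - z).
    rewrite /w (linB z (K x) lK) (linB (K z) (K (K x)) lK).
    by rewrite (linB (K (K x)) _ lK) (linZ _ _ lK) scalerBr subrKA subrKA.
  rewrite (le_lt_trans (nmD _ _))// (@le_lt_trans _ _ (m * (m * d) + m * q + m ^+ 2 * d))//.
    rewrite !lerD//.
    - rewrite (le_trans (nmD _ _))// lerD//.
        rewrite (le_trans (hz _))// ler_wpM2l ?(ltW m0)//.
        by rewrite (le_trans (hz _))// ler_wpM2l ?(ltW m0)// ltW.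
      by rewrite (le_trans (hz _))// ler_wpM2l ?(ltW m0).
    - rewrite nmZ cabsR ger0_norm ?sqr_ge0// ler_wpM2l ?sqr_ge0//.
      by rewrite nmBC ltW.
  have dq : d <= q by rewrite ge_min lexx.
  have : q * (2 * m ^+ 2 + m + 1) = e by rewrite /q mulfVK// gt_eqF.
  have := ler_wpM2l (sqr_ge0 m) dq.
  rewrite !expr2; nra.
have zn0 : z != 0 by rewrite -nm_eq0 gt_eqF.
have mk (w : H) (l : R) : w != 0 -> `|l| = m -> K w = l%:C *: w ->
    exists el, top_eigenpair K el.
  move=> w0 lm Kw; exists ((nm w)^-1%:C *: w, l); split => /=.
  - rewrite nmZ cabsR ger0_norm ?invr_ge0 ?nm_ge0// mulVf// nm_eq0//.
  - by rewrite -normr_gt0 lm.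
  - by rewrite linZ// Kw !scalerA mulrC.
  - by move=> x; rewrite lm.
have [w0|w0] := eqVneq (K z + m%:C *: z) 0.
  apply: (mk z (- m)) => //; first by rewrite normrN gtr0_norm.
  by apply/eqP; rewrite rmorphN scaleNr -addr_eq0 w0.
apply: (mk _ _ w0 (gtr0_norm m0)).
by rewrite linD// linZ// KKz scalerDr scalerA -rmorphM -expr2 addrC.
Qed.

Variable K : H -> H.

(** K restricted to the orthogonal complement of its top eigenvector e, and 0 on
e. The choice is total: eigenvectors are only guaranteed while the deflated
operator is nonzero. *)
Definition deflate T : H -> H :=
  let e := (xget (0, 0) [set el | top_eigenpair T el]).1 in
  T \o (fun x => x - ip x e *: e).

Definition deflated n : H -> H := iter n deflate K.
Definition eigpair n : H * R := xget (0, 0) [set el | top_eigenpair (deflated n) el].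
Definition eigvec n : H := (eigpair n).1.
Definition eigval n : R := (eigpair n).2.

Lemma deflatedS n x : deflated n.+1 x = deflated n (x - ip x (eigvec n) *: eigvec n).
Proof. by []. Qed.

Lemma deflated_ortho n x : (forall i, (i < n)%N -> ip x (eigvec i) = 0) ->
  deflated n x = K x.
Proof.
elim: n => // n IH h; rewrite deflatedS h// scale0r subr0 IH// => i ni.
by rewrite h// ltnW.
Qed.

Hypotheses (cK : compact_operator K) (sK : symmetric_operator K).
Hypotheses (injK : forall x, K x = 0 -> x = 0).
Hypotheses (denseK : forall x (eps : R), 0 < eps -> exists y, nm (x - K y) < eps).
Hypothesis infH : infinite_dim ip.

Let defl_ok n := compact_operator (deflated n) /\ symmetric_operator (deflated n).

Let pair_ok n : defl_ok n -> top_eigenpair (deflated n) (eigpair n).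
Proof.
move=> [c s]; apply: (xgetPex _ (_ : exists el, top_eigenpair (deflated n) el)).
apply: top_eigenpair_exists => //.
have [x x0 hx] := infH n eigvec; exists x; rewrite deflated_ortho//.
by apply: contra_neq x0; exact: injK.
Qed.

Let deflatedS' n x : defl_ok n ->
  deflated n.+1 x = deflated n x - ((eigval n)%:C * ip x (eigvec n)) *: eigvec n.
Proof.
move=> dn; have Ke : deflated n (eigvec n) = (eigval n)%:C *: eigvec n.
  by case: (pair_ok dn).
case: dn => -[/bo_lin l _] _.
by rewrite deflatedS (linB _ _ l) (linZ _ _ l) Ke scalerA mulrC.
Qed.

Let deflates n : defl_ok n.
Proof.
elim: n => [|n IH]; first by [].
split.
  apply: compact_operator_comp IH.1 _.
  by apply: (boB (bo_id H)); exact: bo_rank1.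
move=> x y; rewrite !deflatedS'// ipBl ipBr IH.2 ipZl ipZr conjM conjcR.
by rewrite -ipC [in RHS]mulrAC.
Qed.

Let eig n : top_eigenpair (deflated n) (eigpair n) := pair_ok (deflates n).

Lemma eigvec_unit n : nm (eigvec n) = 1. Proof. by case: (eig n). Qed.

Lemma eigval_neq0 n : eigval n != 0. Proof. by case: (eig n). Qed.

Lemma deflated_norm n x : nm (deflated n x) <= `|eigval n| * nm x.
Proof. by case: (eig n). Qed.

Lemma deflated_eig n : deflated n (eigvec n) = (eigval n)%:C *: eigvec n.
Proof. by case: (eig n). Qed.

Lemma eigval_neq0C n : (eigval n)%:C != 0.
Proof. by rewrite (inj_eq (@complexI _) _ 0) eigval_neq0. Qed.

Lemma deflated_eq0 n i : (i < n)%N -> deflated n (eigvec i) = 0.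
Proof.
elim: n i => // n IH i; rewrite ltnS leq_eqVlt => /orP[/eqP ->|ni].
  rewrite deflatedS' ?deflated_eig ?(ipxx hH) ?eigvec_unit; last exact: deflates.
  by rewrite expr1n mulr1 subrr.
rewrite deflatedS'; last exact: deflates.
have : ip (eigvec i) (deflated n (eigvec n)) = 0.
  by rewrite -(deflates n).2 IH// ip0l.
rewrite deflated_eig ipZr conjcR => ->.
by rewrite IH// scale0r subrr.
Qed.

Lemma eigvec_orthonormal : orthonormal_seq ip eigvec.
Proof.
have key i n : (i < n)%N -> ip (eigvec n) (eigvec i) = 0.
  move=> ni; apply: (mulfI (eigval_neq0C n)).
  by rewrite mulr0 -ipZl -deflated_eig (deflates n).2 deflated_eq0// ip0r.
move=> i j; have [ij|ij|->] := ltngtP i j.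
- by rewrite ipC key// rmorph0.
- by rewrite key.
- by rewrite (ipxx hH) eigvec_unit expr1n.
Qed.

(** The deflated operator is K followed by the projection on the orthogonal
complement of the first n eigenvectors. Its norm is |eigval n|, which turns
this formula into the convergence of the eigenvector expansion. *)
Lemma deflatedE n x : deflated n x = K x - oproj ip eigvec n (K x).
Proof.
suff h : deflated n x =
    K x - \sum_(i < n) ((eigval i)%:C * ip x (eigvec i)) *: eigvec i.
  have Ke i : K (eigvec i) = (eigval i)%:C *: eigvec i.
    have : deflated i (eigvec i) = K (eigvec i).
      apply: deflated_ortho => j ji; rewrite eigvec_orthonormal.
      by rewrite gtn_eqF.
    by rewrite deflated_eig.
  rewrite h; congr (_ - _); apply: eq_bigr => i _.
  by rewrite sK Ke ipZr conjcR.
elim: n => [|n IH]; first by rewrite big_ord0 subr0.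
rewrite deflatedS'; last exact: deflates.
by rewrite IH big_ord_recr /= opprD addrA.
Qed.

Lemma eigvecP i : K (eigvec i) = (eigval i)%:C *: eigvec i.
Proof.
rewrite -deflated_eig; apply/esym/deflated_ortho => j ji.
by rewrite eigvec_orthonormal gtn_eqF.
Qed.

Lemma eigval_noninc n : `|eigval n.+1| <= `|eigval n|.
Proof.
have := deflated_norm n (eigvec n.+1); rewrite eigvec_unit mulr1.
rewrite deflatedE eigvecP linZ; last exact: proj_linear.
rewrite [oproj _ _ _ _]big1 ?scaler0 ?subr0; last first.
  by move=> i _; rewrite eigvec_orthonormal gtn_eqF ?scale0r// ltnS ltnW.
by rewrite nmZ cabsR eigvec_unit mulr1.
Qed.

Lemma eigval_noninc_le m n : (m <= n)%N -> `|eigval n| <= `|eigval m|.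
Proof. exact: (noninc_le eigval_noninc). Qed.

(** Otherwise the vectors K e_n = k_n e_n, which lie in a compact set, would be at
mutual distance at least c. *)
Lemma eigval_cvg0 (c : R) : 0 < c -> exists N, forall n, (N <= n)%N -> `|eigval n| < c.
Proof.
move=> c0; have [[N hN]|hN] := pselect (exists N, `|eigval N| < c).
  by exists N => n Nn; apply: le_lt_trans hN; exact: eigval_noninc_le.
have {}hN n : c <= `|eigval n| by rewrite leNgt; apply/negP => h; apply: hN; exists n.
have := cK.2; rewrite precompactE => /(_ ((fun n => K (eigvec n)) @ \oo)).
case=> [|p [_ clp]].
  exists 0%N => // n _; apply: subset_closure; exists (eigvec n) => //=.
  by rewrite nmE eigvec_unit.
have np : nbhs p [set y | nm (p - y) < c / 2].
  by apply/nbhs_nm; exists (c / 2) => //; rewrite divr_gt0.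
have [|_ [[n _ <-] /= hn]] := clp (range (fun n => K (eigvec n))) _ _ np.
  by exists 0%N => // n _; exists n.
have [|_ [[k /= nk <-] /= hk]] :=
  clp [set K (eigvec k) | k in [set k | (n < k)%N]] _ _ np.
  by exists n.+1 => // k nk; exists k.
have := nm_tri p (K (eigvec n)) (K (eigvec k)); rewrite nmBC in hn.
move/le_lt_trans => /(_ c); rewrite [X in _ < X]splitr ltrD// => /(_ isT).
rewrite !eigvecP ltNge => /negP h; exfalso; apply: h.
rewrite -(@ler_pXn2r _ 2) ?nnegrE ?nm_ge0 ?ltW// (nmB2 hH).
rewrite ipZl ipZr eigvec_orthonormal ltn_eqF// !mulr0 subr0.
rewrite !nmZ !cabsR !eigvec_unit !mulr1.
apply: (@le_lt_trans _ _ (`|eigval n| ^+ 2)).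
  by rewrite ler_pXn2r ?nnegrE ?(ltW c0).
by rewrite ltrDl exprn_gt0// normr_gt0 eigval_neq0.
Qed.

(** On the range of K the remainder of the expansion is a deflated operator, whose
norm tends to 0; the range is dense. *)
Lemma eigvec_complete : complete_seq_basis ip eigvec.
Proof.
have su := orthonormal_suborthonormal hH eigvec_orthonormal.
move=> x; apply/cvgn_nm => e e0.
have e30 : 0 < e / 3 by rewrite divr_gt0.
have [y hy] := denseK x e30.
have ny1 : 0 < nm y + 1 by rewrite ltr_wpDl// nm_ge0.
have [N hN] := eigval_cvg0 (divr_gt0 e30 ny1).
exists N => n /hN; rewrite ltr_pdivlMr// => hn.
(* x is close to K y, for which the expansion converges *)
have -> : x - oproj ip eigvec n x = (x - K y) + deflated n y
    + oproj ip eigvec n (K y - x).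
  have lp : linear (oproj ip eigvec n) by exact: proj_linear.
  rewrite deflatedE (linB _ _ lp).
  by rewrite subrKA subrKA.
rewrite (le_lt_trans (nmD _ _))// (_ : e = e / 3 + e / 3 + e / 3); last by field.
rewrite ltrD// ?(le_lt_trans (nm_proj _ _ _ _))//; last by rewrite nmBC.
rewrite (le_lt_trans (nmD _ _))// ltrD// (le_lt_trans (deflated_norm _ _))//.
rewrite (le_lt_trans _ hn)// ler_wpM2l// lerDl//.
Qed.

End CompactSpectral.

(** * Inverse of a self-adjoint operator with compact resolvent *)

Section SelfAdjointInverse.
Context (R : realType) (H : completeNormedModType R[i]).
Context (ip : {dot H for Num.conj}) (hH : is_hilbert ip).
Implicit Types (x y z : H) (a b : R[i]) (T S K : H -> H) (u v e : nat -> H).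

Lemma ip_cvg_eq (p q : H) u v x y : u @ \oo --> x -> v @ \oo --> y ->
  (forall n, ip p (u n) = ip q (v n)) -> ip p x = ip q y.
Proof.
move=> /cvgn_nm ux /cvgn_nm vy h; apply/eqP; rewrite -subr_eq0; apply/eqP.
apply: eq0_normc; apply/eqP; rewrite eq_le cabs_ge0 andbT.
apply/ler_addgt0Pr => e e0; rewrite add0r.
have k0 : 0 < nm p + nm q + 1 by rewrite ltr_wpDl// addr_ge0 ?nm_ge0.
have [N hN] := ux _ (divr_gt0 e0 k0); have [M hM] := vy _ (divr_gt0 e0 k0).
have := hN _ (leq_maxl N M); have := hM _ (leq_maxr N M).
set n := maxn N M; rewrite !ltr_pdivlMr// => hy hx.
have -> : ip p x - ip q y = ip p (x - u n) - ip q (y - v n).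
  by rewrite !ipBr h opprB addrA subrK.
rewrite (le_trans (le_cabsD _ _))// cabsN.
rewrite (le_trans (lerD (cauchy_schwarz hH _ _) (cauchy_schwarz hH _ _)))//.
have := nm_ge0 p; have := nm_ge0 q; have := nm_ge0 (x - u n); have := nm_ge0 (y - v n).
nra.
Qed.

Variable D : operator H.
Hypotheses (saD : self_adjoint ip D) (crD : has_compact_resolvent D).
Hypothesis D0 : zero_not_eigenvalue D.

Lemma self_adjoint_sym x y : dom D x -> dom D y -> ip (D x) y = ip x (D y).
Proof.
case: saD => _ _ h dx dy; have [_ h2] := h y (D y).
exact: (h2 (conj dy erefl)).
Qed.

Lemma self_adjoint_closed u x y : (forall n, dom D (u n)) -> u @ \oo --> x ->
  (fun n => D (u n)) @ \oo --> y -> dom D x /\ D x = y.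
Proof.
move=> du ux Duy; case: saD => _ _ h.
have [h1 _] := h x y; case: h1 => [w dw|dx ->//].
by apply: (ip_cvg_eq ux Duy) => n; rewrite self_adjoint_sym.
Qed.

Lemma dom_lin a x y : dom D x -> dom D y ->
  dom D (a *: x + y) /\ D (a *: x + y) = a *: D x + D y.
Proof. by case: saD => -[_ h] _ _; exact: h. Qed.

Lemma dom_zero : dom D 0 /\ D 0 = 0.
Proof.
have d0 : dom D 0 by case: saD => -[].
by have [d1] := dom_lin (-1) d0 d0; rewrite !scaleN1r oppr0 addr0 addNr.
Qed.

Lemma dom_scale a x : dom D x -> dom D (a *: x) /\ D (a *: x) = a *: D x.
Proof.
move=> dx; have [d0 e0] := dom_zero.
by have := dom_lin a dx d0; rewrite e0 !addr0.
Qed.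

Lemma dom_sub x y : dom D x -> dom D y -> dom D (x - y) /\ D (x - y) = D x - D y.
Proof. by move=> dx dy; have := dom_lin (-1) dy dx; rewrite !scaleN1r addrC [- D y + _]addrC. Qed.

(** If not, there are unit vectors w n with D (w n) tending to 0. As w n is S applied
to D (w n) - l w n, compactness of the resolvent S gives a cluster point p of a
rescaled sequence; D is closed, so D p = 0, hence p = 0, against |w n| = 1. *)
Lemma bounded_below : exists2 c : R, 0 < c & forall x, dom D x -> c * nm x <= nm (D x).
Proof.
have [l [S [[bS _ SD] cS]]] := crD.
apply: contrapT => nh.
have /choice[w hw] : forall n : nat, exists x,
    [/\ dom D x, nm x = 1 & nm (D x) < n.+1%:R^-1].
  move=> n; apply: contrapT => hn; apply: nh.
  exists n.+1%:R^-1; first by rewrite invr_gt0.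
  move=> x dx; have [->|x0] := eqVneq x 0; first by rewrite nm0 mulr0 nm_ge0.
  have nx : 0 < nm x by rewrite lt_def nm_eq0 x0 nm_ge0.
  rewrite leNgt; apply/negP => hx; apply: hn; exists ((nm x)^-1%:C *: x).
  have [d1 e1] := dom_scale (nm x)^-1%:C dx; split => //.
    by rewrite nmZ cabsR ger0_norm ?invr_ge0 ?nm_ge0// mulVf// gt_eqF.
  rewrite e1 nmZ cabsR ger0_norm ?invr_ge0 ?nm_ge0//.
  by rewrite mulrC ltr_pdivrMr.
(* dividing by M brings D (w n) - l (w n) into the unit ball *)
pose M := 1 + cabs l.
have M0 : 0 < M by rewrite ltr_pwDl// cabs_ge0.
pose r := (M^-1)%:C : R[i].
pose f n : H := r *: w n.
have rM (x : H) : nm (r *: x) = M^-1 * nm x.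
  by rewrite nmZ cabsR ger0_norm// invr_ge0 ltW.
have cl n : closure (S @` [set x | `|x| <= 1]) (f n).
  have [dw w1 Dw] := hw n.
  apply: subset_closure; exists (r *: (D (w n) - l *: w n)); last first.
    by rewrite linZ ?SD//; exact: bo_lin.
  rewrite /= nmE lecR rM mulrC ler_pdivrMr// mul1r.
  rewrite (le_trans (nmB _ _))// nmZ w1 mulr1 lerD2r ltW//.
  by rewrite (lt_le_trans Dw)// invf_le1// ler1n.
have := cS.2; rewrite precompactE => /(_ (f @ \oo)).
case=> [|p [_ clp]]; first by exists 0%N => // n _; exact: cl.
have /choice[k hk] : forall m : nat, exists n, (m <= n)%N /\ nm (p - f n) < m.+1%:R^-1.
  move=> m.
  have np : nbhs p [set y | nm (p - y) < m.+1%:R^-1].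
    by apply/nbhs_nm; exists m.+1%:R^-1 => //; rewrite invr_gt0.
  have [|_ [[n mn <-] hn]] := clp [set f n | n in [set n | (m <= n)%N]] _ _ np.
    by exists m => // n mn; exists n.
  by exists n.
have cf : (fun m => f (k m)) @ \oo --> p.
  apply/cvgn_nm => e /succ_inv_small[N hN]; exists N => n Nn.
  by apply: lt_trans (hN _ Nn); have [] := hk n.
have df n : dom D (f n) /\ D (f n) = r *: D (w n).
  by apply: dom_scale; have [] := hw n.
have cDf : (fun m => D (f (k m))) @ \oo --> (0 : H).
  apply/cvgn_nm => e e0.
  have [N hN] := succ_inv_small (mulr_gt0 e0 M0); exists N => n Nn.
  rewrite (df _).2 sub0r nmN rM mulrC ltr_pdivrMr//.
  apply: le_lt_trans (hN _ Nn).
  have [_ _ /ltW h1] := hw (k n); rewrite (le_trans h1)// lef_pV2 ?posrE//.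
  by rewrite ler_nat ltnS; have [] := hk n.
have [dp Dp] := self_adjoint_closed (fun m => (df (k m)).1) cf cDf.
have p0 := D0 dp Dp.
have [N hN] := succ_inv_small (divr_gt0 ltr01 M0).
have [_] := hk N; rewrite p0 sub0r nmN rM.
have [_ -> _] := hw (k N); rewrite mulr1 => /lt_trans/(_ (hN N (leqnn _))).
by rewrite mul1r ltxx.
Qed.

(** The range is closed because D is closed and bounded below, and a vector
orthogonal to it lies in the kernel of the adjoint, which is D. *)
Lemma self_adjoint_surj y : exists2 x, dom D x & D x = y.
Proof.
have [c c0 hc] := bounded_below.
pose M : set H := [set y | exists2 x, dom D x & D x = y].
apply: (@dense_of_orthogonal _ _ ip hH M).
- split => [|a _ _ [x1 d1 <-] [x2 d2 <-]|v z hv vz].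
  + by have [d0 e0] := dom_zero; exists 0.
  + by have [d3 e3] := dom_lin a d1 d2; exists (a *: x1 + x2).
  + have /choice[x hx] : forall n, exists x, dom D x /\ D x = v n.
      by move=> n; have [x] := hv n; exists x.
    have [p xp] : exists p : H, x @ \oo --> p.
      apply: complete_seq => e e0.
      have ec : 0 < e * c / 2 by rewrite divr_gt0// mulr_gt0.
      have /cvgn_nm/(_ _ ec)[N hN] := vz; exists N => n Nn.
      have [dd Dd] := dom_sub (hx N).1 (hx n).1.
      rewrite -(ltr_pM2l c0) (le_lt_trans (hc _ dd))// Dd (hx N).2 (hx n).2.
      rewrite (le_lt_trans (nm_tri z _ _))// mulrC [ltRHS]splitr ltrD ?hN//.
      by rewrite nmBC hN.
    have [|dp Dp] := self_adjoint_closed (fun n => (hx n).1) xp (_ : _ @ \oo --> z).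
      by under eq_fun do rewrite (hx _).2.
    by exists p.
- move=> z hz; case: saD => _ _ h; have [h1 _] := h z 0.
  case: h1 => [x dx|dz Dz]; last exact: D0.
  by rewrite ip0r hz//; exists x.
Qed.

Let K := inverse_operator D.

Lemma inverseP y : dom D (K y) /\ D (K y) = y.
Proof.
have [x dx Dx] := self_adjoint_surj y.
exact: (xgetPex 0 (ex_intro (fun x => dom D x /\ D x = y) x (conj dx Dx))).
Qed.

Lemma inverseK x : dom D x -> K (D x) = x.
Proof.
move=> dx; have [dK DK] := inverseP (D x).
have [dd Dd] := dom_sub dK dx; apply/eqP; rewrite -subr_eq0; apply/eqP.
by apply: D0 => //; rewrite Dd DK subrr.
Qed.

Lemma inverse_linear : linear K.
Proof.
move=> a x y; have [dx Dx] := inverseP x; have [dy Dy] := inverseP y.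
have [d e] := dom_lin a dx dy; rewrite -[in LHS]Dx -[in LHS]Dy -e.
by rewrite inverseK.
Qed.

Lemma inverse_bounded : bounded_operator K.
Proof.
have [c c0 hc] := bounded_below.
apply: (@bo_intro _ _ _ c^-1); first exact: inverse_linear.
move=> x; have [dx Dx] := inverseP x.
by rewrite -(ler_pM2l c0) mulrA mulfV ?gt_eqF// mul1r (le_trans (hc _ dx))// Dx.
Qed.

(** The resolvent identity K = S (1 - l K). *)
Lemma inverse_compact : compact_operator K.
Proof.
have [l [S [[bS _ SD] cS]]] := crD.
have -> : K = S \o (idfun + (- l) *: K).
  apply/funext => x /=; have [dx Dx] := inverseP x.
  by rewrite -[LHS]SD// Dx !fctE scaleNr.
apply: compact_operator_comp => //.
by apply: (boD (bo_id H)); apply: boZ; exact: inverse_bounded.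
Qed.

Lemma inverse_symmetric : symmetric_operator ip K.
Proof.
move=> x y; have [dx Dx] := inverseP x; have [dy Dy] := inverseP y.
by rewrite -[in LHS]Dy -[in RHS]Dx self_adjoint_sym.
Qed.

Lemma inverse_injective x : K x = 0 -> x = 0.
Proof.
by move=> Kx; have [_ <-] := inverseP x; rewrite Kx; case: dom_zero.
Qed.

Lemma inverse_dense x (eps : R) : 0 < eps -> exists y, nm (x - K y) < eps.
Proof.
move=> e0; case: saD => _ dD _.
pose O := interior [set y | nm (x - y) < eps].
have nO : nbhs x [set y | nm (x - y) < eps] by apply/nbhs_nm; exists eps.
have [|w [/interior_subset Ow dw]] := dD O _ (@open_interior _ _).
  by exists x.
by exists (D w); rewrite inverseK.
Qed.

Lemma inverse_eigen (e : H) (k : R) : k != 0 -> K e = k%:C *: e ->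
  dom D e /\ D e = (k^-1)%:C *: e.
Proof.
move=> k0 Ke; have [dK DK] := inverseP e.
have kC : k%:C != 0 by rewrite (inj_eq (@complexI _) _ 0).
have ee : e = (k^-1)%:C *: K e.
  by rewrite Ke scalerA -rmorphM mulVf// scale1r.
by rewrite {1 2}ee; have [d ->] := dom_scale (k^-1)%:C dK; rewrite DK.
Qed.

Lemma inverse_spectral : infinite_dim ip ->
  exists e (k : nat -> R),
  [/\ orthonormal_seq ip e, complete_seq_basis ip e,
      forall n, k n != 0 /\ `|k n.+1| <= `|k n|,
      forall c : R, 0 < c -> exists N, forall n, (N <= n)%N -> `|k n| < c &
      forall n, [/\ K (e n) = (k n)%:C *: e n, dom D (e n) & D (e n) = (k n)^-1%:C *: e n]].
Proof.
move=> infH.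
have cK := inverse_compact; have sK := inverse_symmetric.
have iK := inverse_injective; have dK := inverse_dense.
exists (eigvec ip K), (eigval ip K); split.
- exact: eigvec_orthonormal.
- exact: eigvec_complete.
- by move=> n; split; [exact: eigval_neq0|exact: eigval_noninc].
- exact: eigval_cvg0.
- move=> n; have Ke := eigvecP hH cK sK iK infH n.
  by have [] := inverse_eigen (eigval_neq0 hH cK sK iK infH n) Ke.
Qed.

End SelfAdjointInverse.

(** * Diagonal operators and singular values *)

Section Basis.
Context (R : realType) (H : completeNormedModType R[i]).
Context (ip : {dot H for Num.conj}) (hH : is_hilbert ip).
Implicit Types (x y z : H) (a b : R[i]) (T S K : H -> H).

Lemma nm_lim_le (u : nat -> H) x (B : R) : u @ \oo --> x ->
  (exists N, forall n, (N <= n)%N -> nm (u n) <= B) -> nm x <= B.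
Proof.
move=> /cvgn_nm ux [N hN]; apply/ler_addgt0Pr => e e0.
have [M hM] := ux _ e0; have := hM _ (leq_maxr N M); have := hN _ (leq_maxl N M).
set n := maxn N M => h1 h2; have := nm_tri (u n) x 0; rewrite !subr0 => /le_trans->//.
by rewrite addrC lerD// ltW.
Qed.

(** The partial sums of the squares converge, so the tails of the series are
small by orthogonality. *)
Lemma riesz_fischer (u : nat -> H) (c : nat -> R[i]) (B : R) :
  suborthonormal ip u -> (forall n, \sum_(i < n) cabs (c i) ^+ 2 <= B) ->
  exists l : H, (fun n => \sum_(i < n) c i *: u i) @ \oo --> l.
Proof.
move=> su hB; apply: complete_seq => e e0.
pose s n := \sum_(i < n) cabs (c i) ^+ 2.
pose A : set R := range s.
have sA : has_sup A.
  by split; [exists (s 0%N), 0%N|exists B => _ [n _ <-]; exact: hB].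
have [_ [N _ <-] hN] := sup_adherent (exprn_gt0 2 e0) sA.
exists N => n Nn; rewrite -(@ltr_pXn2r _ 2) ?nnegrE ?nm_ge0 ?(ltW e0)//.
have split_sum (V : zmodType) (F : nat -> V) :
    \sum_(i < n) F i = \sum_(i < N) F i + \sum_(i < n | (N <= i)%N) F i.
  by rewrite -!(big_mkord xpredT F) (big_cat_nat (leq0n N) Nn)//= [X in _ + X = _]big_geq_mkord.
rewrite nmBC (split_sum _ (fun i => c i *: u i)) addrAC subrr add0r.
rewrite (le_lt_trans (nm2_comb hH _ _ _ su))//.
have : s n <= sup A by apply: (sup_upper_bound sA); exists n.
rewrite /s (split_sum _ (fun i => cabs (c i) ^+ 2)) -/(s N).
move: hN; set q := \sum_(_ < n | _) _; set p := s N; set r := sup _.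
lra.
Qed.

Variable e : nat -> H.
Hypotheses (oe : orthonormal_seq ip e) (ce : complete_seq_basis ip e).
Arguments ce : clear implicits.

Let se := orthonormal_suborthonormal hH oe.

Lemma basis_ext x y : (forall n, ip x (e n) = ip y (e n)) -> x = y.
Proof.
move=> h; apply: (cvg_unique_nm (ce x)).
rewrite (_ : (fun n => _) = (fun n => oproj ip e n y)); first exact: ce.
by apply/funext => n; apply: eq_bigr => i _; rewrite h.
Qed.

Lemma basis_op_ext T S : bounded_operator T -> bounded_operator S ->
  (forall n, T (e n) = S (e n)) -> T = S.
Proof.
move=> bT bS h; apply/funext => x.
apply: (cvg_unique_nm (bo_cvg bT (ce x))).
rewrite (_ : T \o _ = S \o (fun n => oproj ip e n x)); first exact: bo_cvg bS (ce x).
apply/funext => n /=; rewrite !lin_sum; try exact: bo_lin.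
by apply: eq_bigr => i _; rewrite !linZ ?h//; exact: bo_lin.
Qed.

(** Weighted shifts along an injection of the index set. They give both the
diagonal operators and the isometries that split the basis into halves. *)
Lemma shift_operator (c : nat -> R[i]) (s : nat -> nat) (M : R) :
  injective s -> (forall n, cabs (c n) <= M) ->
  exists W, [/\ bounded_operator W, forall n, W (e n) = c n *: e (s n) &
                forall x, nm (W x) <= M * nm x].
Proof.
move=> injs cM.
have M0 : 0 <= M by exact: le_trans (cabs_ge0 _) (cM 0%N).
have su : suborthonormal ip (e \o s).
  split=> [i j ij|i] /=; last by right; exact: orthonormal_seq_nm.
  by rewrite oe (inj_eq injs) (negbTE ij).
pose p x n := \sum_(i < n) (c i * ip x (e i)) *: (e \o s) i.
have pB x n : \sum_(i < n) cabs (c i * ip x (e i)) ^+ 2 <= (M * nm x) ^+ 2.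
  apply: (@le_trans _ _ (\sum_(i < n) M ^+ 2 * cabs (ip x (e i)) ^+ 2)).
    apply: ler_sum => i _; rewrite cabsM exprMn ler_wpM2r ?sqr_ge0//.
    by rewrite ler_pXn2r ?nnegrE ?cabs_ge0.
  by rewrite -mulr_sumr exprMn ler_wpM2l ?sqr_ge0// bessel.
have /choice[W hW] : forall x, exists l : H, p x @ \oo --> l.
  by move=> x; apply: (riesz_fischer (c := fun i => c i * ip x (e i)) su (pB x)).
have nW x : nm (W x) <= M * nm x.
  apply: (nm_lim_le (hW x)); exists 0%N => n _.
  rewrite -(@ler_pXn2r _ 2) ?nnegrE ?mulr_ge0 ?nm_ge0//.
  apply: le_trans (pB x n).
  exact: (nm2_comb hH xpredT (fun i => c i * ip x (e i)) n su).
have lW : linear W.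
  move=> a x y; apply: (cvg_unique_nm (hW _)); apply/cvgn_nm => d d0.
  have a0 : 0 < cabs a + 1 by rewrite ltr_wpDl// cabs_ge0.
  have d1 : 0 < d / 2 / (cabs a + 1) by rewrite !divr_gt0.
  have d2 : 0 < d / 2 by rewrite divr_gt0.
  have /cvgn_nm/(_ _ d1)[N hN] := hW x; have /cvgn_nm/(_ _ d2)[N' hN'] := hW y.
  exists (maxn N N') => n; rewrite geq_max => /andP[/hN h1 /hN' h2].
  have -> : p (a *: x + y) n = a *: p x n + p y n.
    rewrite /p scaler_sumr -big_split; apply: eq_bigr => i _ /=.
    by rewrite ipDl ipZl scalerA -scalerDl; congr (_ *: _); ring.
  rewrite opprD addrACA -scalerBr (le_lt_trans (nmD _ _))// [ltRHS]splitr.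
  rewrite ler_ltD// nmZ; move: h1; rewrite ltr_pdivlMr// => /ltW; apply: le_trans.
  by rewrite mulrC ler_wpM2l ?nm_ge0// lerDl.
exists W; split => //; first exact: bo_intro lW nW.
move=> n; apply: (cvg_unique_nm (hW _)); apply/cvgn_nm => d d0.
exists n.+1 => m nm; rewrite /p (bigD1 (Ordinal nm))//= oe eqxx mulr1.
rewrite big1 ?addr0 ?subrr ?nm0// => i ni; rewrite oe.
by rewrite (_ : (n == i) = false) ?mulr0 ?scale0r//; apply/negbTE; rewrite eq_sym.
Qed.

(** The eigenvectors e 0, ..., e n bound the supremum from below. If n+1 orthonormal
eigenvectors belonged to values above c n, they would be orthogonal to
all e i with n <= i, hence lie in the span of the first n. *)
Lemma singular_value_basis T (c : nat -> R) : bounded_operator T ->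
  (forall n, 0 <= c n) -> (forall n, c n.+1 <= c n) ->
  (forall n, adjoint ip T (T (e n)) = (c n ^+ 2)%:C *: e n) ->
  forall n, singular_value ip T n.+1 = c n.
Proof.
move=> bT c0 cS hT n.
have cle m k : (m <= k)%N -> c k <= c m.
  exact: noninc_le.
rewrite /singular_value; set A := [set s | _].
have ub : ubound A (c n).
  move=> s [->//|[s0 [E [oE hE]]]]; rewrite leNgt; apply/negP => cs.
  have [uE /= iE] := orthonormalP oE.
  have szE : size E = n.+1 by rewrite size_tuple.
  have memE j : (j < n.+1)%N -> nth 0 E j \in tval E.
    by move=> jn; apply: mem_nth; rewrite szE.
  suff : (n.+1 <= n)%N by rewrite ltnn.
  apply: (@orthonormal_le_dim _ _ _ hH e n (nth 0 E) n.+1 se).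
    move=> i j ni nj; rewrite iE ?memE// nth_uniq ?szE//.
  move=> j jn; have [t st At] := hE _ (memE j jn).
  set x := nth 0 E j in At *.
  (* eigenvectors of T^*T for different eigenvalues are orthogonal *)
  have x0 i : (n <= i)%N -> ip x (e i) = 0.
    move=> ni; have : ip (adjoint ip T (T x)) (e i) = ip x (adjoint ip T (T (e i))).
      by rewrite (adjointP' hH bT) (adjointP hH bT).
    rewrite At hT ipZl ipZr conjcR => /eqP; rewrite -subr_eq0 -mulrBl -rmorphB.
    rewrite mulf_eq0 (inj_eq (@complexI _) _ 0) subr_eq0 => /orP[|/eqP//].
    have t0 : 0 < t by exact: lt_le_trans st.
    rewrite eqrXn2 ?(ltW t0)// => /eqP tc.
    by have := lt_le_trans (le_lt_trans (cle _ _ ni) cs) st; rewrite tc ltxx.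
  apply: (@cvg_unique_nm _ _ (fun _ => oproj ip e n x)); first exact: cvg_cst.
  apply/cvgn_nm => d /(proj1 (cvgn_nm _ _) (ce x))[N hN].
  exists 0%N => _ _; have := hN _ (leq_maxr n N); congr (nm (_ - _) < _).
  rewrite /oproj -!(big_mkord xpredT (fun i => ip x (e i) *: e i)).
  rewrite (big_cat_nat (leq0n n) (leq_maxl n N))//= [X in _ + X]big1_seq ?addr0//.
  by move=> i; rewrite mem_index_iota => /andP[_ /andP[ni _]]; rewrite x0// scale0r.
have Ac : A (c n).
  have [c00|cn0] := eqVneq (c n) 0; first by left.
  right; split; first by rewrite lt_def cn0 c0.
  exists [tuple of mkseq e n.+1]; split.
    apply/orthonormalP; split.
      rewrite mkseq_uniq// => i j eij; apply/eqP; apply/negPn/negP => ij.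
      have := oe i j; rewrite eij oe eqxx (negbTE ij) => /eqP.
      by rewrite oner_eq0.
    move=> _ _ /mapP[i _ ->] /mapP[j _ ->]; rewrite oe.
    have [->|ij] := eqVneq i j; first by rewrite eqxx.
    suff -> : (e i == e j) = false by [].
    apply/negbTE/eqP => eij; have := oe i j; rewrite eij oe eqxx (negbTE ij) => /eqP.
    by rewrite oner_eq0.
  move=> x /mapP[j]; rewrite mem_iota add0n ltnS => /andP[_ nj] ->.
  by exists (c j); [exact: cle|exact: hT].
apply/eqP; rewrite eq_le; apply/andP; split.
  by apply: ge_sup => //; exists (c n).
by apply: sup_upper_bound => //; split; [exists (c n)|exists (c n)].
Qed.

(** The diagonal operator with coefficients c; it exists and is unique when c is
bounded. *)
Definition diag (c : nat -> R) : H -> H :=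
  xget (fun=> 0) [set T | bounded_operator T /\ forall n, T (e n) = (c n)%:C *: e n].

Definition bounded_coef (c : nat -> R) := exists M : R, forall n, `|c n| <= M.

Lemma diagP c : bounded_coef c ->
  bounded_operator (diag c) /\ forall n, diag c (e n) = (c n)%:C *: e n.
Proof.
move=> [M hM].
apply: (xgetPex (fun=> 0) (_ : exists T, bounded_operator T /\ forall n, T (e n) = (c n)%:C *: e n)).
have [|n|W [bW hW _]] := @shift_operator (fun n => (c n)%:C) id M; first by [].
  by rewrite cabsR.
by exists W.
Qed.

Lemma diag_unique c T : bounded_coef c -> bounded_operator T ->
  (forall n, T (e n) = (c n)%:C *: e n) -> T = diag c.
Proof.
move=> bc bT hT; have [bd hd] := diagP bc.
by apply: basis_op_ext => // n; rewrite hT hd.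
Qed.

Lemma ip_diag c x n : bounded_coef c -> ip (diag c x) (e n) = (c n)%:C * ip x (e n).
Proof.
move=> bc; have [bd hd] := diagP bc.
have h1 : (fun m => diag c (oproj ip e m x)) @ \oo --> diag c x.
  exact: bo_cvg bd (ce x).
rewrite ipC; rewrite (ip_cvg_eq hH (p := e n) (q := (c n)%:C *: e n) h1 (ce x)).
  by rewrite ipZl conjM conjcR -ipC.
move=> m; rewrite /oproj lin_sum ?ip_sumr; last exact: bo_lin.
apply: eq_bigr => i _; rewrite linZ ?hd; last exact: bo_lin.
rewrite !ipZr ipZl oe conjcR; have [->|ni] := eqVneq n i; first by ring.
by rewrite !mulr0.
Qed.

Lemma diag_symmetric c : bounded_coef c -> symmetric_operator ip (diag c).
Proof.
move=> bc x y; have [bd hd] := diagP bc.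
suff h : adjoint ip (diag c) = diag c by rewrite -{1}h (adjointP' hH bd).
apply: basis_op_ext => // [|n]; first exact: bo_adjoint.
apply: basis_ext => m; rewrite ip_diag// (adjointP' hH bd) hd ipZr conjcR.
by [].
Qed.

Lemma diag_adjoint c : bounded_coef c -> adjoint ip (diag c) = diag c.
Proof. by move=> bc; apply: (adjoint_unique hH) => x y; exact: diag_symmetric. Qed.

(** Only the coefficients at the basis vectors that x meets matter; this gives both
the norm of the operator and the norm of its tails. *)
Lemma diag_tail_le c (B : R) x : bounded_coef c -> 0 <= B ->
  (forall n, ip x (e n) != 0 -> `|c n| <= B) -> nm (diag c x) <= B * nm x.
Proof.
move=> bc B0 hB; have [bd hd] := diagP bc.
apply: (nm_lim_le (ce (diag c x))); exists 0%N => n _.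
rewrite -(@ler_pXn2r _ 2) ?nnegrE ?mulr_ge0 ?nm_ge0// (nm2_proj hH)//.
rewrite exprMn; apply: (@le_trans _ _ (B ^+ 2 * \sum_(i < n) cabs (ip x (e i)) ^+ 2)).
  rewrite mulr_sumr; apply: ler_sum => i _; rewrite ip_diag// cabsM exprMn cabsR.
  have [->|h] := eqVneq (ip x (e i)) 0; first by rewrite cabs0 expr0n !mulr0.
  by rewrite ler_wpM2r ?sqr_ge0// ler_pXn2r ?nnegrE// hB.
by rewrite ler_wpM2l ?sqr_ge0// bessel.
Qed.

(** The quadratic form at the projection of x is a sum of nonnegative terms, and
it converges to the form at x. *)
Lemma diag_positive c : bounded_coef c -> (forall n, 0 <= c n) ->
  positive_operator ip (diag c).
Proof.
move=> bc c0 x; have [bd hd] := diagP bc.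
have im0 : Im (ip (diag c x) x) = 0.
  have : Num.conj (ip (diag c x) x) = ip (diag c x) x.
    by rewrite -ipC -diag_symmetric.
  by case: (ip _ _) => p q [] /= /eqP; rewrite eqNr => /eqP.
rewrite lecE /= im0 eqxx /=.
rewrite leNgt; apply/negP => lt0.
have /cvgn_nm h := bo_cvg bd (ce x).
have nx1 : 0 < nm x + 1 by rewrite ltr_wpDl// nm_ge0.
have s0 : 0 < - Re (ip (diag c x) x) by rewrite oppr_gt0.
have [N hN] := h _ (divr_gt0 s0 nx1).
have := hN _ (leqnn _); rewrite /= ltr_pdivlMr//.
have : - Re (ip (diag c x) x) <= nm (diag c x - diag c (oproj ip e N x)) * nm x.
  apply: le_trans (_ : - Re (ip (diag c x - diag c (oproj ip e N x)) x) <= _); last first.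
    by rewrite -ReN -ipNl (le_trans (Re_ip_le hH _ _))// nmN.
  rewrite ipBl ReB opprB lerDr /oproj lin_sum ?ip_suml ?Re_sum; last exact: bo_lin.
  apply: sumr_ge0 => i _; rewrite linZ ?hd; last exact: bo_lin.
  rewrite !ipZl (ipC ip (e i) x) mulrCA cabs2 -rmorphM /= mulr_ge0 ?sqr_ge0//.
have := nm_ge0 (diag c x - diag c (oproj ip e N x)).
set q := nm _; set r := nm x; set s := - Re _; lra.
Qed.

Lemma diag_comp c d : bounded_coef c -> bounded_coef d ->
  diag c \o diag d = diag (fun n => c n * d n).
Proof.
move=> bc bd; have [b1 h1] := diagP bc; have [b2 h2] := diagP bd.
apply: diag_unique.
- have [M hM] := bc; have [N hN] := bd; exists (M * N) => n.
  by rewrite normrM ler_pM.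
- exact: bo_comp.
- move=> n /=; rewrite h2 linZ ?h1 ?scalerA -?rmorphM ?[d n * _]mulrC//.
  exact: bo_lin.
Qed.

Lemma singular_value_diag c : bounded_coef c -> (forall n, 0 <= c n) ->
  (forall n, c n.+1 <= c n) -> forall n, singular_value ip (diag c) n.+1 = c n.
Proof.
move=> bc c0 cS; have [bd hd] := diagP bc; apply: singular_value_basis => // n.
rewrite diag_adjoint// hd linZ ?hd ?scalerA -?rmorphM ?expr2//; exact: bo_lin.
Qed.

End Basis.

(** * Limits along ultrafilters *)

Section UltraReal.
Context (R : realType).

Lemma ultra_fmap (T U : Type) (F : set_system T) (f : T -> U) :
  UltraFilter F -> UltraFilter (f @ F).
Proof.
move=> FU; have FP : ProperFilter F by exact: ultra_proper.
split=> [|G GP FG]; first exact: fmap_proper_filter.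
apply/seteqP; split => // A GA.
have [//|nA] := in_ultra_setVsetC (f @^-1` A) FU.
exfalso; have : G (A `&` ~` A) by apply: filterI => //; exact: FG.
by rewrite setICr; exact: filter_not_empty.
Qed.

Lemma ultra_real_limit (T : Type) (F : set_system T) (FU : UltraFilter F)
  (f : T -> R) (B : R) : F [set t | `|f t| <= B] ->
  exists2 l : R, `|l| <= B & forall d : R, 0 < d -> F [set t | `|f t - l| < d].
Proof.
move=> hB.
have := @segment_compact R (- B) B; rewrite compact_ultra => /(_ (f @ F) _) [||].
- exact: ultra_fmap.
- have FF : Filter F by exact: ultra_proper.
  by apply: filterS hB => t ht; rewrite /= in_itv /= -ler_norml; exact: ht.
move=> l [/=]; rewrite in_itv /= -ler_norml => lB fl; exists l => // d d0.
have := fl [set y | `|y - l| < d]; apply.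
by apply/nbhs_ballP; exists d => // y; rewrite /ball /= distrC.
Qed.

End UltraReal.

(** * Compactness of diagonal operators *)

Section CompactDiag.
Context (R : realType) (H : completeNormedModType R[i]).
Context (ip : {dot H for Num.conj}) (hH : is_hilbert ip).
Implicit Types (x y z : H) (a b : R[i]) (T S K : H -> H).
Variable e : nat -> H.
Hypotheses (oe : orthonormal_seq ip e) (ce : complete_seq_basis ip e).
Arguments ce : clear implicits.

Let se := orthonormal_suborthonormal hH oe.

Definition vanishing (c : nat -> R) :=
  forall d : R, 0 < d -> exists N, forall n, (N <= n)%N -> `|c n| < d.

(** An ultrafilter on the closure of the image of the ball has all coordinates
convergent, and the tails of the vectors in that set are uniformly small, so
it is Cauchy. *)
Lemma compact_diag (c : nat -> R) : bounded_coef c -> vanishing c ->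
  compact_operator (diag e c).
Proof.
move=> bc c0; have [bd hd] := diagP hH oe bc.
split=> //; rewrite precompactE compact_ultra => F FU.
set X := _ @` _ => FX.
have [M M0 hM] := bo_norm bd.
have lp n : linear (oproj ip e n) by exact: proj_linear.
have bX y : closure X y -> nm y <= M.
  move=> /closure_nm h; apply/ler_addgt0Pr => d /h[_ [x /= x1 <-] hy].
  have := nm_tri (diag e c x) y 0; rewrite !subr0 => /le_trans->//.
  rewrite addrC lerD ?(ltW hy)// (le_trans (hM _))// ler_piMr ?(ltW M0)//.
  by rewrite -lecR -nmE.
(* tails are uniformly small on the closure of the image of the ball *)
have tX y (d : R) N : 0 <= d -> (forall n, (N <= n)%N -> `|c n| < d) -> closure X y ->
    nm (y - oproj ip e N y) <= d.
  move=> d0 hN /closure_nm h; apply/ler_addgt0Pr => r /h[_ [x /= x1 <-] hy].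
  set w := diag e c x in hy *.
  have -> : y - oproj ip e N y = (w - oproj ip e N w) + (y - w - oproj ip e N (y - w)).
    by rewrite (linB y w (lp N)) opprB addrACA addKr [w + _]addrC subrK.
  rewrite (le_trans (nmD _ _))// lerD//; last first.
    by rewrite (le_trans (nm_sub_proj hH _ _ se))// ltW.
  have -> : w - oproj ip e N w = diag e c (x - oproj ip e N x).
    rewrite linB; last exact: bo_lin.
    congr (_ - _); rewrite /oproj lin_sum; last exact: bo_lin.
    apply: eq_bigr => i _; rewrite linZ ?hd ?ip_diag//; last exact: bo_lin.
    by rewrite scalerA mulrC.
  apply: (@le_trans _ _ (d * nm (x - oproj ip e N x))).
    apply: (diag_tail_le hH oe ce) => // n hn; apply/ltW/hN.
    rewrite leqNgt; apply: contraNN hn => nN.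
    by rewrite ipBl ip_proj// subrr.
  rewrite ler_piMr// (le_trans (nm_sub_proj hH _ _ se))//.
  by rewrite -lecR -nmE.
(* the coordinates converge along the ultrafilter *)
have coord i : exists a : R[i], forall d : R, 0 < d ->
    F [set y | cabs (ip y (e i) - a) < d].
  have ei : nm (e i) = 1 by exact: orthonormal_seq_nm.
  have [|p _ hp] := @ultra_real_limit R H F FU (fun y => Re (ip y (e i))) M.
    apply: filterS FX => y /bX yM /=; rewrite (le_trans (normRe_cabs _))//.
    by rewrite (le_trans (cauchy_schwarz hH _ _))// ei mulr1.
  have [|q _ hq] := @ultra_real_limit R H F FU (fun y => Im (ip y (e i))) M.
    apply: filterS FX => y /bX yM /=; rewrite (le_trans (normIm_cabs _))//.
    by rewrite (le_trans (cauchy_schwarz hH _ _))// ei mulr1.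
  exists (p +i* q) => d d0; have d2 : 0 < d / 2 by rewrite divr_gt0.
  apply: filterS (filterI (hp _ d2) (hq _ d2)) => y /= [h1 h2].
  rewrite (le_lt_trans (cabs_ReIm _))// ReB ImD ImN /= [ltRHS]splitr ltrD//.
have /choice[a ha] := coord.
have [l Fl] : exists l : H, F --> l.
  apply: cauchy_nm => d d0; have d3 : 0 < d / 3 by rewrite divr_gt0.
  have [N hN] := c0 _ d3.
  exists (\sum_(i < N) a i *: e i).
  have dN : 0 < d / 3 / N.+1%:R by rewrite divr_gt0.
  have FI : F [set y | forall i : 'I_N, cabs (ip y (e i) - a i) < d / 3 / N.+1%:R].
    by apply: filter_forall => i; exact: ha.
  apply: filterS (filterI FX FI) => y [Xy hy].
  rewrite (le_lt_trans (nm_tri (oproj ip e N y) _ _))//.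
  rewrite (@le_lt_trans _ _ (d / 3 + d / 3))//; last by lra.
  rewrite lerD//; last by rewrite nmBC; apply: tX => //; exact: ltW.
  rewrite /oproj -sumrB (le_trans (nm_sum _ _ _))//.
  apply: (@le_trans _ _ (\sum_(i < N) d / 3 / N.+1%:R)).
    apply: ler_sum => i _; rewrite -scalerBl nmZ (orthonormal_seq_nm hH _ oe) mulr1.
    by rewrite -cabsN opprB; apply/ltW/hy.
  rewrite sumr_const card_ord; set t := d / 3 in d3 *.
  rewrite -[leLHS]mulr_natr -mulrA ler_piMr ?(ltW d3)//.
  by rewrite mulrC ler_pdivrMr// mul1r ler_nat.
exists l; split => //; apply/closure_nm => d d0.
have d2 : 0 < d / 2 by rewrite divr_gt0.
have Fb : F [set y | nm (l - y) < d / 2].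
  by apply: Fl; apply/nbhs_nm; exists (d / 2).
have [y [Xy hy]] := filter_ex (filterI FX Fb).
have [w Xw yw] := proj1 (closure_nm _ _) Xy _ d2.
exists w => //; rewrite (le_lt_trans (nm_tri y _ _))// [ltRHS]splitr ltrD//.
Qed.

End CompactDiag.

(** * Finite-dimensional spaces *)

Section FiniteDim.
Context (R : realType) (H : completeNormedModType R[i]).
Context (ip : {dot H for Num.conj}) (hH : is_hilbert ip).

Lemma finite_dim_singular_value : ~ infinite_dim ip ->
  exists N, forall (T : H -> H) n, (N < n)%N -> singular_value ip T n = 0.
Proof.
move=> fin.
have [N [v hv]] : exists N (v : nat -> H), forall x : H,
    (forall i, (i < N)%N -> ip x (v i) = 0) -> x = 0.
  apply: contrapT => h; apply: fin => n v; apply: contrapT => h2; apply: h.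
  exists n, v => x hx; apply/eqP/negPn/negP => x0; apply: h2; exists x => //.
exists N => T n Nn.
have [su hu] := gram_schmidtP hH v; set u := gram_schmidt ip v in su hu.
have px x : oproj ip u N x = x.
  apply/esym/eqP; rewrite -subr_eq0; apply/eqP/hv => i iN.
  by rewrite ipBl proj_sym hu// subrr.
rewrite /singular_value (_ : [set s | _] = [set 0]) ?sup1//.
apply/seteqP; split=> [s [->//|[s0 [E [oE _]]]]|_ ->]; last by left.
exfalso; have [uE /= iE] := orthonormalP oE.
have szE : size E = n by rewrite size_tuple.
have memE j : (j < n)%N -> nth 0 E j \in tval E.
  by move=> jn; apply: mem_nth; rewrite szE.
suff : (n <= N)%N by rewrite leqNgt Nn.
apply: (@orthonormal_le_dim _ _ _ hH u N (nth 0 E) n su) => //.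
by move=> i j ni nj; rewrite iE ?memE// nth_uniq ?szE.
Qed.

(** The singular values vanish eventually, so the logarithmic ratio is eventually
the quotient of -oo by a negative number. *)
Lemma finite_dim_box_dim (D : operator H) : ~ infinite_dim ip -> box_dim ip D = 0%E.
Proof.
move=> /finite_dim_singular_value[N hN].
rewrite /box_dim (cvg_limn_einf_sup (_ : log_ratio ip D @ \oo --> +oo%E)).1 ?invey//.
apply: cvg_near_cst; exists (maxn N.+1 2) => // n /=; rewrite geq_max => /andP[Nn n2].
rewrite /log_ratio hN//.
have n0 : 0 < (n%:R : R) by rewrite ltr0n (ltn_trans _ n2).
have n1 : (n%:R^-1 : R) < 1 by rewrite invf_lt1// ltr1n.
have ni : 0 < (n%:R^-1 : R) by rewrite invr_gt0.
have l0 : ln (n%:R^-1 : R) < 0 by rewrite ln_lt0// ni.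
rewrite /lne lexx leNgt ni /= inver lt_eqF//.
by rewrite mulNyr ltr0_sg ?invr_lt0// mulN1e.
Qed.

End FiniteDim.

(** * Negative powers of the absolute value *)

Section FunctionalCalculus.
Context (R : realType) (H : completeNormedModType R[i]).
Context (ip : {dot H for Num.conj}) (hH : is_hilbert ip).
Variables (D : operator H) (saD : self_adjoint ip D).
Variables (e : nat -> H) (k : nat -> R).
Hypotheses (oe : orthonormal_seq ip e) (ce : complete_seq_basis ip e).
Hypothesis De : forall n, dom D (e n) /\ D (e n) = ((k n)^-1)%:C *: e n.

(** An eigenvector of D for l is orthogonal to all e n whose eigenvalue is not l, so
the diagonal operator satisfies the description of f(D); and that description
already determines the values on the basis. *)
Lemma functional_calculusE (f : R -> R) :
  bounded_coef (fun n => f (k n)^-1) ->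
  functional_calculus D f = diag e (fun n => f (k n)^-1).
Proof.
move=> bf; have [bd hd] := diagP hH oe bf.
have [bT hT] : bounded_operator (functional_calculus D f) /\
    forall (l : R) x, dom D x -> D x = l%:C *: x ->
      functional_calculus D f x = (f l)%:C *: x.
  apply: (xgetPex (fun=> 0) (_ : exists T, bounded_operator T /\
    forall (l : R) x, dom D x -> D x = l%:C *: x -> T x = (f l)%:C *: x)).
  exists (diag e (fun n => f (k n)^-1)); split => // l x dx Dx.
  apply: (basis_ext ce) => n; rewrite ip_diag// ipZl.
  have [->|xn] := eqVneq (ip x (e n)) 0; first by rewrite !mulr0.
  have [de Den] := De n.
  have := self_adjoint_sym saD dx de; rewrite Dx Den ipZl ipZr conjcR.
  by move=> /(mulIf xn)/complexI ->.
apply: (diag_unique hH oe ce) => // n; have [de Den] := De n.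
by rewrite (hT _ _ de Den).
Qed.

Lemma abs_power_oppE (d : R) : 0 < d -> (exists M : R, forall n, `|k n| <= M) ->
  (forall n, k n != 0) ->
  abs_power_opp D d = diag e (fun n => `|k n| `^ d).
Proof.
move=> d0 [M hM] k0; rewrite /abs_power_opp.
have E : (fun n => `|k n| `^ d) = (fun n => `|(k n)^-1| `^ (- d)).
  apply/funext => n; rewrite normfV -powR_inv1// -powRrM mulrN mulNr mul1r opprK//.
rewrite (functional_calculusE (f := fun l => `|l| `^ (- d))) -?E//.
exists (M `^ d) => n /=; rewrite ger0_norm ?powR_ge0//.
by rewrite ge0_ler_powR ?nnegrE ?(ltW d0)// (le_trans _ (hM n)).
Qed.

End FunctionalCalculus.

(** * Logarithmic asymptotics of sequences *)

Section LogAsymptotics.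
Context (R : realType).
Implicit Types (u s mu : nat -> R) (d l : R).

Lemma cvgn_eps u l : u @ \oo --> l <->
  (forall d : R, 0 < d -> exists N, forall n, (N <= n)%N -> `|u n - l| < d).
Proof.
split=> [/cvgrPdist_lt h d /h[N _ hN]|h].
  by exists N => n Nn; rewrite distrC; exact: hN.
apply/cvgrPdist_lt => d /h[N hN]; exists N => // n Nn.
by rewrite distrC; exact: hN.
Qed.

Lemma ln_large (M : R) : exists N, forall n, (N <= n)%N -> M <= ln (n%:R : R).
Proof.
exists (Num.truncn (expR M)).+1 => n Nn.
have h : expR M <= n%:R.
  by rewrite (le_trans (ltW (truncnS_gt _)))// ler_nat.
by rewrite -[M]expRK ler_ln ?posrE ?expR_gt0// (lt_le_trans (expR_gt0 M)).
Qed.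

(** ln (1 - x) <= - x at x = 1/(n+1). *)
Lemma ln_ratio_le (n : nat) : (0 < n)%N ->
  n.+1%:R^-1 <= ln (n.+1%:R : R) - ln n%:R.
Proof.
move=> n0; have n0' : 0 < (n%:R : R) by rewrite ltr0n.
have h := @le_ln1Dx R (- n.+1%:R^-1).
have e1 : 1 + - n.+1%:R^-1 = n%:R / n.+1%:R :> R.
  by rewrite -[n.+1]addn1 natrD; field; apply: lt0r_neq0; lra.
rewrite e1 ln_div ?posrE// in h.
have : ln (n%:R : R) - ln n.+1%:R <= - n.+1%:R^-1.
  by apply: h; rewrite ltrN2 invf_lt1 ?ltr1n// ltnS.
by set a := ln _; set b := ln _; set c := _^-1; lra.
Qed.

Lemma harmonic_le (n : nat) : (0 < n)%N ->
  \sum_(1 <= k < n.+1) (k%:R^-1 : R) <= 1 + ln n%:R.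
Proof.
case: n => // n _; elim: n => [|n IH]; first by rewrite big_nat1 ln1 invr1 addr0.
rewrite big_nat_recr//=; apply: (le_trans (lerD IH (@ln_ratio_le n.+1 isT))).
by set a := ln n.+1%:R; set b := ln _; lra.
Qed.

Lemma harmonic_ge (N n : nat) : (0 < N)%N -> (N <= n)%N ->
  ln (n.+1%:R : R) - ln N%:R <= \sum_(N <= k < n.+1) (k%:R^-1 : R).
Proof.
move=> N0 /subnK <-; elim: (n - N)%N => [|m IH]; rewrite ?add0n ?addSn.
  rewrite big_nat1; have := @le_ln1Dx R N%:R^-1.
  have e1 : 1 + N%:R^-1 = N.+1%:R / N%:R :> R.
    by rewrite -[N.+1]addn1 natrD; field; rewrite pnatr_eq0 -lt0n.
  rewrite e1 ln_div ?posrE ?ltr0n// => -> //.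
  by rewrite (lt_trans (ltrN10 _))// invr_gt0 ltr0n.
rewrite big_nat_recr/=; last by rewrite ltnW// ltnS leq_addl.
set p := (m + N).+1.
have := @le_ln1Dx R p%:R^-1.
have e1 : 1 + p%:R^-1 = p.+1%:R / p%:R :> R.
  by rewrite -[p.+1]addn1 natrD; field; rewrite pnatr_eq0.
rewrite e1 ln_div ?posrE ?ltr0n// => h.
have {}h : ln (p.+1%:R : R) - ln p%:R <= p%:R^-1.
  by apply: h; rewrite (lt_trans (ltrN10 _))// invr_gt0 ltr0n.
by move: IH; rewrite -/p; lra.
Qed.

(** A sequence that is o(1/n) has partial sums that are o of the harmonic sums. *)
Lemma littleo_ln s : (forall d, 0 < d -> exists N, forall n, (N <= n)%N ->
    `|s n| <= d / n%:R) ->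
  (fun n : nat => \sum_(1 <= k < n.+1) s k : R^o)
    =o_\oo (fun n : nat => ln n%:R : R^o).
Proof.
move=> h; apply/eqoP => d d0.
have d2 : 0 < d / 2 / 2 by rewrite !divr_gt0.
have [N hN] := h _ d2.
pose C := \sum_(1 <= k < N.+1) `|s k|.
have [M hM] := ln_large ((C + d / 2 / 2) / (d / 2 / 2) + 1).
exists (maxn (maxn N M) 1) => // n /=; rewrite !geq_max => /andP[/andP[Nn Mn] n1].
have ln0 : 0 <= ln (n%:R : R) by rewrite ln_ge0// ler1n.
rewrite [X in _ <= _ * X]ger0_norm//.
apply: (@le_trans _ _ (C + \sum_(1 <= k < n.+1) d / 2 / 2 / k%:R)).
  apply: le_trans (ler_norm_sum _ _ _) _.
  apply: (@le_trans _ _ (\sum_(1 <= k < n.+1) ((if (k < N.+1)%N then `|s k| else 0)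
       + d / 2 / 2 / k%:R))).
    apply: ler_sum_nat => k /andP[k1 kn]; case: ltnP => kN.
      by rewrite lerDl divr_ge0// ltW.
    by rewrite add0r hN// ltnW.
  rewrite big_split /= lerD2r /C.
  rewrite (big_cat_nat (_ : 1 <= N.+1)%N (_ : N.+1 <= n.+1)%N)//=.
  rewrite [X in _ + X]big_nat_cond [X in _ + X]big1 ?addr0.
    rewrite le_eqVlt; apply/orP; left; apply/eqP; apply: eq_big_nat => k /andP[_ ->].
    by [].
  by move=> k /andP[/andP[kN _] _]; rewrite ltnNge kN.
rewrite -mulr_sumr.
(* the terms up to N give C, and the others at most (d/4) (1 + ln n) *)
have h1 := harmonic_le n1.
have h2 := hM n Mn.
set q := d / 2 / 2 in d2 h2 *.
have h3 : q * \sum_(1 <= k < n.+1) k%:R^-1 <= q * (1 + ln n%:R).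
  by apply: ler_wpM2l h1; exact: ltW.
apply: le_trans (lerD (lexx C) h3) _.
have h4 : C + q <= q * ln n%:R.
  rewrite -ler_pdivrMl// mulrC; apply: le_trans h2; rewrite lerDl//.
have -> : d = 4 * q by rewrite /q; field.
by move: h4 (mulr_ge0 (ltW d2) ln0); set L := ln _; rewrite mulrDr mulr1; lra.
Qed.

(** The partial sums exceed ln n minus a constant, which is more than (ln n) / 2. *)
Lemma not_littleo_ln s : (forall n, 0 <= s n) ->
  (exists N, forall n, (N <= n)%N -> n%:R^-1 <= s n) ->
  ~ ((fun n : nat => \sum_(1 <= k < n.+1) s k : R^o)
    =o_\oo (fun n : nat => ln n%:R : R^o)).
Proof.
move=> s0 [N hN] /eqoP h.
have [M _ hM] := h (1 / 2) (ltac:(by rewrite divr_gt0)).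
have [P hP] := ln_large (2 * ln N.+1%:R + 1).
pose n := (maxn (maxn N.+1 M) P).
have Nn : (N.+1 <= n)%N by rewrite /n !leq_max leqnn.
have Mn : (M <= n)%N by rewrite /n !leq_max leqnn orbT.
have Pn : (P <= n)%N by rewrite /n !leq_max leqnn !orbT.
have n0 : (0 < n)%N by exact: leq_trans Nn.
have := hM n Mn; rewrite /= ger0_norm; last by apply: sumr_ge0.
rewrite ger0_norm; last by rewrite ln_ge0// ler1n.
have h1 := harmonic_ge (isT : 0 < N.+1)%N Nn.
have h2 : \sum_(N.+1 <= k < n.+1) (k%:R^-1 : R) <= \sum_(1 <= k < n.+1) s k.
  rewrite [leRHS](big_cat_nat (_ : 1 <= N.+1)%N (_ : N.+1 <= n.+1)%N)//=; last exact: ltnW.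
  rewrite ler_wpDl ?sumr_ge0//; apply: ler_sum_nat => k /andP[kN _]; apply: hN.
  exact: ltnW.
have h3 := hP n Pn.
have h4 : ln (n%:R : R) <= ln n.+1%:R by rewrite ler_ln ?posrE ?ltr0n// ler_nat.
by move=> h5; move: h1 h2 h3 h4 h5; set a := ln _; set b := ln _; lra.
Qed.

Variable mu : nat -> R.
Hypothesis mu_gt0 : forall n, (0 < n)%N -> 0 < mu n.

(** The real-valued version of [log_ratio]. *)
Definition ln_ratio (n : nat) : R := ln (mu n) / ln n%:R^-1.

Lemma ln_muE n : (1 < n)%N -> ln (mu n) = - ln_ratio n * ln n%:R.
Proof.
move=> n1; rewrite /ln_ratio lnV ?posrE ?ltr0n ?(ltn_trans _ n1)//.
have l0 : ln (n%:R : R) != 0 by rewrite gt_eqF// ln_gt0// ltr1n.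
by field.
Qed.

(** mu n ^ d = n^(- d ln_ratio n), and the exponent is eventually below -1 - c for a
fixed c > 0, while n^(-c) tends to 0. *)
Lemma powR_mu_small (dl d : R) : ln_ratio @ \oo --> dl -> 0 < d -> 1 < d * dl ->
  forall eps, 0 < eps -> exists N, forall n, (N <= n)%N -> `|mu n `^ d| <= eps / n%:R.
Proof.
move=> /cvgn_eps h d0 dd eps e0.
pose c := (d * dl - 1) / 2.
have c0 : 0 < c by rewrite divr_gt0// subr_gt0.
have [N hN] := h _ (divr_gt0 c0 d0).
have [M hM] := ln_large (- ln eps / c).
exists (maxn (maxn N M) 2) => n; rewrite !geq_max => /andP[/andP[/hN h1 /hM h2] n1].
have n0 : (0 < n)%N by exact: ltn_trans n1.
have m0 := mu_gt0 n0; have nR : 0 < (n%:R : R) by rewrite ltr0n.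
rewrite ger0_norm ?powR_ge0// -ler_ln ?posrE ?powR_gt0 ?divr_gt0//.
rewrite ln_powR ln_div ?posrE// ln_muE//.
have l0 : 0 < ln (n%:R : R) by rewrite ln_gt0// ltr1n.
have : 1 + c <= d * ln_ratio n.
  move: h1; rewrite ltr_norml => /andP[h1 _].
  have : d * (dl - c / d) <= d * ln_ratio n by rewrite ler_wpM2l ?(ltW d0)//; lra.
  by rewrite mulrBr mulrCA mulfV ?gt_eqF// mulr1 /c; lra.
move: h2; rewrite ler_pdivrMr// mulrC => h2 h3.
have := ler_wpM2r (ltW l0) h3; rewrite mulrDl mul1r.
set L := ln n%:R in h2 *; set r := ln_ratio n.
have -> : d * (- r * L) = - (d * r * L) by ring.
lra.
Qed.

Lemma powR_mu_large (dl d : R) : ln_ratio @ \oo --> dl -> 0 < d -> d * dl < 1 ->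
  exists N, forall n, (N <= n)%N -> n%:R^-1 <= mu n `^ d.
Proof.
move=> /cvgn_eps h d0 dd.
pose c := (1 - d * dl).
have c0 : 0 < c by rewrite subr_gt0.
have [N hN] := h _ (divr_gt0 c0 d0).
exists (maxn N 2) => n; rewrite geq_max => /andP[/hN h1 n1].
have n0 : (0 < n)%N by exact: ltn_trans n1.
have m0 := mu_gt0 n0; have nR : 0 < (n%:R : R) by rewrite ltr0n.
rewrite -ler_ln ?posrE ?powR_gt0 ?invr_gt0//.
rewrite ln_powR lnV ?posrE// ln_muE//.
have l0 : 0 < ln (n%:R : R) by rewrite ln_gt0// ltr1n.
have h2 : d * ln_ratio n <= 1.
  move: h1; rewrite ltr_norml => /andP[_]; rewrite ltr_pdivlMr// mulrBl /c.
  by rewrite mulrC (mulrC dl); lra.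
have := ler_wpM2r (ltW l0) h2; rewrite mul1r.
set L := ln n%:R; set r := ln_ratio n.
have -> : d * (- r * L) = - (d * r * L) by ring.
lra.
Qed.

Lemma ln_ratio_limit_ge0 (dl : R) :
  (exists N, forall n, (N <= n)%N -> mu n <= 1) ->
  ln_ratio @ \oo --> dl -> 0 <= dl.
Proof.
move=> [N hN] /cvgn_eps h; apply/ler_addgt0Pl => e /h[M hM].
pose n := maxn (maxn N M) 2.
have Nn : (N <= n)%N by rewrite /n !leq_max leqnn.
have Mn : (M <= n)%N by rewrite /n !leq_max leqnn orbT.
have n2 : (1 < n)%N by rewrite /n !leq_max leqnn !orbT.
have := hM n Mn; rewrite ltr_norml => /andP[_].
have : 0 <= ln_ratio n.
  rewrite /ln_ratio mulr_le0//; first by rewrite ln_le0// hN.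
  rewrite invr_le0 ln_le0// invf_le1 ?ltr0n ?ler1n ?(ltn_trans _ n2)//.
lra.
Qed.

Hypothesis mu_noninc : forall m n, (0 < m)%N -> (m <= n)%N -> mu n <= mu m.

(** Along powers of 2, - ln (mu (2^k)) has increments tending to ln L, so it is
k ln L + o(k). For 2^k <= n < 2^(k+1) monotonicity traps - ln (mu n) between
consecutive values, while ln n is k ln 2 up to a bounded error. *)
Lemma ln_ratio_of_doubling (L : R) :
  (fun n => mu n / mu (2 * n)%N) @ \oo --> L ->
  1 <= L /\ ln_ratio @ \oo --> ln L / ln 2.
Proof.
move=> /cvgn_eps h.
have r1 n : (0 < n)%N -> 1 <= mu n / mu (2 * n)%N.
  move=> n0; have m0 : 0 < mu (2 * n)%N by rewrite mu_gt0// muln_gt0.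
  by rewrite ler_pdivlMr// mul1r mu_noninc// leq_pmull.
have L1 : 1 <= L.
  apply/ler_addgt0Pl => e /h[N hN].
  have := hN N.+1 (leqnSn _); have := r1 N.+1 isT; rewrite ltr_norml => ? /andP[_].
  lra.
split=> //; apply/cvgn_eps => e e0.
have L0 : 0 < L by exact: lt_le_trans L1.
set lam := ln L; have lam0 : 0 <= lam by exact: ln_ge0.
pose q := e / 8; have q0 : 0 < q by rewrite divr_gt0.
(* eventually the logarithm of the doubling ratio is within q of lam *)
have [N hN] : exists N, forall n, (N <= n)%N ->
    `|ln (mu n) - ln (mu (2 * n)%N) - lam| <= q.
  (* r is so small that L - r and L + r are within the factors exp (-q) and
     exp q of L *)
  pose r := Num.min (L * (expR q - 1)) (L * (1 - expR (- q))).
  have r0 : 0 < r.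
    by rewrite lt_min !mulr_gt0// subr_gt0 ?expR_gt1 ?expR_lt1 ?oppr_lt0.
  have [N hN] := h _ r0; exists N.+1 => n Nn.
  have n0 : (0 < n)%N by exact: leq_trans Nn.
  have m0 := mu_gt0 n0.
  have m1 : 0 < mu (2 * n)%N by rewrite mu_gt0// muln_gt0.
  rewrite -ln_div ?posrE//; have := hN n (ltnW Nn).
  set x := mu n / _; have x0 : 0 < x by rewrite divr_gt0.
  clearbody x.
  rewrite ltr_norml => /andP[h1 h2].
  have h3 : x <= L * expR q.
    have : r <= L * (expR q - 1) by rewrite ge_min lexx.
    by rewrite mulrBr mulr1; lra.
  have h4 : L * expR (- q) <= x.
    have : r <= L * (1 - expR (- q)) by rewrite ge_min lexx orbT.
    by rewrite mulrBr mulr1; lra.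
  have E0 := expR_gt0 q; have E1 := expR_gt0 (- q).
  have F0 : 0 < L * expR q by exact: mulr_gt0.
  have F1 : 0 < L * expR (- q) by exact: mulr_gt0.
  have : ln x <= ln (L * expR q) by rewrite ler_ln ?posrE.
  have : ln (L * expR (- q)) <= ln x by rewrite ler_ln ?posrE.
  rewrite !lnM ?posrE// !expRK -/lam => h5 h6.
  rewrite ler_norml; lra.
(* summing the increments of b from N on *)
pose b k := - ln (mu (2 ^ k)%N).
have bS k : (N <= k)%N -> `|b k.+1 - b k - lam| <= q.
  move=> Nk.
  have -> : b k.+1 - b k = ln (mu (2 ^ k)%N) - ln (mu (2 * 2 ^ k)%N).
    by rewrite /b expnS opprK addrC.
  apply: hN.
  by rewrite (leq_trans Nk)// ltnW// ltn_expl.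
have bk k : `|b (k + N)%N - b N - k%:R * lam| <= k%:R * q.
  elim: k => [|k IH]; first by rewrite add0n subrr !mul0r subr0 normr0.
  have := bS (k + N)%N (leq_addl _ _); rewrite addSn.
  move: IH; rewrite !ler_norml -[k.+1]addn1 natrD => /andP[? ?] /andP[? ?].
  by apply/andP; split; lra.
pose C := `|b N| + N%:R * lam + lam.
have C0 : 0 <= C by rewrite !addr_ge0// mulr_ge0.
pose P := maxn (maxn N (Num.truncn (C / q)).+1) 1.
exists (2 ^ P)%N => n Pn.
have n0 : (0 < n)%N by rewrite (leq_trans _ Pn)// expn_gt0.
(* 2^k <= n < 2^(k+1), and k is so large that the constant C, which collects the
   bounded errors, is at most q k *)
have /andP[k1 k2] := trunc_log_bounds (isT : 1 < 2)%N n0.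
set k := trunc_log 2 n in k1 k2.
have Pk : (P <= k)%N by rewrite -ltnS -(ltn_exp2l _ _ (isT : 1 < 2)%N) (leq_ltn_trans Pn).
have Nk : (N <= k)%N by rewrite (leq_trans _ Pk)// /P !leq_max leqnn.
have k0 : (0 < k)%N by rewrite (leq_trans _ Pk)// /P !leq_max leqnn !orbT.
have kC : C <= q * k%:R.
  rewrite -ler_pdivrMl// mulrC (le_trans (ltW (truncnS_gt _)))// ler_nat.
  by rewrite (leq_trans _ Pk)// /P !leq_max leqnn orbT.
have kR : 1 <= (k%:R : R) by rewrite ler1n.
have ln2 : 0 < ln (2 : R) by rewrite ln_gt0// ltr1n.
have ln2h : 1 / 2 <= ln (2 : R).
  by have := @ln_ratio_le 1 isT; rewrite ln1 subr0 div1r.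
have lnn1 : k%:R * ln 2 <= ln (n%:R : R).
  rewrite mulr_natl -lnXn ?ltr0n// ler_ln ?posrE ?exprn_gt0 ?ltr0n//.
  by rewrite -natrX ler_nat.
have lnn2 : ln (n%:R : R) <= (k%:R + 1) * ln 2.
  have -> : (k%:R + 1) * ln 2 = ln (2 ^+ k.+1 : R).
    by rewrite natr1 mulr_natl lnXn.
  by rewrite ler_ln ?posrE ?exprn_gt0 ?ltr0n// -natrX ler_nat ltnW.
have m1 : b k <= - ln (mu n).
  by rewrite /b lerN2 ler_ln ?posrE ?mu_gt0 ?expn_gt0// mu_noninc// expn_gt0.
have m2 : - ln (mu n) <= b k.+1.
  by rewrite /b lerN2 ler_ln ?posrE ?mu_gt0 ?expn_gt0// mu_noninc// ltnW.
have := bk (k - N)%N; have := bk (k.+1 - N)%N.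
rewrite !subnK// ?(leq_trans Nk)// !ler_norml natrB ?(leq_trans Nk)// natrB//.
rewrite -[k.+1]addn1 natrD => /andP[_ u1] /andP[u2 _].
have /andP[aN1 aN2] : (- `|b N| <= b N) && (b N <= `|b N|) by rewrite -ler_norml.
have NR : 0 <= (N%:R : R) by [].
have Nkr : (N%:R : R) <= k%:R by rewrite ler_nat.
have Nq : 0 <= N%:R * q by rewrite mulr_ge0// ltW.
have Nl : 0 <= N%:R * lam by rewrite mulr_ge0.
have z1 : lam / ln 2 * ln n%:R <= (k%:R + 1) * lam.
  rewrite mulrAC ler_pdivrMr// (mulrC _ lam) -mulrA ler_wpM2l//.
have z2 : k%:R * lam <= lam / ln 2 * ln n%:R.
  rewrite mulrAC ler_pdivlMr// (mulrC _ lam) -mulrA ler_wpM2l//.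
have n2 : (1 < n)%N by rewrite (leq_trans _ k1)// -{1}(expn0 2) ltn_exp2l.
have lnn0 : 0 < ln (n%:R : R) by rewrite ln_gt0// ltr1n.
have key : `|ln_ratio n - lam / ln 2| * ln n%:R <= (2 * k%:R + 1) * q.
  rewrite -[X in _ * X](ger0_norm (ltW lnn0)) -normrM mulrBl.
  have -> : ln_ratio n * ln n%:R = - ln (mu n) by rewrite ln_muE// mulNr opprK.
  rewrite addn1 in u1; have kC' : `|b N| + N%:R * lam + lam <= q * k%:R by [].
  rewrite ler_norml; move: u1 u2 m1 m2 aN1 aN2 z1 z2 Nq Nl kC' q0 lam0; clear.
  set x := - ln (mu n); set y := lam / ln 2 * _; set bN := `|b N|.
  move=> *; apply/andP; split; lra.
rewrite -(ltr_pM2r lnn0) (le_lt_trans key)//.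
apply: (@lt_le_trans _ _ (e * (k%:R * ln 2))); last by rewrite ler_wpM2l// ltW.
have -> : e = 8 * q by rewrite /q; field.
have : 8 * q * (k%:R * (1 / 2)) <= 8 * q * (k%:R * ln 2).
  apply: ler_wpM2l; first by rewrite mulr_ge0// ltW.
  exact: ler_wpM2l.
apply: lt_le_trans; have := ler_wpM2r (ltW q0) kR; lra.
Qed.

End LogAsymptotics.

(** * Banach limits *)

Section BanachLimit.
Context (R : realType).
Implicit Types (x y : nat -> R) (a l : R).

Definition mean x n : R := n.+1%:R^-1 * \sum_(k < n.+1) x k.

Lemma mean_lin a x y n : mean (fun k => a * x k + y k) n = a * mean x n + mean y n.
Proof. by rewrite /mean big_split /= -mulr_sumr mulrDr mulrCA. Qed.

Lemma mean_le x y n : (forall k, x k <= y k) -> mean x n <= mean y n.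
Proof. by move=> h; rewrite /mean ler_wpM2l ?invr_ge0//; exact: ler_sum. Qed.

Lemma mean_cst a n : mean (fun=> a) n = a.
Proof. by rewrite /mean sumr_const card_ord -[a *+ _]mulr_natl mulKf// pnatr_eq0. Qed.

Lemma mean_bounded x : bounded_coef x -> bounded_coef (mean x).
Proof.
move=> [M hM]; exists M => n; rewrite ler_norml; apply/andP; split.
  rewrite -(mean_cst (- M) n); apply: mean_le => k.
  by have := hM k; rewrite ler_norml => /andP[].
rewrite -[leRHS](mean_cst M n); apply: mean_le => k.
by have := hM k; rewrite ler_norml => /andP[].
Qed.

Lemma mean_cvg x l : x @ \oo --> l -> mean x @ \oo --> l.
Proof.
move=> /cesaro; rewrite /arithmetic_mean /mean /series /=.
by under eq_fun do rewrite big_mkord.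
Qed.

(** A free ultrafilter on nat, fixed once and for all. *)
Definition banach_ultra : set_system nat :=
  xget (eventually : set_system nat) [set G | UltraFilter G /\ eventually `<=` G].

Lemma banach_ultraP : UltraFilter banach_ultra /\ eventually `<=` banach_ultra.
Proof.
apply: (xgetPex _ (_ : exists G, UltraFilter G /\ (eventually : set_system nat) `<=` G)).
exact: (@ultraFilterLemma nat eventually eventually_filter).
Qed.

#[local] Instance banach_ultra_ultra : UltraFilter banach_ultra := banach_ultraP.1.

(** The limit of the Cesaro means along the ultrafilter. Taking means first makes
the limit shift-invariant. *)
Definition banach_lim x : R :=
  xget 0 [set l | forall d : R, 0 < d -> banach_ultra [set n | `|mean x n - l| < d]].

Lemma banach_limP x : bounded_coef x ->
  forall d : R, 0 < d -> banach_ultra [set n | `|mean x n - banach_lim x| < d].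
Proof.
move=> /mean_bounded[M hM].
apply: (xgetPex 0 (_ : exists l, forall d : R, 0 < d -> banach_ultra [set n | `|mean x n - l| < d])).
have [|l _ hl] := @ultra_real_limit R nat _ banach_ultra_ultra (mean x) M; last by exists l.
by apply: filterS filterT => n _ /=.
Qed.

Lemma banach_lim_unique x l : bounded_coef x ->
  (forall d : R, 0 < d -> banach_ultra [set n | `|mean x n - l| < d]) ->
  banach_lim x = l.
Proof.
move=> bx hl; apply/eqP; rewrite -subr_eq0 -normr_le0.
apply/ler_addgt0Pr => d d0; rewrite add0r.
have d2 : 0 < d / 2 by rewrite divr_gt0.
have [n /= [h1 h2]] := filter_ex (filterI (banach_limP bx d2) (hl _ d2)).
have -> : banach_lim x - l = (mean x n - l) - (mean x n - banach_lim x) by ring.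
by rewrite (le_trans (ler_normB _ _))// [leRHS]splitr ltW// ltrD.
Qed.

Lemma banach_lim_mean_cvg x l : bounded_coef x -> mean x @ \oo --> l -> banach_lim x = l.
Proof.
move=> bx /cvgn_eps h; apply: banach_lim_unique => // d /h[N hN].
by apply: banach_ultraP.2; exists N.
Qed.

Lemma banach_lim_cvg x l : bounded_coef x -> x @ \oo --> l -> banach_lim x = l.
Proof. by move=> bx /mean_cvg; exact: banach_lim_mean_cvg. Qed.

Lemma bounded_coef_lin a x y : bounded_coef x -> bounded_coef y ->
  bounded_coef (fun k => a * x k + y k).
Proof.
move=> [M hM] [N hN]; exists (`|a| * M + N) => n.
by rewrite (le_trans (ler_normD _ _))// lerD// normrM ler_wpM2l.
Qed.

Lemma banach_lim_lin a x y : bounded_coef x -> bounded_coef y ->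
  banach_lim (fun k => a * x k + y k) = a * banach_lim x + banach_lim y.
Proof.
move=> bx b_y; apply: banach_lim_unique; first exact: bounded_coef_lin.
move=> d d0; have d2 : 0 < d / 2 by rewrite divr_gt0.
have a1 : 0 < `|a| + 1 by rewrite ltr_wpDl.
have d3 : 0 < d / 2 / (`|a| + 1) by rewrite divr_gt0.
apply: filterS (filterI (banach_limP bx d3) (banach_limP b_y d2)) => n /= [h1 h2].
rewrite mean_lin opprD addrACA -mulrBr (le_lt_trans (ler_normD _ _))//.
rewrite [ltRHS]splitr ler_ltD// normrM; move: h1; rewrite ltr_pdivlMr// => /ltW.
by apply: le_trans; rewrite mulrC ler_wpM2l// lerDl.
Qed.

Lemma banach_lim_le x y : bounded_coef x -> bounded_coef y ->
  (forall k, x k <= y k) -> banach_lim x <= banach_lim y.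
Proof.
move=> bx b_y xy; apply/ler_addgt0Pr => d d0.
have d2 : 0 < d / 2 by rewrite divr_gt0.
have [n /= [h1 h2]] := filter_ex (filterI (banach_limP bx d2) (banach_limP b_y d2)).
have h3 := mean_le n xy.
move: h1 h2; rewrite !ltr_norml => /andP[? ?] /andP[? ?]; lra.
Qed.

(** The means of x (k+1) - x k telescope to a bounded quantity divided by n, so
they tend to 0. *)
Lemma banach_lim_telescope x y : bounded_coef x -> bounded_coef y ->
  (fun k => y k - (x k.+1 - x k)) @ \oo --> 0 -> banach_lim y = 0.
Proof.
move=> bx b_y h.
pose w k := y k - (x k.+1 - x k).
pose s k := x k.+1 - x k.
have bs : bounded_coef s.
  have [M hM] := bx; exists (M + M) => n.
  by rewrite (le_trans (ler_normB _ _))// lerD.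
have bw : bounded_coef w.
  have [M hM] := bs; have [N hN] := b_y; exists (N + M) => n.
  apply: le_trans (ler_normB _ _) _; apply: lerD; [exact: hN|exact: hM].
have -> : y = (fun k => 1 * s k + w k) by apply/funext => k; rewrite mul1r /w /s addrC subrK.
rewrite banach_lim_lin// mul1r (banach_lim_cvg bw h) addr0.
apply: banach_lim_mean_cvg => //; apply/cvgn_eps => d d0.
have [M hM] := bx.
have M0 : 0 <= M by exact: le_trans (hM 0%N).
exists (Num.truncn ((M + M) / d)).+1 => n nN.
rewrite subr0 /mean -(big_mkord xpredT s) telescope_sumr//.
rewrite normrM ger0_norm ?invr_ge0// mulrC ltr_pdivrMr//.
rewrite (le_lt_trans (ler_normB _ _))// (le_lt_trans (lerD (hM _) (hM _)))//.
rewrite -ltr_pdivrMl// mulrC (lt_le_trans (truncnS_gt _))// ler_nat.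
by rewrite (leq_trans nN)// leqnSn.
Qed.

Definition cbounded (z : nat -> R[i]) := exists M : R, forall n, cabs (z n) <= M.

Definition cbanach_lim (z : nat -> R[i]) : R[i] :=
  banach_lim (fun n => Re (z n)) +i* banach_lim (fun n => Im (z n)).

Lemma cbounded_Re z : cbounded z -> bounded_coef (fun n => Re (z n)).
Proof. by move=> [M hM]; exists M => n; exact: le_trans (normRe_cabs _) (hM n). Qed.

Lemma cbounded_Im z : cbounded z -> bounded_coef (fun n => Im (z n)).
Proof. by move=> [M hM]; exists M => n; exact: le_trans (normIm_cabs _) (hM n). Qed.

Lemma cbanach_lim_lin (c : R[i]) z w : cbounded z -> cbounded w ->
  cbanach_lim (fun k => c * z k + w k) = c * cbanach_lim z + cbanach_lim w.
Proof.
move=> bz bw; have bzr := cbounded_Re bz; have bzi := cbounded_Im bz.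
have bwr := cbounded_Re bw; have bwi := cbounded_Im bw.
case: c => p q; rewrite /cbanach_lim.
have -> : (fun n => Re ((p +i* q) * z n + w n)) =
    (fun n => p * Re (z n) + ((- q) * Im (z n) + Re (w n))).
  by apply/funext => n; case: (z n) (w n) => ? ? [? ?] /=; ring.
have -> : (fun n => Im ((p +i* q) * z n + w n)) =
    (fun n => p * Im (z n) + (q * Re (z n) + Im (w n))).
  by apply/funext => n; case: (z n) (w n) => ? ? [? ?] /=; ring.
rewrite !banach_lim_lin//; try exact: bounded_coef_lin.
by apply/eqP; rewrite eq_complex /=; apply/andP; split; apply/eqP; ring.
Qed.

End BanachLimit.

(** * Trace of operators of finite rank *)

Section FiniteRankTrace.
Context (R : realType) (H : completeNormedModType R[i]).
Context (ip : {dot H for Num.conj}) (hH : is_hilbert ip).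
Implicit Types (x y z : H) (a b : R[i]) (T S K F G : H -> H).
Variable e : nat -> H.
Hypotheses (oe : orthonormal_seq ip e) (ce : complete_seq_basis ip e).
Arguments ce : clear implicits.

Definition trace_partial F n : R[i] := \sum_(i < n) ip (F (e i)) (e i).

(** The limit of the partial sums along the fixed basis e; it is used only for
operators of finite rank, where the sums converge. *)
Definition trace F : R[i] :=
  xget 0 [set l | forall d : R, 0 < d -> exists N, forall n, (N <= n)%N ->
    cabs (trace_partial F n - l) < d].

(** The trace can be computed on any orthonormal family that spans the range, by
exchanging the two sums. Linearity and unitary invariance follow. *)
Lemma traceE F u m : suborthonormal ip u -> bounded_operator F ->
  (forall x, oproj ip u m (F x) = F x) ->
  trace F = \sum_(j < m) ip (F (u j)) (u j).
Proof.
move=> su bF hF; set s := \sum_(_ < m) _.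
have key : forall d : R, 0 < d -> exists N, forall n, (N <= n)%N ->
    cabs (trace_partial F n - s) < d.
  move=> d d0; have d1 : 0 < d / m.+1%:R by rewrite divr_gt0.
  have [N _ hN] : \forall n \near \oo, forall j : 'I_m,
      nm (F (u j) - F (oproj ip e n (u j))) < d / m.+1%:R.
    apply: filter_forall => j.
    have /cvgn_nm/(_ _ d1)[N hN] := bo_cvg bF (ce (u j)).
    by exists N.
  exists N => n /hN {}hN.
  have -> : trace_partial F n = \sum_(j < m) ip (F (oproj ip e n (u j))) (u j).
    rewrite /trace_partial.
    transitivity (\sum_(i < n) \sum_(j < m) ip (F (e i)) (u j) * ip (u j) (e i)).
      apply: eq_bigr => i _; rewrite -[in LHS](hF (e i)) /oproj ip_suml.
      by apply: eq_bigr => j _; rewrite ipZl.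
    rewrite exchange_big; apply: eq_bigr => j _ /=.
    rewrite /oproj lin_sum ?ip_suml; last exact: bo_lin.
    by apply: eq_bigr => i _; rewrite linZ ?ipZl 1?mulrC//; exact: bo_lin.
  rewrite -sumrB (le_lt_trans (cabs_sum _ _ _))//.
  apply: (@le_lt_trans _ _ (\sum_(j < m) d / m.+1%:R)).
    apply: ler_sum => j _; rewrite -ipBl (le_trans (cauchy_schwarz hH _ _))//.
    rewrite nmBC; apply: le_trans (ltW (hN j)).
    by case: (su.2 j) => ->; rewrite ?nm0 ?mulr0 ?mulr1// nm_ge0.
  rewrite sumr_const card_ord -[ltLHS]mulr_natr mulrAC ltr_pdivrMr//.
  by rewrite ltr_pM2l// ltr_nat.
have ht : forall d : R, 0 < d -> exists N, forall n, (N <= n)%N ->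
    cabs (trace_partial F n - trace F) < d.
  exact: (xgetPex 0 (ex_intro (fun l => forall d : R, 0 < d ->
    exists N, forall n, (N <= n)%N -> cabs (trace_partial F n - l) < d) s key)).
apply/eqP; rewrite -subr_eq0; apply/eqP/eq0_normc/eqP.
rewrite -/(cabs _) eq_le cabs_ge0 andbT; apply/ler_addgt0Pr => d d0; rewrite add0r.
have d2 : 0 < d / 2 by rewrite divr_gt0.
have [N hN] := key _ d2; have [M hM] := ht _ d2.
have -> : trace F - s = (trace_partial F (maxn N M) - s)
    - (trace_partial F (maxn N M) - trace F) by ring.
rewrite (le_trans (le_cabsD _ _))// cabsN [leRHS]splitr ltW// ltrD//.
  by rewrite hN// leq_maxl.
by rewrite hM// leq_maxr.
Qed.

(** Rank at most m, with a witnessing family for the range; zero vectors in the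
family make the notion monotone in m. *)
Definition finite_rank_le (m : nat) F : Prop := bounded_operator F /\
  exists2 u, suborthonormal ip u & forall x, oproj ip u m (F x) = F x.

Lemma finite_rank_le_span m F (v : nat -> H) : bounded_operator F ->
  (forall x, exists c : nat -> R[i], F x = \sum_(i < m) c i *: v i) ->
  finite_rank_le m F.
Proof.
move=> bF hF; split => //; have [su hu] := gram_schmidtP hH v.
exists (gram_schmidt ip v) => // x; have [c ->] := hF x; rewrite lin_sum; last exact: proj_linear.
by apply: eq_bigr => i _; rewrite linZ ?hu//; exact: proj_linear.
Qed.

Lemma finite_rank_le_mono m n F : (m <= n)%N -> finite_rank_le m F -> finite_rank_le n F.
Proof.
move=> mn [bF [u su hu]]; split=> //; exists u => // x.
by rewrite -[in LHS]hu proj_proj// hu.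
Qed.

Lemma finite_rank_le_compl m B F : bounded_operator B -> finite_rank_le m F ->
  finite_rank_le m (B \o F).
Proof.
move=> bB [bF [u su hu]].
apply: (@finite_rank_le_span _ _ (B \o u)); first exact: bo_comp.
move=> x; exists (fun i => ip (F x) (u i)) => /=.
rewrite -[in LHS]hu /oproj lin_sum; last exact: bo_lin.
by apply: eq_bigr => i _; rewrite linZ//; exact: bo_lin.
Qed.

Lemma finite_rank_le_compr m B F : bounded_operator B -> finite_rank_le m F ->
  finite_rank_le m (F \o B).
Proof.
move=> bB [bF [u su hu]]; split; first exact: bo_comp.
by exists u => // x /=; rewrite hu.
Qed.

(** Orthonormalize the concatenation of the two witnessing families. *)
Lemma finite_rank_common m n F G : finite_rank_le m F -> finite_rank_le n G ->
  exists u, [/\ suborthonormal ip u, forall x, oproj ip u (m + n) (F x) = F x &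
                forall x, oproj ip u (m + n) (G x) = G x].
Proof.
move=> [bF [u su hu]] [bG [w sw hw]].
pose v i := if (i < m)%N then u i else w (i - m)%N.
have [sg hg] := gram_schmidtP hH v.
exists (gram_schmidt ip v); split => // x.
  have Fx : F x = \sum_(i < m) ip (F x) (u i) *: u i := esym (hu x).
  rewrite [in LHS]Fx lin_sum; last exact: proj_linear.
  rewrite [RHS]Fx; apply: eq_bigr => i _; rewrite linZ; last exact: proj_linear.
  have -> : u i = v i by rewrite /v ltn_ord.
  by rewrite hg// (leq_trans (ltn_ord i))// leq_addr.
have Gx : G x = \sum_(i < n) ip (G x) (w i) *: w i := esym (hw x).
rewrite [in LHS]Gx lin_sum; last exact: proj_linear.
rewrite [RHS]Gx; apply: eq_bigr => i _; rewrite linZ; last exact: proj_linear.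
have -> : w i = v (m + i)%N by rewrite /v ltnNge leq_addr /= addKn.
by rewrite hg// ltn_add2l.
Qed.

Lemma finite_rank_le_lin m n a F G : finite_rank_le m F -> finite_rank_le n G ->
  finite_rank_le (m + n) (a *: F + G).
Proof.
move=> fF fG; have [u [su hF hG]] := finite_rank_common fF fG.
split; first exact: bo_lincomb fF.1 fG.1.
exists u => // x; rewrite !fctE linD ?linZ ?hF ?hG//; exact: proj_linear.
Qed.

Lemma trace_lin m n a F G : finite_rank_le m F -> finite_rank_le n G ->
  trace (a *: F + G) = a * trace F + trace G.
Proof.
move=> fF fG; have [u [su hF hG]] := finite_rank_common fF fG.
rewrite (traceE su fF.1 hF) (traceE su fG.1 hG) (@traceE _ u (m + n))//.
- rewrite mulr_sumr -big_split; apply: eq_bigr => j _ /=.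
  by rewrite !fctE ipDl ipZl.
- exact: bo_lincomb fF.1 fG.1.
- by move=> x; rewrite !fctE linD ?linZ ?hF ?hG//; exact: proj_linear.
Qed.

Lemma trace_sub m n F G : finite_rank_le m F -> finite_rank_le n G ->
  trace (F - G) = trace F - trace G.
Proof.
move=> fF fG; rewrite addrC -scaleN1r (trace_lin _ fG fF).
by rewrite mulN1r addrC.
Qed.

Lemma finite_rank_le_sub m n F G : finite_rank_le m F -> finite_rank_le n G ->
  finite_rank_le (m + n) (F - G).
Proof.
by move=> fF fG; rewrite addrC -scaleN1r addnC; exact: finite_rank_le_lin.
Qed.

(** The trace is a sum of m terms, each bounded by the norm. *)
Lemma trace_bound m F (B : R) : finite_rank_le m F ->
  (forall x, nm (F x) <= B * nm x) -> cabs (trace F) <= m%:R * B.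
Proof.
move=> [bF [u su hu]] hB; rewrite (traceE su bF hu).
rewrite (le_trans (cabs_sum _ _ _))//.
apply: (@le_trans _ _ (\sum_(j < m) B)).
  apply: ler_sum => j _; rewrite (le_trans (cauchy_schwarz hH _ _))//.
  have B0 : 0 <= B.
    have := hB (e 0%N); rewrite (orthonormal_seq_nm hH _ oe) mulr1.
    exact: le_trans (nm_ge0 _).
  case: (su.2 j) => uj; first by rewrite uj nm0 mulr0.
  by rewrite uj mulr1 (le_trans (hB _))// uj mulr1.
by rewrite sumr_const card_ord -[B *+ _]mulr_natl.
Qed.

Lemma unitary_nm U x : unitary_operator ip U -> nm (U x) = nm x.
Proof.
move=> [bU hU _]; have := f_equal (fun f => f x) hU => /= h.
apply/eqP; rewrite -(@eqrXn2 _ 2) ?nm_ge0// -!(Re_ipxx hH).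
by rewrite (adjointP hH bU) h.
Qed.

Lemma unitary_adjoint_nm U x : unitary_operator ip U -> nm (adjoint ip U x) = nm x.
Proof.
move=> uU; have [_ _ /(f_equal (fun f => f x)) /= h] := uU.
by rewrite -(unitary_nm _ uU) h.
Qed.

Lemma trace_unitary m U F : unitary_operator ip U -> finite_rank_le m F ->
  trace (U \o F \o adjoint ip U) = trace F.
Proof.
move=> uU [bF [u su hu]]; have [bU hU hU'] := uU.
have Uu i : adjoint ip U (U (u i)) = u i by have := f_equal (fun f => f (u i)) hU.
rewrite (traceE su bF hu) (@traceE _ (U \o u) m).
- apply: eq_bigr => j _ /=; rewrite Uu (adjointP hH bU).
  by have := f_equal (fun f => f (u j)) hU => /= ->.
- split=> [i j ij|i] /=; first by rewrite (adjointP hH bU) Uu su.1.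
  rewrite (unitary_nm _ uU); case: (su.2 i) => ->; last by right.
  by left; rewrite lin0//; exact: bo_lin.
- by apply: bo_comp; [exact: bo_comp|exact: bo_adjoint].
- move=> x /=; set y := adjoint ip U x.
  rewrite -[in RHS]hu {2}/oproj lin_sum; last exact: bo_lin.
  apply: eq_bigr => i _; rewrite linZ; last exact: bo_lin.
  by rewrite (adjointP hH bU) Uu.
Qed.

End FiniteRankTrace.

(** * Positive operators are symmetric *)

Section PositiveSymmetric.
Context (R : realType) (H : completeNormedModType R[i]).
Context (ip : {dot H for Num.conj}) (hH : is_hilbert ip).

(** Polarization: s measures the failure of symmetry and vanishes on the diagonal
since <A z, z> is real. Hence s is antisymmetric, and replacing y by i y makes
it symmetric as well. *)
Lemma positive_symmetric (A : H -> H) : linear A -> positive_operator ip A ->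
  symmetric_operator ip A.
Proof.
move=> lA pA.
pose s x y := ip (A x) y - ip x (A y).
have s0 z : s z z = 0.
  rewrite /s; apply/eqP; rewrite subr_eq0 eq_sym ipC; apply/eqP/CrealP.
  exact: ger0_real (pA z).
have sD x y : s (x + y) (x + y) = s x x + s x y + s y x + s y y.
  by rewrite /s (linD _ _ lA) !ipDl !ipDr; ring.
have h1 x y : s x y = - s y x.
  by have := sD x y; rewrite !s0 add0r addr0 => /esym/eqP; rewrite addr_eq0 => /eqP.
have h2 x y : s x ('i *: y) = - 'i * s x y.
  rewrite /s (linZ _ _ lA) !ipZr.
  by rewrite conj_i; ring.
have h3 x y : s ('i *: x) y = 'i * s x y.
  by rewrite /s (linZ _ _ lA) !ipZl; ring.
move=> x y; apply/eqP; rewrite -subr_eq0 -/(s x y).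
have := h1 x ('i *: y); rewrite h2 h3 mulNr => /oppr_inj/mulfI h.
have /eqP : s x y = s y x.
  by apply: h; rewrite eq_complex /= oner_eq0 andbF.
rewrite h1 eq_sym -addr_eq0 -mulr2n -mulr_natl mulf_eq0 pnatr_eq0 /=.
by move=> /eqP ->; rewrite oppr0.
Qed.

End PositiveSymmetric.

(** * The dyadic singular trace *)

Section DyadicTrace.
Context (R : realType) (H : completeNormedModType R[i]).
Context (ip : {dot H for Num.conj}) (hH : is_hilbert ip).
Implicit Types (x y z : H) (T S K A B : H -> H) (F G : nat -> H -> H).
Variable e : nat -> H.
Hypotheses (oe : orthonormal_seq ip e) (ce : complete_seq_basis ip e).
Arguments ce : clear implicits.
Variable q : nat -> R.
Hypotheses (q_gt0 : forall k, 0 < q k) (q_noninc : forall k, q k.+1 <= q k).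
Hypothesis q_ratio : (fun k => 2 * q k.+1 / q k) @ \oo --> (1 : R).

(* the weights; their successive ratios tend to 1 *)
Let a k : R := 2 ^+ k * q k.
Let a_gt0 k : 0 < a k. Proof. by rewrite mulr_gt0// exprn_gt0. Qed.
Let aC k : (a k)%:C != 0. Proof. by rewrite (inj_eq (@complexI _) _ 0) gt_eqF. Qed.
Let rho k : R := a k.+1 / a k.
Let rhoE k : rho k = 2 * q k.+1 / q k.
Proof.
rewrite /rho /a exprS.
have h1 : q k != 0 by rewrite gt_eqF.
have h2 : (2 : R) ^+ k != 0 by rewrite expf_neq0.
by field; rewrite h1.
Qed.

(** Approximations of A of rank O(2^k) with error O(q k), with one constant C
for both. *)
Definition dyadic_rep A (C : nat) F : Prop := forall k,
  finite_rank_le ip (C * 2 ^ k) (F k) /\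
  forall x, nm (A x - F k x) <= C%:R * q k * nm x.

(** Normalized increments of the traces; their Banach limit will be the trace
of A. *)
Definition increments F k : R[i] :=
  (trace ip e (F k.+1) - trace ip e (F k)) / (a k)%:C.

Let diff_bound A C C' F G k x : (forall x, nm (A x - F k x) <= C * q k * nm x) ->
  (forall x, nm (A x - G k x) <= C' * q k * nm x) ->
  nm ((F k - G k) x) <= (C + C') * q k * nm x.
Proof.
move=> hF hG; rewrite !fctE (le_trans (nm_tri (A x) _ _))// mulrDl mulrDl.
by rewrite lerD// nmBC.
Qed.

(** F (k+1) - F k has rank at most 3 C 2^k and norm at most 2 C q k. *)
Lemma increments_bounded A C F : dyadic_rep A C F -> cbounded (increments F).
Proof.
move=> h; exists (6 * C%:R ^+ 2) => k.
have [f1 n1] := h k; have [f2 n2] := h k.+1.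
rewrite cabsM cabsV cabsR gtr0_norm// ler_pdivrMr// -(trace_sub hH ce f2 f1).
apply: le_trans (trace_bound hH oe ce (finite_rank_le_sub hH f2 f1)
  (B := (C%:R + C%:R) * q k) _) _.
  move=> x; rewrite !fctE (le_trans (nm_tri (A x) _ _))// mulrDl mulrDl.
  rewrite lerD// nmBC (le_trans (n2 x))// ler_wpM2r ?nm_ge0// ler_wpM2l//.
rewrite natrD !natrM !natrX exprS /a le_eqVlt; apply/orP; left; apply/eqP; ring.
Qed.

(** z differs from the telescoping sequence y (k+1) - y k by (rho k - 1) y (k+1),
which tends to 0. *)
Lemma cbanach_lim_telescope (z y : nat -> R[i]) : cbounded y -> cbounded z ->
  (forall k, z k = (rho k)%:C * y k.+1 - y k) -> cbanach_lim z = 0.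
Proof.
move=> hy hz zE.
have real_case (u v : nat -> R) : bounded_coef u -> bounded_coef v ->
    (forall k, v k = rho k * u k.+1 - u k) -> banach_lim v = 0.
  move=> bu bv vE; apply: (banach_lim_telescope bu bv).
  apply/cvgn_eps => d d0; have [M hM] := bu.
  have M0 : 0 <= M by exact: le_trans (hM 0%N).
  have M1 : 0 < M + 1 by rewrite ltr_wpDl.
  have [N hN] := proj1 (cvgn_eps _ _) q_ratio _ (divr_gt0 d0 M1).
  exists N => n /hN; rewrite ltr_pdivlMr// => h.
  have -> : v n - (u n.+1 - u n) - 0 = (2 * q n.+1 / q n - 1) * u n.+1.
    by rewrite vE rhoE; ring.
  rewrite normrM (le_lt_trans _ h)// ler_wpM2l// (le_trans (hM _))// lerDl//.
rewrite /cbanach_lim (real_case (fun n => Re (y n)) (fun n => Re (z n))).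
- rewrite (real_case (fun n => Im (y n)) (fun n => Im (z n)))//.
  + exact: cbounded_Im.
  + exact: cbounded_Im.
  + by move=> k; rewrite zE; case: (y k.+1) (y k) => ? ? [? ?] /=; ring.
- exact: cbounded_Re.
- exact: cbounded_Re.
- by move=> k; rewrite zE; case: (y k.+1) (y k) => ? ? [? ?] /=; ring.
Qed.

(** F k - G k has rank O(2^k) and norm O(q k), so y k, its trace divided by the
weight, is bounded; and the two sequences of increments differ by
rho k y (k+1) - y k. *)
Lemma dyadic_rep_unique A C C' F G : dyadic_rep A C F -> dyadic_rep A C' G ->
  cbanach_lim (increments F) = cbanach_lim (increments G).
Proof.
move=> hF hG.
pose y k := trace ip e (F k - G k) / (a k)%:C.
pose z k := increments F k - increments G k.
have bF := increments_bounded hF; have bG := increments_bounded hG.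
have bz : cbounded z.
  have [M hM] := bF; have [N hN] := bG; exists (M + N) => n.
  by rewrite (le_trans (le_cabsD _ _))// cabsN lerD.
have b_y : cbounded y.
  exists ((C%:R + C'%:R) ^+ 2) => k.
  have [f1 n1] := hF k; have [f2 n2] := hG k.
  rewrite cabsM cabsV cabsR gtr0_norm// ler_pdivrMr//.
  apply: le_trans (trace_bound hH oe ce (finite_rank_le_sub hH f1 f2)
    (B := (C%:R + C'%:R) * q k) _) _.
    by move=> x; exact: diff_bound n1 n2.
  rewrite natrD !natrM !natrX /a le_eqVlt; apply/orP; left; apply/eqP; ring.
have -> : increments F = (fun k => 1 * z k + increments G k).
  by apply/funext => k; rewrite mul1r /z subrK.
rewrite cbanach_lim_lin// (@cbanach_lim_telescope z y)//.
  by rewrite mulr0 add0r.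
move=> k; rewrite /z /y /increments /rho.
rewrite (trace_sub hH ce (hF k).1 (hG k).1) (trace_sub hH ce (hF k.+1).1 (hG k.+1).1).
rewrite realC_div.
have h1 := aC k; have h2 := aC k.+1.
by field; rewrite h1.
Qed.

Definition dyadic_trace A : R[i] :=
  xget 0 [set l | exists C F, dyadic_rep A C F /\ l = cbanach_lim (increments F)].

Lemma dyadic_traceE A C F : dyadic_rep A C F ->
  dyadic_trace A = cbanach_lim (increments F).
Proof.
move=> h.
have [C' [G [hG ->]]] : exists C' G, dyadic_rep A C' G /\
    dyadic_trace A = cbanach_lim (increments G).
  apply: (xgetPex 0 (_ : exists l, exists C F, dyadic_rep A C F /\ l = cbanach_lim (increments F))).
  by exists (cbanach_lim (increments F)), C, F.
exact: dyadic_rep_unique hG h.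
Qed.

(** Lets the constant be taken positive. *)
Lemma dyadic_rep_mono A C C' F : (C <= C')%N -> dyadic_rep A C F -> dyadic_rep A C' F.
Proof.
move=> CC h k; have [f n] := h k; split.
  by apply: finite_rank_le_mono f => //; rewrite leq_mul2r CC orbT.
move=> x; rewrite (le_trans (n x))// ler_wpM2r ?nm_ge0// ler_wpM2r ?(ltW (q_gt0 k))//.
by rewrite ler_nat.
Qed.

Lemma dyadic_rep_lin c A B C C' F G : dyadic_rep A C F -> dyadic_rep B C' G ->
  dyadic_rep (c *: A + B) (C * (Num.truncn (cabs c)).+1 + C') (fun k => c *: F k + G k).
Proof.
move=> hF hG k; have [f1 n1] := hF k; have [f2 n2] := hG k; split.
  apply: finite_rank_le_mono (finite_rank_le_lin hH c f1 f2) => //.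
  by rewrite -mulnDl leq_mul2r leq_add2r leq_pmulr// orbT.
move=> x; rewrite !fctE opprD addrACA -scalerBr (le_trans (nmD _ _))//.
rewrite natrD natrM !mulrDl lerD// nmZ.
apply: (@le_trans _ _ (cabs c * (C%:R * q k * nm x))).
  by rewrite ler_wpM2l ?cabs_ge0.
have -> : C%:R * (Num.truncn (cabs c)).+1%:R * q k * nm x =
  (Num.truncn (cabs c)).+1%:R * (C%:R * q k * nm x) by ring.
rewrite ler_wpM2r ?(ltW (truncnS_gt _))// mulr_ge0 ?nm_ge0// mulr_ge0//.
exact: ltW.
Qed.

Lemma dyadic_trace_lin c A B C C' F G : dyadic_rep A C F -> dyadic_rep B C' G ->
  dyadic_trace (c *: A + B) = c * dyadic_trace A + dyadic_trace B.
Proof.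
move=> hF hG; rewrite (dyadic_traceE (dyadic_rep_lin c hF hG)).
rewrite (dyadic_traceE hF) (dyadic_traceE hG) -cbanach_lim_lin.
- congr cbanach_lim; apply/funext => k; rewrite /increments.
  rewrite (trace_lin hH ce c (hF k.+1).1 (hG k.+1).1).
  by rewrite (trace_lin hH ce c (hF k).1 (hG k).1); ring.
- exact: increments_bounded hF.
- exact: increments_bounded hG.
Qed.

Lemma dyadic_rep_compl A B C F (M : nat) : bounded_operator B ->
  (forall x, nm (B x) <= M.+1%:R * nm x) -> dyadic_rep A C F ->
  dyadic_rep (B \o A) (M.+1 * C) (fun k => B \o F k).
Proof.
move=> bB hB h k; have [f n] := h k; split.
  apply: finite_rank_le_mono (finite_rank_le_compl hH bB f) => //.
  by rewrite leq_mul2r leq_pmull ?orbT.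
move=> x /=; rewrite -(linB _ _ (bo_lin bB)) (le_trans (hB _))// natrM -!mulrA.
by rewrite ler_wpM2l// mulrA.
Qed.

Lemma dyadic_rep_compr A B C F (M : nat) : bounded_operator B ->
  (forall x, nm (B x) <= M.+1%:R * nm x) -> dyadic_rep A C F ->
  dyadic_rep (A \o B) (M.+1 * C) (fun k => F k \o B).
Proof.
move=> bB hB h k; have [f n] := h k; split.
  apply: finite_rank_le_mono (finite_rank_le_compr bB f) => //.
  by rewrite leq_mul2r leq_pmull ?orbT.
move=> x /=; rewrite (le_trans (n _))// natrM -[in leRHS]mulrA -[in leRHS]mulrA.
rewrite [leRHS]mulrCA -[leLHS]mulrA ler_wpM2l//.
rewrite [leRHS]mulrCA ler_wpM2l ?(ltW (q_gt0 k))//.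
Qed.

Definition dyadic_ideal : set (H -> H) :=
  [set A | bounded_operator A /\ exists C F, dyadic_rep A C F].

Lemma nat_bound B : bounded_operator B ->
  exists M : nat, forall x, nm (B x) <= M.+1%:R * nm x.
Proof.
move=> /bo_norm[M M0 hM]; exists (Num.truncn M) => x.
by rewrite (le_trans (hM x))// ler_wpM2r ?nm_ge0// ltW// truncnS_gt.
Qed.

Lemma finite_rank_le0 : finite_rank_le ip 0 (fun=> 0 : H).
Proof.
split; first exact: bo0.
exists e; first exact: orthonormal_suborthonormal.
by move=> x; rewrite /oproj big_ord0.
Qed.

Lemma dyadic_ideal_two_sided : two_sided_ideal dyadic_ideal.
Proof.
split.
- by move=> A [].
- split; first exact: bo0.
  exists 0%N, (fun _ _ => 0) => k; split; first by rewrite mul0n; exact: finite_rank_le0.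
  by move=> x; rewrite subr0 nm0 !mul0r.
- move=> c A B [bA [C [F hF]]] [bB [C' [G hG]]]; split; first exact: bo_lincomb.
  by eexists; eexists; exact: dyadic_rep_lin hF hG.
- move=> B A bB [bA [C [F hF]]]; have [M hM] := nat_bound bB; split; split.
  + exact: bo_comp.
  + by eexists; eexists; exact: dyadic_rep_compl hM hF.
  + exact: bo_comp.
  + by eexists; eexists; exact: dyadic_rep_compr hM hF.
Qed.

Lemma dyadic_trace_unitary U A C F : unitary_operator ip U -> dyadic_rep A C F ->
  dyadic_trace (U \o A \o adjoint ip U) = dyadic_trace A.
Proof.
move=> uU h; have [bU _ _] := uU.
have h' : dyadic_rep (U \o A \o adjoint ip U) C (fun k => U \o F k \o adjoint ip U).
  move=> k; have [f n] := h k; split.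
    apply: finite_rank_le_compr; first exact: bo_adjoint.
    exact: finite_rank_le_compl.
  move=> x /=; rewrite -(linB _ _ (bo_lin bU)) (unitary_nm hH _ uU).
  by rewrite (le_trans (n _))// (unitary_adjoint_nm hH _ uU).
rewrite (dyadic_traceE h) (dyadic_traceE h'); congr cbanach_lim.
by apply/funext => k; rewrite /increments !(trace_unitary hH ce uU (h _).1).
Qed.

Lemma cbanach_lim0 : @cbanach_lim R (fun=> 0) = 0.
Proof.
rewrite /cbanach_lim /= (@banach_lim_cvg _ (fun=> 0) 0)//.
  by exists 0 => n; rewrite normr0.
exact: cvg_cst.
Qed.

(** The constant family F k = P is an approximation, with increments 0. *)
Lemma dyadic_trace_finite_rank P : finite_rank_projection ip P -> dyadic_trace P = 0.
Proof.
move=> [bP _ _ [n [v hv]]].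
have fP : finite_rank_le ip n P.
  pose w i := if insub i is Some j then v j else 0.
  apply: (@finite_rank_le_span _ _ _ hH n P w) => // x.
  have [c hc] := hv x; exists (fun i => if insub i is Some j then c j else 0).
  by rewrite hc; apply: eq_bigr => i _; rewrite /w valK.
have h : dyadic_rep P n (fun=> P).
  move=> k; split; first by apply: finite_rank_le_mono fP => //; rewrite leq_pmulr// expn_gt0.
  move=> x; rewrite subrr nm0 mulr_ge0 ?nm_ge0// mulr_ge0//; exact: ltW.
rewrite (dyadic_traceE h) -[RHS]cbanach_lim0; congr cbanach_lim.
by apply/funext => k; rewrite /increments subrr mul0r.
Qed.

Lemma cbanach_lim_ge0 (z : nat -> R[i]) : cbounded z -> (forall k, 0 <= z k) ->
  0 <= cbanach_lim z.
Proof.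
move=> bz z0.
have zI : (fun n => Im (z n)) = (fun=> 0).
  by apply/funext => n; exact: ger0_Im.
have b0 : @bounded_coef R (fun=> 0) by exists 0 => n; rewrite normr0.
have l0 : banach_lim (fun=> 0 : R) = 0 by apply: banach_lim_cvg => //; exact: cvg_cst.
rewrite lecE /= zI l0 eqxx /= -[leLHS]l0.
apply: banach_lim_le => //; first exact: cbounded_Re.
by move=> k; have := z0 k; rewrite lecE => /andP[].
Qed.

(** Replace F k by G k = P k A P k, where the P k are increasing projections whose
range contains that of F k. As A is symmetric, G k is again an approximation,
and its trace is the sum of <A u_i, u_i> over the first N k vectors of one
orthonormal family, hence non-decreasing in k. *)
Lemma dyadic_trace_positive A C F : bounded_operator A -> positive_operator ip A ->
  dyadic_rep A C F -> 0 <= dyadic_trace A.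
Proof.
move=> bA pA h0; have {h0} h := dyadic_rep_mono (leqnSn C) h0.
set D := C.+1 in h.
have sA := positive_symmetric (bo_lin bA) pA.
have /choice[w hw] : forall k, exists u, suborthonormal ip u /\
    forall x, oproj ip u (D * 2 ^ k) (F k x) = F k x.
  by move=> k; have [[_ [u su hu]] _] := h k; exists u.
(* The family v lists the vectors spanning the range of F k at the places from
   D 2^k to D 2^(k+1) - 1, so that one Gram-Schmidt process covers all levels. *)
pose lev m := trunc_log 2 (m %/ D).
pose v m := w (lev m) (m - D * 2 ^ lev m)%N.
have [su hu] := gram_schmidtP hH v; set u := gram_schmidt ip v in su hu.
pose N k := (D * 2 ^ k.+1)%N.
pose P k := oproj ip u (N k).
have lP k : linear (P k) by exact: proj_linear.
have levE k j : (j < D * 2 ^ k)%N -> lev (D * 2 ^ k + j)%N = k.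
  move=> jk; apply: trunc_log_eq => //; rewrite leq_divRL// ltn_divLR// !(mulnC _ D) leq_addr /=.
  by rewrite expnS mul2n -addnn mulnDr ltn_add2l.
have PF k x : P k (F k x) = F k x.
  have Fx : F k x = \sum_(i < D * 2 ^ k) ip (F k x) (w k i) *: w k i.
    exact: esym ((hw k).2 x).
  rewrite [in LHS]Fx lin_sum; last exact: lP.
  rewrite [RHS]Fx; apply: eq_bigr => i _; rewrite linZ; last exact: lP.
  have -> : w k i = v (D * 2 ^ k + i)%N by rewrite /v levE// addKn.
  congr (_ *: _); apply: hu.
  by rewrite /N expnS mul2n -addnn mulnDr ltn_add2l ltn_ord.
pose G k := P k \o A \o P k.
have rG : dyadic_rep A (2 * D) G.
  move=> k; have [fk nk] := h k; split.
    split; first by do 2?apply: bo_comp => //; exact: bo_proj.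
    exists u => // x; rewrite /G /= /P /N expnS mulnCA mulnA.
    by rewrite proj_proj.
  have n1 x : nm (A x - P k (A x)) <= D%:R * q k * nm x.
    have -> : A x - P k (A x) = (A x - F k x) - P k (A x - F k x).
      by rewrite (linB _ _ (lP k)) PF opprB subrKA.
    by rewrite (le_trans (nm_sub_proj hH _ _ su)).
  (* the adjoint of the estimate n1 *)
  have n2 x : nm (A x - A (P k x)) <= D%:R * q k * nm x.
    set y := A x - A (P k x).
    have : nm y ^+ 2 <= nm x * (D%:R * q k * nm y).
      rewrite -(Re_ipxx hH) {1}/y -(linB _ _ (bo_lin bA)) sA ipBl.
      rewrite proj_sym -ipBr (le_trans (Re_ip_le hH _ _))//.
      by rewrite ler_wpM2l ?nm_ge0.
    have [->|y0] := eqVneq (nm y) 0.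
      by move=> _; rewrite mulr_ge0 ?nm_ge0// mulr_ge0// ltW.
    have ny : 0 < nm y by rewrite lt_def y0 nm_ge0.
    move=> h1; rewrite -(ler_pM2r ny) -expr2 (le_trans h1)//.
    by rewrite le_eqVlt; apply/orP; left; apply/eqP; ring.
  move=> x; rewrite /G /=.
  have -> : A x - P k (A (P k x)) = (A x - P k (A x)) + P k (A x - A (P k x)).
    by rewrite (linB _ _ (lP k)) subrKA.
  rewrite (le_trans (nmD _ _))// natrM.
  have -> : 2 * D%:R * q k * nm x = D%:R * q k * nm x + D%:R * q k * nm x by ring.
  by rewrite lerD// (le_trans (nm_proj hH _ _ su)).
have trG k : trace ip e (G k) = \sum_(i < N k) ip (A (u i)) (u i).
  rewrite (traceE hH ce su (rG k).1.1 (m := N k)); last first.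
    by move=> x; rewrite /G /= /P proj_proj.
  apply: eq_bigr => i _; rewrite /G /= /P proj_sym.
  by rewrite (proj_vec hH su (ltn_ord i)).
rewrite (dyadic_traceE rG); apply: cbanach_lim_ge0.
  exact: increments_bounded rG.
move=> k; rewrite /increments !trG; apply: mulr_ge0; last first.
  by rewrite invr_ge0 ler0c ltW.
have NN : (N k <= N k.+1)%N by rewrite /N leq_mul2l leq_exp2l// leqnSn orbT.
rewrite -!(big_mkord xpredT (fun i => ip (A (u i)) (u i))).
rewrite [X in X - _](big_cat_nat (leq0n (N k)) NN)//= [X in X - _]addrC addrK.
by apply: sumr_ge0 => i _; exact: pA.
Qed.

Theorem singular_trace_exists J : two_sided_ideal J -> J `<=` dyadic_ideal ->
  singular_trace ip J dyadic_trace.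
Proof.
move=> iJ JD; split.
- move=> c A B /JD[_ [C [F hF]]] /JD[_ [C' [G hG]]].
  exact: dyadic_trace_lin hF hG.
- by move=> A /JD[bA [C [F hF]]] pA; exact: dyadic_trace_positive bA pA hF.
- by move=> U A uU /JD[_ [C [F hF]]]; exact: dyadic_trace_unitary uU hF.
- by move=> P _; exact: dyadic_trace_finite_rank.
Qed.

(* from here on q samples the coefficients of a diagonal operator *)
Variable t : nat -> R.
Hypotheses (t_gt0 : forall n, 0 < t n) (t_noninc : forall n, t n.+1 <= t n).
Hypothesis qE : forall k, q k = t (2 ^ k).-1.

Let bt : bounded_coef t.
Proof.
exists (t 0%N) => n; rewrite ger0_norm; last exact: ltW.
by elim: n => // n; exact: le_trans.
Qed.

Let t_le m n : (m <= n)%N -> t n <= t m.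
Proof. exact: noninc_le. Qed.

Let F k : H -> H := oproj ip e (2 ^ k) \o diag e t.

(** Truncate the diagonal operator to the first 2^k coefficients; the first one
that is dropped is at most q k. *)
Lemma diag_dyadic_rep : dyadic_rep (diag e t) 1 F.
Proof.
have se := orthonormal_suborthonormal hH oe.
have [bd hd] := diagP hH oe bt.
move=> k; rewrite mul1n mul1r; split.
  split; first by apply: bo_comp => //; exact: bo_proj.
  by exists e => // x; rewrite /F /= proj_proj.
move=> x; rewrite /F /=.
have -> : diag e t x - oproj ip e (2 ^ k) (diag e t x) =
    diag e t (x - oproj ip e (2 ^ k) x).
  rewrite linB; last exact: bo_lin.
  congr (_ - _); rewrite /oproj lin_sum; last exact: bo_lin.
  apply: eq_bigr => i _; rewrite linZ ?hd ?ip_diag//; last exact: bo_lin.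
  by rewrite scalerA mulrC.
apply: (@le_trans _ _ (q k * nm (x - oproj ip e (2 ^ k) x))).
  apply: (diag_tail_le hH oe ce) => //; first exact: ltW.
  move=> n hn; rewrite ger0_norm; last exact: ltW.
  rewrite qE t_le// (leq_trans (leq_pred _))// leqNgt; apply: contraNN hn => nN.
  by rewrite ipBl ip_proj// subrr.
by rewrite ler_wpM2l ?(ltW (q_gt0 k))// nm_sub_proj.
Qed.

Lemma diag_dyadic_ideal : dyadic_ideal (diag e t).
Proof.
split; first by have [] := diagP hH oe bt.
by exists 1%N, F; exact: diag_dyadic_rep.
Qed.

(** The increments are the dyadic blocks of the sum of t divided by the weights.
A block has 2^k terms, each at least q (k+1), so its quotient is at least rho k / 2,
which tends to 1/2. *)
Lemma dyadic_trace_diag_neq0 : dyadic_trace (diag e t) != 0.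
Proof.
have se := orthonormal_suborthonormal hH oe.
have [bd hd] := diagP hH oe bt.
have trF k : trace ip e (F k) = (\sum_(i < 2 ^ k) t i)%:C.
  rewrite (traceE hH ce se (diag_dyadic_rep k).1.1 (m := (2 ^ k)%N)); last first.
    by move=> x; rewrite /F /= proj_proj.
  rewrite rmorph_sum; apply: eq_bigr => i _; rewrite /F /= proj_sym proj_vec//.
  by rewrite hd ipZl oe eqxx mulr1.
rewrite (dyadic_traceE diag_dyadic_rep).
pose x k := (\sum_(2 ^ k <= i < 2 ^ k.+1) t i) / a k.
have incE : increments F = (fun k => (x k)%:C).
  apply/funext => k; rewrite /increments !trF -rmorphB.
  have h : (2 ^ k <= 2 ^ k.+1)%N by rewrite leq_exp2l.
  rewrite -!(big_mkord xpredT t) (big_cat_nat (leq0n _) h)//= [X in X - _]addrC addrK.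
  by rewrite /x realC_div.
have bx : bounded_coef x.
  have := cbounded_Re (increments_bounded diag_dyadic_rep).
  by rewrite incE.
have xlow k : 2^-1 * rho k <= x k.
  rewrite /rho mulrA ler_wpM2r ?invr_ge0 ?(ltW (a_gt0 k))//.
  have -> : 2^-1 * a k.+1 = \sum_(2 ^ k <= i < 2 ^ k.+1) q k.+1.
    rewrite sumr_const_nat expnS mul2n -addnn addnK /a exprS -[RHS]mulr_natl natrX.
    by field.
  apply: ler_sum_nat => i /andP[_ h]; rewrite qE t_le//.
  by rewrite -ltnS prednK// expn_gt0.
have crho : (fun k => 2^-1 * rho k) @ \oo --> (2^-1 : R).
  apply/cvgn_eps => d d0; have [N hN] := proj1 (cvgn_eps _ _) q_ratio _ d0.
  exists N => n /hN h; rewrite rhoE.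
  have -> : 2^-1 * (2 * q n.+1 / q n) - 2^-1 = 2^-1 * (2 * q n.+1 / q n - 1) by ring.
  rewrite normrM ger0_norm ?invr_ge0//; have := normr_ge0 (2 * q n.+1 / q n - 1).
  lra.
have brho : bounded_coef (fun k => 2^-1 * rho k).
  exists 1 => k; rewrite rhoE ger0_norm; last first.
    by rewrite mulr_ge0 ?invr_ge0// divr_ge0 ?mulr_ge0 ?ltW.
  rewrite !mulrA mulVf// mul1r ler_pdivrMr// mul1r//.
have := banach_lim_le brho bx xlow; rewrite (banach_lim_cvg brho crho) => h.
apply: contraTneq h => /(congr1 (@complex.Re R)); rewrite incE /= => ->.
by rewrite -ltNge invr_gt0.
Qed.

End DyadicTrace.

(** * Bounded operators as combinations of unitaries *)

Section UnitarySpan.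
Context (R : realType) (H : completeNormedModType R[i]).
Context (ip : {dot H for Num.conj}) (hH : is_hilbert ip).
Implicit Types (x y z : H) (T S K A B U Y : H -> H).

Section SquareRoot.
Variable h : H -> H.
Hypotheses (bh : bounded_operator h) (sh : symmetric_operator ip h).
Hypothesis nh : forall x, nm (h x) <= 2^-1 * nm x.

Let lh := bo_lin bh.

(** Iteration for the solution Y of Y = (h^2 + Y^2) / 2, for which (1 - Y)^2 is
1 - h^2. It needs no spectral theory: with |h| <= 1/2 the iterates stay in
the ball of radius 1/2 and converge geometrically. *)
Fixpoint sqrt_iter n : H -> H :=
  if n is n'.+1 then (2^-1)%:C *: ((h \o h) + (sqrt_iter n' \o sqrt_iter n')) else 0.

Lemma sqrt_iterS n x : sqrt_iter n.+1 x =
  (2^-1)%:C *: (h (h x) + sqrt_iter n (sqrt_iter n x)).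
Proof. by []. Qed.

Let half_nm (x : H) : nm ((2^-1)%:C *: x) = 2^-1 * nm x.
Proof. by rewrite nmZ cabsR ger0_norm ?invr_ge0. Qed.

Let double (x : H) : x + x = 2%:C *: x.
Proof. by rewrite (_ : 2%:C = 1 + 1 :> R[i]) ?rmorphD// scalerDl scale1r. Qed.

Let halfK (x : H) : (2^-1)%:C *: (x + x) = x.
Proof. by rewrite double scalerA -rmorphM mulVf// scale1r. Qed.

(** Symmetry and commutation with h are carried along, as they pass to the limit. *)
Lemma sqrt_iterP n : [/\ bounded_operator (sqrt_iter n),
  symmetric_operator ip (sqrt_iter n),
  forall x, nm (sqrt_iter n x) <= 2^-1 * nm x &
  forall x, sqrt_iter n (h x) = h (sqrt_iter n x)].
Proof.
elim: n => [|n [bY sY nY cY]].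
  split=> [|x y|x|x] /=; first exact: bo0.
  - by rewrite ip0l ip0r.
  - by rewrite nm0 mulr_ge0 ?invr_ge0 ?nm_ge0.
  - by rewrite lin0.
have bhh := bo_comp bh bh; have bYY := bo_comp bY bY.
split=> [|x y|x|x] /=.
- by apply: boZ; exact: boD.
- by rewrite !fctE /= ipZl ipZr ipDl ipDr !sh !sY conjcR.
- rewrite !fctE half_nm ler_wpM2l ?invr_ge0//= (le_trans (nmD _ _))//.
  have h1 := nh (h x); have h2 := nh x; have h3 := nY (sqrt_iter n x); have h4 := nY x.
  have := nm_ge0 x; lra.
- by rewrite !fctE /= (linZ _ _ lh) (linD _ _ lh) !cY.
Qed.

Let sq_lin n : linear (sqrt_iter n). Proof. by have [/bo_lin] := sqrt_iterP n. Qed.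

Lemma sqrt_iter_diff n x :
  nm (sqrt_iter n.+1 x - sqrt_iter n x) <= 2 ^- n * nm x.
Proof.
elim: n x => [|n IH] x.
  have [_ _ h1 _] := sqrt_iterP 1; rewrite [sqrt_iter 0]/= subr0 (le_trans (h1 x))//.
  by rewrite expr0 invr1 ler_wpM2r ?nm_ge0// invf_le1 ?ler1n.
have [_ _ n1 _] := sqrt_iterP n.+1; have [_ _ n0 _] := sqrt_iterP n.
have -> : sqrt_iter n.+2 x - sqrt_iter n.+1 x =
    (2^-1)%:C *: (sqrt_iter n.+1 (sqrt_iter n.+1 x - sqrt_iter n x)
      + (sqrt_iter n.+1 (sqrt_iter n x) - sqrt_iter n (sqrt_iter n x))).
  rewrite (linB _ _ (sq_lin n.+1)) subrKA.
  rewrite (sqrt_iterS n.+1 x) [X in _ - X = _](sqrt_iterS n x) -scalerBr.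
  by congr (_ *: _); rewrite opprD addrACA subrr add0r.
rewrite half_nm exprS invfM -mulrA ler_wpM2l ?invr_ge0// (le_trans (nmD _ _))//.
have h1 := n1 (sqrt_iter n.+1 x - sqrt_iter n x); have h2 := IH x.
have h3 := IH (sqrt_iter n x); have h4 := n0 x.
have p0 : 0 <= (2 : R) ^- n by rewrite invr_ge0 exprn_ge0.
have := ler_wpM2l p0 h4; lra.
Qed.

Let sq_tail n m x : (n <= m)%N ->
  nm (sqrt_iter m x - sqrt_iter n x) <= (2 * 2 ^- n - 2 * 2 ^- m) * nm x.
Proof.
move=> /subnK <-; elim: (m - n)%N => [|k IH]; first by rewrite !add0n !subrr nm0 mul0r.
rewrite addSn (le_trans (nm_tri (sqrt_iter (k + n)%N x) _ _))//.
have h1 := sqrt_iter_diff (k + n) x.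
apply: le_trans (lerD h1 IH) _.
rewrite -mulrDl ler_wpM2r ?nm_ge0// exprS invfM.
by set p := _ ^- (k + n)%N; set r := _ ^- n; lra.
Qed.

Let sq_cvg x : exists l : H, (fun n => sqrt_iter n x) @ \oo --> l.
Proof.
apply: complete_seq => d d0.
have nx : 0 < 2 * nm x + 1 by rewrite ltr_wpDl// mulr_ge0// nm_ge0.
exists (Num.truncn ((2 * nm x + 1) / d)).+1 => n; set N := _.+1 => Nn.
rewrite nmBC (le_lt_trans (sq_tail x Nn))//.
have p0 : 0 <= (2 : R) ^- n by rewrite invr_ge0 exprn_ge0.
have pN : (2 : R) ^- N <= d / (2 * nm x + 1).
  rewrite -[leRHS]invrK lef_pV2 ?posrE ?exprn_gt0// ?invr_gt0 ?divr_gt0//.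
  rewrite invf_div (le_trans (ltW (truncnS_gt _)))// -/N -natrX ler_nat.
  exact/ltnW/ltn_expl.
move: pN; rewrite ler_pdivlMr// => pN.
have nx0 := nm_ge0 x; have := mulr_ge0 p0 nx0.
have : 0 < (2 : R) ^- N by rewrite invr_gt0 exprn_gt0.
move: pN; set p := _ ^- N; set r := _ ^- n; rewrite mulrDr mulr1 mulrBl => *.
lra.
Qed.

(** Z = 1 - Y with Y the limit of the iteration. *)
Lemma sqrt_one_sub_square : exists Z : H -> H, [/\ bounded_operator Z,
  symmetric_operator ip Z, forall x, Z (h x) = h (Z x) &
  forall x, Z (Z x) = x - h (h x)].
Proof.
have /choice[Y hY] := sq_cvg.
have cY x (d : R) : 0 < d -> exists n, forall m, (n <= m)%N -> nm (Y x - sqrt_iter m x) < d.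
  by have /cvgn_nm := hY x; exact.
have lY : linear Y.
  move=> c x y; apply: le_nm_eps => d d0.
  have c1 : 0 < cabs c + 2 by rewrite ltr_wpDl ?cabs_ge0.
  have d1 : 0 < d / (cabs c + 2) by rewrite divr_gt0.
  have [n1 h1] := cY (c *: x + y) _ d1; have [n2 h2] := cY x _ d1.
  have [n3 h3] := cY y _ d1; pose m := maxn n1 (maxn n2 n3).
  have {}h1 := h1 m (leq_maxl _ _).
  have {}h2 : nm (Y x - sqrt_iter m x) < d / (cabs c + 2).
    by apply: h2; rewrite /m !leq_max leqnn orbT.
  have {}h3 : nm (Y y - sqrt_iter m y) < d / (cabs c + 2).
    by apply: h3; rewrite /m !leq_max leqnn !orbT.
  have -> : Y (c *: x + y) - (c *: Y x + Y y) = (Y (c *: x + y) - sqrt_iter m (c *: x + y))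
      - (c *: (Y x - sqrt_iter m x) + (Y y - sqrt_iter m y)).
    rewrite (sq_lin m) scalerBr addrACA -opprD opprB addrA subrK.
    by [].
  rewrite (le_lt_trans (nmB _ _))// (@le_lt_trans _ _ (nm (Y (c *: x + y) - sqrt_iter m (c *: x + y)) +
    (cabs c * nm (Y x - sqrt_iter m x) + nm (Y y - sqrt_iter m y))))//.
    by rewrite lerD2l (le_trans (nmD _ _))// nmZ.
  have c0 := cabs_ge0 c.
  move: h1 h2 h3; set p := nm _; set q := nm _; set r := nm _; set s := d / _ => h1 h2 h3.
  have -> : d = s * (cabs c + 2) by rewrite /s mulfVK// gt_eqF.
  have := ler_wpM2l c0 (ltW h2); lra.
have nY x : nm (Y x) <= 2^-1 * nm x.
  apply: (nm_lim_le (hY x)); exists 0%N => n _.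
  by have [_ _ + _] := sqrt_iterP n; exact.
have bY : bounded_operator Y by exact: bo_intro lY nY.
have sY : symmetric_operator ip Y.
  move=> x y; rewrite ipC.
  have E2 n : ip y (sqrt_iter n x) = Num.conj (ip x (sqrt_iter n y)).
    by have [_ s _ _] := sqrt_iterP n; rewrite -ipC s.
  have E3 : ip y (Y x) = Num.conj (ip x (Y y)).
    apply/eqP; rewrite -subr_eq0; apply/eqP/eq0_normc/eqP.
    rewrite -/(cabs _) eq_le cabs_ge0 andbT; apply/ler_addgt0Pr => d d0; rewrite add0r.
    have k0 : 0 < nm x + nm y + 1 by rewrite ltr_wpDl// addr_ge0 ?nm_ge0.
    have d1 := divr_gt0 d0 k0.
    have [n1 h1] := cY x _ d1; have [n2 h2] := cY y _ d1.
    have {}h1 := ltW (h1 _ (leq_maxl n1 n2)); have {}h2 := ltW (h2 _ (leq_maxr n1 n2)).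
    set m := maxn n1 n2 in h1 h2.
    have -> : ip y (Y x) - Num.conj (ip x (Y y)) =
       ip y (Y x - sqrt_iter m x) - Num.conj (ip x (Y y - sqrt_iter m y)).
      by rewrite !ipBr rmorphB /= E2 opprB addrA subrK.
    rewrite (le_trans (le_cabsD _ _))// cabsN cabs_conj.
    rewrite (le_trans (lerD (cauchy_schwarz hH _ _) (cauchy_schwarz hH _ _)))//.
    have g1 := ler_wpM2l (nm_ge0 y) h1; have g2 := ler_wpM2l (nm_ge0 x) h2.
    move: g1 g2 (ltW d1); set s := d / _ => g1 g2 s0.
    have -> : d = s * (nm x + nm y + 1) by rewrite /s mulfVK// gt_eqF.
    lra.
  by rewrite E3 conjCK.
have cYh x : Y (h x) = h (Y x).
  apply: (cvg_unique_nm (hY (h x))).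
  have -> : (fun n => sqrt_iter n (h x)) = h \o (fun n => sqrt_iter n x).
    by apply/funext => n /=; have [_ _ _ ->] := sqrt_iterP n.
  exact: bo_cvg.
(* the fixed point equation 2 Y = h^2 + Y^2 *)
have Yeq x : Y x + Y x = h (h x) + Y (Y x).
  apply: le_nm_eps => d d0; have d8 : 0 < d / 8 by rewrite divr_gt0.
  have [n1 h1] := cY x _ d8; have [n2 h2] := cY (Y x) _ d8.
  pose m := maxn n1 n2.
  have h3 : nm (Y x - sqrt_iter m.+1 x) < d / 8.
    by apply: h1; rewrite leqW// leq_maxl.
  have {}h1 : nm (Y x - sqrt_iter m x) < d / 8 by apply: h1; rewrite leq_maxl.
  have {}h2 : nm (Y (Y x) - sqrt_iter m (Y x)) < d / 8 by apply: h2; rewrite leq_maxr.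
  have hm : sqrt_iter m.+1 x + sqrt_iter m.+1 x = h (h x) + sqrt_iter m (sqrt_iter m x).
    by rewrite sqrt_iterS -scalerDr halfK.
  have -> : Y x + Y x - (h (h x) + Y (Y x)) = (Y x - sqrt_iter m.+1 x) + (Y x - sqrt_iter m.+1 x)
      - ((Y (Y x) - sqrt_iter m (Y x)) + sqrt_iter m (Y x - sqrt_iter m x)).
    rewrite (linB _ _ (sq_lin m)) subrKA [in RHS]addrACA -opprD hm -[RHS]addrA -opprD.
    by congr (_ - _); rewrite -addrA; congr (_ + _); rewrite addrC subrK.
  have [_ _ nm_m _] := sqrt_iterP m; have h4 := nm_m (Y x - sqrt_iter m x).
  rewrite (le_lt_trans (nmB _ _))// (le_lt_trans (lerD (nmD _ _) (nmD _ _)))//.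
  move: h1 h2 h3 h4; lra.
exists (idfun - Y); split.
- exact: boB (bo_id H) bY.
- by move=> x y; rewrite !fctE ipBl ipBr sY.
- by move=> x; rewrite !fctE cYh linB.
- move=> x; rewrite !fctE (linB _ _ lY) opprB addrACA -opprD Yeq.
  by rewrite opprD addrACA subrr addr0.
Qed.

(** h + i Z and h - i Z are unitary when Z^2 = 1 - h^2 and Z commutes with h, and
their mean is h. *)
Lemma unitary_pair : exists U V : H -> H, [/\ unitary_operator ip U,
  unitary_operator ip V & h = (2^-1)%:C *: (U + V)].
Proof.
have [Z [bZ sZ cZ ZZ]] := sqrt_one_sub_square.
have lZ := bo_lin bZ.
have iC := conj_i R.
have ii : 'i * 'i = -1 :> R[i] by rewrite -expr2 sqr_i.
pose W (s : R[i]) : H -> H := s *: Z + h.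
have bW s : bounded_operator (W s) by exact: bo_lincomb.
have aW s : Num.conj s = - s -> adjoint ip (W s) = W (- s).
  move=> sC; apply: (adjoint_unique hH) => x y.
  by rewrite /W !fctE ipDl ipZl ipDr ipZr sZ sh rmorphN /= sC opprK.
have WW s x : s * s = -1 -> W (- s) (W s x) = x.
  move=> ss; rewrite /W !fctE (linD _ _ lZ) (linZ _ _ lZ) (linD _ _ lh) (linZ _ _ lh).
  rewrite cZ ZZ scalerDr scalerA mulNr ss opprK scale1r scaleNr.
  by rewrite subrKA subrK.
have uW s : Num.conj s = - s -> s * s = -1 -> unitary_operator ip (W s).
  move=> sC ss; split; first exact: bW.
    by apply/funext => x /=; rewrite aW// WW.
  apply/funext => x /=; rewrite aW//.
  by have := WW (- s) x; rewrite opprK; apply; rewrite mulrNN.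
exists (W 'i), (W (- 'i)); split.
- exact: uW.
- by apply: uW; rewrite ?rmorphN /= ?iC ?mulrNN.
- apply/funext => x; rewrite /W !fctE scaleNr addrACA subrr add0r.
  by rewrite halfK.
Qed.

End SquareRoot.

Lemma unitary_id : unitary_operator ip (idfun : H -> H).
Proof.
by split; rewrite ?(adjoint_unique hH (S := idfun))//; exact: bo_id.
Qed.

(** Up to a scalar, B is h1 + i h2 with symmetric h1 and h2 of norm at most 1/2,
and each of these is the mean of two unitaries. Stated as an induction
principle, which avoids linear combinations over explicit families. *)
Lemma unitary_span_ind (Q : (H -> H) -> Prop) :
  (forall U, unitary_operator ip U -> Q U) ->
  (forall c A B, bounded_operator A -> bounded_operator B -> Q A -> Q B -> Q (c *: A + B)) ->
  forall B, bounded_operator B -> Q B.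
Proof.
move=> QU Qlin B bB.
have b0 := bo0 H.
have Q0 : Q 0.
  rewrite (_ : 0 = (-1) *: idfun + idfun).
    by apply: Qlin; try exact: bo_id; apply: QU; exact: unitary_id.
  by apply/funext => x; rewrite !fctE scaleN1r addNr.
have QZ c A : bounded_operator A -> Q A -> Q (c *: A).
  by move=> bA QA; rewrite -[_ *: _]addr0; exact: Qlin.
have QD A A' : bounded_operator A -> bounded_operator A' -> Q A -> Q A' -> Q (A + A').
  by move=> bA bA' QA QA'; rewrite -[A]scale1r; exact: Qlin.
have Qs h : bounded_operator h -> symmetric_operator ip h ->
    (forall x, nm (h x) <= 2^-1 * nm x) -> Q h.
  move=> bh sh nh; have [U [V [uU uV ->]]] := unitary_pair bh sh nh.
  have [bU _ _] := uU; have [bV _ _] := uV.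
  by apply: QZ; [exact: boD|apply: QD => //; exact: QU].
pose C := adjoint ip B; have bC : bounded_operator C := bo_adjoint hH bB.
have [M1 M10 hM1] := bo_norm bB; have [M2 M20 hM2] := bo_norm bC.
pose M := M1 + M2; have M0 : 0 < M by rewrite addr_gt0.
have nBC x (s : R[i]) : cabs s = 1 -> nm (B x + s *: C x) <= M * nm x.
  move=> s1; rewrite (le_trans (nmD _ _))// nmZ s1 mul1r mulrDl.
  by rewrite lerD.
pose r : R := (2 * M)^-1.
have r0 : 0 <= r by rewrite invr_ge0 mulr_ge0// ltW.
have iC := conj_i R.
pose h1 : H -> H := r%:C *: (B + C).
pose h2 : H -> H := (- 'i * r%:C) *: (B - C).
have bh1 : bounded_operator h1 by apply: boZ; exact: boD.
have bh2 : bounded_operator h2 by apply: boZ; exact: boB.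
have nh (s c : R[i]) : cabs s = 1 -> cabs c = r ->
    forall x, nm (c *: (B x + s *: C x)) <= 2^-1 * nm x.
  move=> s1 cr x; rewrite nmZ cr.
  have -> : 2^-1 * nm x = r * (M * nm x) by rewrite /r; field; rewrite gt_eqF.
  by rewrite ler_wpM2l// nBC.
have cr : cabs r%:C = r by rewrite cabsR ger0_norm.
have cm1 : cabs (- 1 : R[i]) = 1 by rewrite cabsN cabs1.
have ci : cabs (- 'i * r%:C) = r.
  rewrite cabsM cabsN cr [cabs 'i](_ : _ = 1) ?mul1r//.
  by rewrite /cabs /= expr0n add0r expr1n sqrtr1.
have Q1 : Q h1.
  apply: Qs => // [x y|x].
    rewrite /h1 !fctE ipZl ipZr conjcR ipDl ipDr.
    by rewrite (adjointP hH bB) (adjointP' hH bB) -/C [_ + ip x (B y)]addrC.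
  by have := nh _ _ (@cabs1 R) cr x; rewrite scale1r.
have Q2 : Q h2.
  apply: Qs => // [x y|x].
    rewrite /h2 !fctE ipZl ipZr conjM rmorphN /= iC conjcR opprK ipBl ipBr.
    by rewrite (adjointP hH bB) (adjointP' hH bB) -/C; ring.
  by have := nh _ _ cm1 ci x; rewrite scaleN1r.
rewrite (_ : B = M%:C *: (h1 + 'i *: h2)).
  apply: (QZ); first by apply: boD => //; exact: boZ.
  by apply: QD => //; [exact: boZ|exact: QZ].
apply/funext => x; rewrite /h1 /h2 !fctE scalerA mulrA mulrN -expr2 sqr_i opprK mul1r.
rewrite -scalerDr scalerA addrACA subrr addr0.
have -> : B x + B x = 2%:C *: B x.
  by rewrite (_ : 2%:C = 1 + 1 :> R[i]) ?rmorphD// scalerDl scale1r.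
rewrite scalerA -!rmorphM (_ : _ * 2 = 1) ?scale1r//.
by rewrite /r; field; rewrite gt_eqF.
Qed.

End UnitarySpan.

(** * Ideals generated by an operator *)

Section GeneratedIdeal.
Context (R : realType) (H : completeNormedModType R[i]).
Implicit Types (T S K A B : H -> H).

Lemma ideal_generatedP T : bounded_operator T ->
  two_sided_ideal (ideal_generated T) /\ ideal_generated T T.
Proof.
move=> bT; split; last by move=> J [_ hJ]; exact: hJ.
have iB : two_sided_ideal [set A : H -> H | bounded_operator A].
  split => //; first exact: bo0.
  - by move=> c A B bA bB; exact: bo_lincomb.
  - by move=> A B bA bB; split; exact: bo_comp.
split.
- by move=> A hA; apply: (hA [set A : H -> H | bounded_operator A]); split => // _ ->.
- by move=> J [[_ h _ _] _].
- by move=> c A B hA hB J hJ; have [[_ _ h _] _] := hJ; apply: h; [exact: hA|exact: hB].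
- move=> A B bA hB; split=> J hJ; have [[_ _ _ h] _] := hJ;
  by have [] := h A B bA (hB J hJ).
Qed.

Lemma ideal_generated_min T J : two_sided_ideal J -> J T -> ideal_generated T `<=` J.
Proof. by move=> iJ JT A hA; apply: hA; split => // _ ->. Qed.

End GeneratedIdeal.

(** * Trace property and vanishing on the generated ideal *)

Section TraceProperty.
Context (R : realType) (H : completeNormedModType R[i]).
Context (ip : {dot H for Num.conj}) (hH : is_hilbert ip).
Implicit Types (x y z : H) (T S K A B U : H -> H).
Variables (J : set (H -> H)) (tau : (H -> H) -> R[i]).
Hypotheses (iJ : two_sided_ideal J) (sJ : singular_trace ip J tau).

Lemma ideal_bounded S : J S -> bounded_operator S.
Proof. by case: iJ => h _ _ _; exact: h. Qed.

Lemma ideal0 : J (0 : H -> H). Proof. by case: iJ. Qed.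

Lemma ideal_lin c S T : J S -> J T -> J (c *: S + T).
Proof. by case: iJ => _ _ h _; exact: h. Qed.

Lemma ideal_compl B S : bounded_operator B -> J S -> J (B \o S).
Proof. by case: iJ => _ _ _ h bB hS; have [] := h B S bB hS. Qed.

Lemma ideal_compr B S : bounded_operator B -> J S -> J (S \o B).
Proof. by case: iJ => _ _ _ h bB hS; have [] := h B S bB hS. Qed.

Lemma tau_lin c S T : J S -> J T -> tau (c *: S + T) = c * tau S + tau T.
Proof. by case: sJ => h _ _ _; exact: h. Qed.

Lemma tau_ge0 S : J S -> positive_operator ip S -> 0 <= tau S.
Proof. by case: sJ => _ h _ _; exact: h. Qed.

Lemma tau0 : tau 0 = 0.
Proof.
have := tau_lin 1 ideal0 ideal0; rewrite scale1r addr0 mul1r => /eqP.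
by rewrite -subr_eq0 opprD addrA subrr add0r oppr_eq0 => /eqP.
Qed.

Lemma comp_linr c S A B : linear S -> S \o (c *: A + B) = c *: (S \o A) + (S \o B).
Proof. by move=> lS; apply/funext => x /=; rewrite !fctE lS. Qed.

Lemma comp_linl c S A B : (c *: A + B) \o S = c *: (A \o S) + (B \o S).
Proof. by []. Qed.

(** For unitary U, U S is the conjugate of S U by U; the general case follows by
linearity. *)
Lemma tau_comm S B : J S -> bounded_operator B -> tau (S \o B) = tau (B \o S).
Proof.
move=> hS; move: B; apply: (unitary_span_ind hH) => [U uU|c A B bA bB hA hB].
  have [bU _ hU] := uU; case: sJ => _ _ h _.
  rewrite -(h U (S \o U))//; last exact: ideal_compr.
  congr tau; apply/funext => x /=.
  by have := f_equal (fun f => f x) hU => /= ->.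
rewrite comp_linr; last exact/bo_lin/ideal_bounded.
rewrite comp_linl !tau_lin ?hA ?hB//; try exact: ideal_compr; exact: ideal_compl.
Qed.

(** Near s = 0 the linear term dominates the quadratic one. *)
Lemma quadratic_ge0_eq0 (g k : R[i]) :
  (forall s : R, 0 <= (s ^+ 2)%:C * g + s%:C * k) -> k = 0.
Proof.
case: g k => g1 g2 [k1 k2] h.
have h1 s : 0 <= s ^+ 2 * g1 + s * k1 /\ s ^+ 2 * g2 + s * k2 = 0.
  by have := h s; rewrite lecE /= !mul0r !subr0 !addr0 => /andP[/eqP ? ?].
have [_ e1] := h1 1; have [_ e2] := h1 (-1).
have k20 : k2 = 0 by lra.
pose d := `|g1| + 1; have d0 : 0 < d by rewrite ltr_wpDl.
have [e3 _] := h1 (- k1 / (2 * d)).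
have : 0 <= k1 ^+ 2 * (g1 - 2 * d).
  have -> : k1 ^+ 2 * (g1 - 2 * d) = (2 * d) ^+ 2 * ((- k1 / (2 * d)) ^+ 2 * g1 + - k1 / (2 * d) * k1).
    by field; rewrite gt_eqF.
  by rewrite mulr_ge0// sqr_ge0.
have gd : g1 - 2 * d < 0 by have := ler_norm g1; have := normr_ge0 g1; rewrite /d; lra.
rewrite nmulr_lge0// => h3.
have /eqP : k1 ^+ 2 = 0 by apply/eqP; rewrite eq_le h3 sqr_ge0.
by rewrite sqrf_eq0 k20 => /eqP ->.
Qed.

(** Expand tau of (c A + 1) T (c A + 1)^*, which is nonnegative for every scalar c. The
term of order 0 is tau T = 0, so the linear terms vanish, for real and for
imaginary c. *)
Lemma tau_left_zero T A : J T -> positive_operator ip T -> tau T = 0 ->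
  bounded_operator A -> tau (A \o T) = 0.
Proof.
move=> hT pT tT bA.
pose C := adjoint ip A; have bC : bounded_operator C := bo_adjoint hH bA.
have bT := ideal_bounded hT.
set al := tau (A \o T); pose be := tau (T \o C); pose ga := tau (A \o (T \o C)).
have jTC : J (T \o C) by exact: ideal_compr.
have jAT : J (A \o T) by exact: ideal_compl.
have jATC : J (A \o (T \o C)) by exact: ideal_compl.
have key (c : R[i]) : 0 <= c * Num.conj c * ga + c * al + Num.conj c * be.
  pose X := c *: A + idfun; have bX : bounded_operator X by exact: bo_lincomb bA (bo_id H).
  have aX : adjoint ip X = Num.conj c *: C + idfun.
    apply: (adjoint_unique hH) => x y.
    by rewrite !fctE ipDl ipDr ipZl ipZr conjCK (adjointP hH bA).
  have -> : c * Num.conj c * ga + c * al + Num.conj c * be = tau (X \o (T \o adjoint ip X)).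
    rewrite aX (comp_linr _ _ _ (bo_lin bT)) comp_linl.
    rewrite (comp_linr _ _ _ (bo_lin bA)) (_ : T \o idfun = T)//.
    rewrite (_ : idfun \o _ = Num.conj c *: (T \o C) + T)//.
    rewrite tau_lin; last 2 first.
      exact: ideal_lin.
      exact: ideal_lin.
    rewrite tau_lin// tau_lin// tT -/al -/be -/ga; ring.
  apply: tau_ge0.
    by apply: ideal_compl => //; apply: ideal_compr => //; exact: bo_adjoint.
  by move=> x /=; rewrite (adjointP hH bX).
have iC := conj_i R.
have s1 : al + be = 0.
  apply: (@quadratic_ge0_eq0 ga) => s; have := key s%:C; rewrite conjcR.
  by rewrite -rmorphM -expr2 -addrA -mulrDr.
have s2 : 'i * (al - be) = 0.
  apply: (@quadratic_ge0_eq0 ga) => s; have := key (s%:C * 'i); rewrite conjM conjcR iC.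
  have ii : 'i * 'i = -1 :> R[i] by rewrite -expr2 sqr_i.
  have -> : s%:C * 'i * (s%:C * - 'i) = (s ^+ 2)%:C.
    by rewrite mulrACA mulrN ii opprK mulr1 -rmorphM -expr2.
  by congr (0 <= _); ring.
move/eqP: s2; rewrite mulf_eq0 eq_complex /= oner_eq0 andbF /= subr_eq0 => /eqP ab.
move: s1; rewrite -ab -mulr2n -mulr_natl => /eqP.
by rewrite mulf_eq0 pnatr_eq0 /= => /eqP.
Qed.

(** The operators S with tau (A S B) = 0 for all A and B form an ideal, which contains
T by the previous lemma and the trace property. *)
Lemma tau_vanish T : J T -> positive_operator ip T -> tau T = 0 ->
  forall S, ideal_generated T S -> tau S = 0.
Proof.
move=> hT pT tT S hS.
pose N : set (H -> H) := [set S | J S /\ forall A B, bounded_operator A ->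
  bounded_operator B -> tau (A \o S \o B) = 0].
suff NS : N S.
  have [_ /(_ idfun idfun)] := NS.
  by apply; exact: bo_id.
apply: (ideal_generated_min _ _ hS); last first.
  split=> // A B bA bB; rewrite tau_comm//; last exact: ideal_compl.
  rewrite (_ : B \o (A \o T) = (B \o A) \o T)//.
  by apply: tau_left_zero => //; exact: bo_comp.
split.
- by move=> A [/ideal_bounded].
- split; first exact: ideal0.
  move=> A B bA bB; rewrite (_ : _ \o _ = 0) ?tau0//.
  by apply/funext => x /=; rewrite lin0//; exact: bo_lin.
- move=> c S1 S2 [j1 h1] [j2 h2]; split; first exact: ideal_lin.
  move=> A B bA bB; rewrite (comp_linr _ _ _ (bo_lin bA)) comp_linl tau_lin.
  + by rewrite h1// h2// mulr0 addr0.
  + by apply: ideal_compr => //; exact: ideal_compl.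
  + by apply: ideal_compr => //; exact: ideal_compl.
- move=> C S1 bC [j1 h1]; split; split.
  + exact: ideal_compl.
  + move=> A B bA bB.
    by rewrite (_ : _ \o _ = (A \o C) \o S1 \o B)// h1//; exact: bo_comp.
  + exact: ideal_compr.
  + move=> A B bA bB.
    by rewrite (_ : _ \o _ = A \o S1 \o (C \o B))// h1//; exact: bo_comp.
Qed.

End TraceProperty.

(** * Singular traces of diagonal operators *)

Section DiagonalTraces.
Context (R : realType) (H : completeNormedModType R[i]).
Context (ip : {dot H for Num.conj}) (hH : is_hilbert ip).
Implicit Types (c d : nat -> R).
Variable e : nat -> H.
Hypotheses (oe : orthonormal_seq ip e) (ce : complete_seq_basis ip e).
Arguments ce : clear implicits.
Variable t : nat -> R.
Hypotheses (t_gt0 : forall n, 0 < t n) (t_noninc : forall n, t n.+1 <= t n).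

Let t_le m n : (m <= n)%N -> t n <= t m.
Proof. exact: noninc_le. Qed.

Let bt : bounded_coef t.
Proof.
by exists (t 0%N) => n; rewrite ger0_norm ?t_le//; exact: ltW.
Qed.

Variable tau : (H -> H) -> R[i].
Let J := ideal_generated (diag e t).
Hypothesis sJ : singular_trace ip J tau.

Let iJ : two_sided_ideal J.
Proof. by have [b _] := diagP hH oe bt; have [] := ideal_generatedP b. Qed.

Let JT : J (diag e t).
Proof. by have [b _] := diagP hH oe bt; have [] := ideal_generatedP b. Qed.

(** The coefficients of the diagonal operators that are multiples of the
generator, hence lie in the ideal. *)
Definition dominated c := exists C : R, forall n, `|c n| <= C * t n.

Lemma dominated_bounded c : dominated c -> bounded_coef c.
Proof.
move=> [C hC]; exists (`|C| * t 0%N) => n; rewrite (le_trans (hC n))//.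
apply: (@le_trans _ _ (`|C| * t n)); first by rewrite ler_wpM2r ?(ltW (t_gt0 n))// ler_norm.
by rewrite ler_wpM2l// t_le.
Qed.

Lemma dominated_lin (r : R) c d : dominated c -> dominated d ->
  dominated (fun n => r * c n + d n).
Proof.
move=> [C hC] [D hD]; exists (`|r| * C + D) => n.
by rewrite (le_trans (ler_normD _ _))// mulrDl lerD// normrM -mulrA ler_wpM2l.
Qed.

Lemma dominated_mask c (p : pred nat) : dominated c ->
  dominated (fun n => if p n then c n else 0).
Proof.
move=> [C hC]; exists C => n; case: ifP => // _.
by rewrite normr0; apply: le_trans (hC n).
Qed.

Lemma dominated_diag c : dominated c -> J (diag e c).
Proof.
move=> dc; have bc := dominated_bounded dc.
have bct : bounded_coef (fun n => c n / t n).
  have [C hC] := dc; exists C => n; rewrite normrM normfV (gtr0_norm (t_gt0 n)).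
  by rewrite ler_pdivrMr.
have -> : diag e c = diag e (fun n => c n / t n) \o diag e t.
  rewrite (diag_comp hH oe ce bct bt); congr diag; apply/funext => n.
  by rewrite mulfVK// gt_eqF.
apply: (ideal_compl iJ) => //.
by have [] := diagP hH oe bct.
Qed.

Let dl c := tau (diag e c).

Lemma diag_lin (r : R) c d : bounded_coef c -> bounded_coef d ->
  diag e (fun n => r * c n + d n) = r%:C *: diag e c + diag e d.
Proof.
move=> bc bd; have [b1 h1] := diagP hH oe bc; have [b2 h2] := diagP hH oe bd.
apply/esym/(diag_unique hH oe ce); first exact: bounded_coef_lin.
  exact: bo_lincomb.
by move=> n; rewrite !fctE h1 h2 scalerA -scalerDl -rmorphM -rmorphD.
Qed.

Lemma diag_trace_lin (r : R) c d : dominated c -> dominated d ->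
  dl (fun n => r * c n + d n) = r%:C * dl c + dl d.
Proof.
move=> hc hd; rewrite /dl diag_lin; try exact: dominated_bounded.
by rewrite (tau_lin sJ)//; exact: dominated_diag.
Qed.

Lemma diag_trace_ge0 c : dominated c -> (forall n, 0 <= c n) -> 0 <= dl c.
Proof.
move=> hc c0; apply: (tau_ge0 sJ); first exact: dominated_diag.
by apply: (diag_positive hH oe ce) => //; exact: dominated_bounded.
Qed.

Lemma dominated_delta N : dominated (fun n => (n == N)%:R).
Proof.
exists (t N)^-1 => n; have [->|_] := eqVneq n N; first by rewrite normr1 mulVf// gt_eqF.
by rewrite normr0 mulr_ge0 ?invr_ge0 ?ltW.
Qed.

(** A rank-one projection. *)
Lemma diag_trace_delta N : dl (fun n => (n == N)%:R) = 0.
Proof.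
have dd := dominated_delta N; have bd := dominated_bounded dd.
have [b h] := diagP hH oe bd.
have E : diag e (fun n => (n == N)%:R) = (fun x => ip x (e N) *: e N).
  apply/esym/(diag_unique hH oe ce) => //; first exact: bo_rank1.
  move=> n; rewrite oe; have [->|_] := eqVneq n N; first by [].
  by rewrite !scale0r.
case: sJ => _ _ _; apply; first exact: dominated_diag.
split => //.
- rewrite (diag_comp hH oe ce bd bd); congr diag; apply/funext => n.
  by case: eqVneq; rewrite ?mulr1 ?mulr0.
- exact: diag_adjoint.
- exists 1%N, (fun=> e N) => x; exists (fun=> ip x (e N)).
  by rewrite E big_ord1.
Qed.

Lemma diag_trace_finite c N : dominated c -> (forall n, (N <= n)%N -> c n = 0) -> dl c = 0.
Proof.
elim: N c => [|N IH] c hc h.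
  have := diag_trace_lin 1 hc hc.
  rewrite (_ : (fun n => 1 * c n + c n) = c); last first.
    by apply/funext => n; rewrite h// mul1r addr0.
  rewrite mul1r => /eqP; rewrite -subr_eq0 opprD addrA subrr add0r oppr_eq0.
  by move=> /eqP.
pose c' n := if (n != N) then c n else 0.
have hc' : dominated c' by exact: (dominated_mask (fun n => n != N)).
have -> : c = (fun n => c N * (n == N)%:R + c' n).
  apply/funext => n; rewrite /c'; have [->|_] := eqVneq n N.
    by rewrite mulr1 addr0.
  by rewrite mulr0 add0r.
rewrite diag_trace_lin ?diag_trace_delta ?mulr0 ?add0r ?IH//.
  move=> n Nn; rewrite /c'; case: eqVneq => // nN.
  by rewrite h// ltn_neqAle eq_sym nN.
exact: dominated_delta.
Qed.

(** Finitely many coefficients do not contribute, so the order of the coefficients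
has to hold only eventually. *)
Lemma diag_trace_le c d N : dominated c -> dominated d ->
  (forall n, (N <= n)%N -> c n <= d n) -> dl c <= dl d.
Proof.
move=> hc hd h; pose f n := (-1) * c n + d n.
have hf : dominated f by exact: dominated_lin.
pose f1 n := if (n < N)%N then f n else 0.
pose f2 n := if (N <= n)%N then f n else 0.
have h1 : dominated f1 by exact: (dominated_mask (fun n => n < N)%N).
have h2 : dominated f2 by exact: (dominated_mask (fun n => N <= n)%N).
have fE : f = (fun n => 1 * f1 n + f2 n).
  apply/funext => n; rewrite /f1 /f2 mul1r; case: ltnP => _; rewrite ?addr0 ?add0r//.
have : 0 <= dl f.
  rewrite fE diag_trace_lin// (@diag_trace_finite f1 N)//.
    rewrite mulr0 add0r; apply: diag_trace_ge0 => // n; rewrite /f2; case: ifP => // nN.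
    by rewrite /f mulN1r addrC subr_ge0 h.
  by move=> n nN; rewrite /f1 ltnNge nN.
by rewrite /f diag_trace_lin// rmorphN rmorph1 mulN1r addrC subr_ge0.
Qed.

(** With V the isometry e n -> e (s n), both operators are products of W = V^* and
(diag c) V, in the two orders. *)
Lemma diag_trace_reindex c (s : nat -> nat) (p : pred nat) : dominated c -> injective s ->
  (forall n, p (s n)) -> (forall m, p m -> exists n, m = s n) ->
  dominated (c \o s) -> dl (c \o s) = dl (fun m => if p m then c m else 0).
Proof.
move=> hc injs ps sp hcs.
have c1 (n : nat) : cabs (1 : R[i]) <= 1 by rewrite cabs1.
have [V [bV hV _]] := @shift_operator _ _ _ hH e oe (fun=> 1) s 1 injs c1.
have {}hV n : V (e n) = e (s n) by rewrite hV scale1r.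
have bW := bo_adjoint hH bV; set W := adjoint ip V in bW.
have WV n : W (e (s n)) = e n.
  apply: (basis_ext ce) => k; rewrite (adjointP' hH bV) hV !oe (inj_eq injs)//.
have W0 m : ~~ p m -> W (e m) = 0.
  move=> npm; apply: (basis_ext ce) => k; rewrite (adjointP' hH bV) hV oe ip0l.
  by case: eqVneq => // mk; rewrite mk ps in npm.
have bc := dominated_bounded hc; have [bd hd] := diagP hH oe bc.
have hm := dominated_mask p hc.
have E1 : diag e (c \o s) = W \o (diag e c \o V).
  apply/esym/(diag_unique hH oe ce); first exact: dominated_bounded.
    by apply: bo_comp => //; exact: bo_comp.
  by move=> n /=; rewrite hV hd linZ ?WV//; exact: bo_lin.
have E2 : diag e (fun m => if p m then c m else 0) = (diag e c \o V) \o W.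
  apply/esym/(diag_unique hH oe ce); first exact: dominated_bounded.
    by apply: bo_comp => //; exact: bo_comp.
  move=> m /=; case: ifP => pm; last first.
    rewrite W0 ?pm// (lin0 (bo_lin bV)) (lin0 (bo_lin bd)) scale0r//.
  by have [n ->] := sp m pm; rewrite WV hV hd.
rewrite /dl E1 E2 -(tau_comm hH iJ sJ)//.
by apply: (ideal_compr iJ) => //; exact: dominated_diag.
Qed.

Lemma dominated_sub c : (forall n, 0 <= c n <= t n) -> dominated c.
Proof.
by move=> h; exists 1 => n; have /andP[c0 ct] := h n; rewrite ger0_norm// mul1r.
Qed.

Let t0 n := t (2 * n)%N.
Let t1 n := t (2 * n).+1.

Let dt : dominated t. Proof. by apply: dominated_sub => n; rewrite lexx ltW. Qed.
Let dt0 : dominated t0.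
Proof.
apply: dominated_sub => n; apply/andP; split; first exact: (ltW (t_gt0 _)).
by apply: t_le; rewrite mul2n -addnn leq_addr.
Qed.
Let dt1 : dominated t1.
Proof.
apply: dominated_sub => n; apply/andP; split; first exact: (ltW (t_gt0 _)).
by apply: t_le; rewrite mul2n -addnn -addnS leq_addr.
Qed.

Lemma diag_trace_halves : dl t = dl t0 + dl t1.
Proof.
have -> : dl t0 = dl (fun m => if ~~ odd m then t m else 0).
  apply: (@diag_trace_reindex t (fun n => (2 * n)%N) (fun m => ~~ odd m)) => //.
  - by move=> m n /eqP; rewrite eqn_mul2l => /eqP.
  - by move=> n; rewrite oddM.
  - by move=> m om; exists m./2; rewrite mul2n even_halfK.
have -> : dl t1 = dl (fun m => if odd m then t m else 0).
  apply: (@diag_trace_reindex t (fun n => (2 * n).+1) (fun m => odd m)) => //.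
  - by move=> m n /eqP; rewrite eqSS eqn_mul2l => /eqP.
  - by move=> n; rewrite /= oddM.
  - by move=> m om; exists m./2; rewrite mul2n -[LHS]odd_double_half om.
rewrite -[dl (fun m => if ~~ odd m then _ else _)]mul1r -diag_trace_lin.
- congr dl; apply/funext => m; case: (odd m); rewrite /= ?mulr0 ?add0r//.
  by rewrite mul1r addr0.
- exact: (dominated_mask (fun m => ~~ odd m)).
- exact: (dominated_mask odd).
Qed.

(** t (2n+2) <= t (2n+1) <= t (2n), and dropping the first coefficient does not
change the trace. *)
Lemma diag_trace_halves_eq : dl t0 = dl t1.
Proof.
have h1 : dl t1 <= dl t0.
  by apply: (@diag_trace_le _ _ 0) => // n _; exact: t_noninc.
have dS : dominated (t0 \o S).
  apply: dominated_sub => n; apply/andP; split; first exact: (ltW (t_gt0 _)).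
  by apply: t_le; rewrite (leq_trans (leqnSn _))// leq_pmull.
have h2 : dl (t0 \o S) = dl t0.
  rewrite (@diag_trace_reindex t0 S (fun m => m != 0%N))//.
  - apply/eqP; rewrite eq_le; apply/andP; split;
      by apply: (@diag_trace_le _ _ 1) => //; [exact: (dominated_mask (fun m => m != 0%N))|case].
  - exact: succn_inj.
  - by case=> // m _; exists m.
apply/eqP; rewrite eq_le h1 andbT -h2.
apply: (@diag_trace_le _ _ 0) => // n _; rewrite /t0 /t1 /= t_le//.
by rewrite mulnS.
Qed.

(** For every d > 0, t n lies eventually between (L - d) t (2n+1) and
(L + d) t (2n+1). *)
Lemma diag_trace_doubling (L : R) : (fun n => t n / t1 n) @ \oo --> L -> dl t = L%:C * dl t1.
Proof.
move=> /cvgn_eps h.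
have p0 : 0 <= dl t1 by apply: diag_trace_ge0 => // n; exact: (ltW (t_gt0 _)).
have both (d : R) : 0 < d -> (L - d)%:C * dl t1 <= dl t <= (L + d)%:C * dl t1.
  move=> d0; have [N hN] := h d d0.
  have z1 : dominated (fun n => 0 * t n) by rewrite /dominated; exists 0 => n; rewrite !mul0r normr0.
  have dz r : dl (fun n => r * t1 n + 0 * t n) = r%:C * dl t1.
    rewrite diag_trace_lin// (@diag_trace_finite (fun n => 0 * t n) 0)// ?addr0//.
    by move=> n _; rewrite mul0r.
  rewrite -!dz; apply/andP; split; apply: (@diag_trace_le _ _ N) => //;
    try exact: dominated_lin;
  move=> n /hN; rewrite mul0r addr0 ltr_norml => /andP[u1 u2].
    by rewrite -(ler_pdivlMr _ _ (t_gt0 _)) -/(t1 n); lra.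
  by rewrite -(ler_pdivrMr _ _ (t_gt0 _)) -/(t1 n); lra.
apply/eqP; rewrite eq_complex.
have eI : Im (dl t) = Im (L%:C * dl t1).
  have /andP[+ _] := both 1 ltr01; rewrite lecE => /andP[/eqP -> _].
  move: (ger0_Im p0); case: (dl t1) => ? y /= ->; rewrite !mulr0 !mul0r//.
rewrite eI eqxx andbT -subr_eq0 -normr_le0 ReZ.
apply/ler_addgt0Pr => d d0; rewrite add0r.
have r0 : 0 <= Re (dl t1) by move: p0; rewrite lecE => /andP[].
have r1 : 0 < Re (dl t1) + 1 by rewrite ltr_wpDl.
have /andP[] := both _ (divr_gt0 d0 r1); rewrite !lecE !ReZ => /andP[_ u1] /andP[_ u2].
have sd : d / (Re (dl t1) + 1) * Re (dl t1) <= d.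
  by rewrite mulrAC ler_pdivrMr// ler_pM2l// lerDl.
rewrite ler_norml; move: u1 u2; rewrite mulrBl mulrDl => u1 u2; lra.
Qed.

(** The two relations tau T = 2 x and tau T = L x, where x is the trace of the odd
half. *)
Lemma no_singular_trace (L : R) : (fun n => t n / t1 n) @ \oo --> L -> L != 2 ->
  forall S, J S -> tau S = 0.
Proof.
move=> hL L2; apply: (tau_vanish hH iJ sJ) => //.
  by apply: (diag_positive hH oe ce) => // n; exact: ltW.
have h1 := diag_trace_halves; rewrite diag_trace_halves_eq in h1.
have h2 := diag_trace_doubling hL.
have d0 : dl t1 = 0.
  have /eqP : (L - 2)%:C * dl t1 = 0.
    by rewrite rmorphB rmorph_nat mulrBl -h2 h1 mulr_natl mulr2n subrr.
  by rewrite mulf_eq0 (inj_eq (@complexI _) _ 0) subr_eq0 (negbTE L2) => /eqP.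
by rewrite -/(dl t) h1 d0 addr0.
Qed.

End DiagonalTraces.

(** * Dimensions and singular traceability *)

Section Spectrum.
Context (R : realType) (H : completeNormedModType R[i]).
Context (ip : {dot H for Num.conj}) (hH : is_hilbert ip).
Variable D : operator H.

Let mu := singular_value ip (inverse_operator D).

Lemma powR_cvg (u : nat -> R) (L d : R) : u @ \oo --> L -> 0 < L ->
  (fun n => u n `^ d) @ \oo --> L `^ d.
Proof.
move=> uL L0; have cp : {for L, continuous (fun x : R => x `^ d)}; last exact: (continuous_cvg _ cp uL).
apply: differentiable_continuous; apply/derivable1_diffP.
by apply: derivable_powR; rewrite in_itv/= L0.
Qed.

(** The extended logarithms are finite here. *)
Lemma log_ratioE n : (1 < n)%N -> 0 < mu n -> log_ratio ip D n = (ln_ratio mu n)%:E.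
Proof.
move=> n1 m0; have n0 : 0 < (n%:R : R) by rewrite ltr0n (ltn_trans _ n1).
have ni : 0 < (n%:R^-1 : R) by rewrite invr_gt0.
have l0 : ln (n%:R^-1 : R) < 0 by rewrite ln_lt0// ni invf_lt1// ltr1n.
rewrite /log_ratio -/mu /lne (negbTE (_ : ~~ (_ <= _)))//; last by rewrite -ltNge.
by rewrite (negbTE (_ : ~~ (_ <= _))) -?ltNge//= inver lt_eqF.
Qed.

(** Eigenvalues may be negative; t is the sequence of their moduli, so the singular
values are t and the signs disappear from |D|^-d. *)
Lemma inverse_operator_spectrum : self_adjoint ip D -> has_compact_resolvent D ->
  zero_not_eigenvalue D -> infinite_dim ip ->
  exists e (t : nat -> R),
  [/\ orthonormal_seq ip e, complete_seq_basis ip e, vanishing t,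
      forall n, [/\ 0 < t n, t n.+1 <= t n & mu n.+1 = t n] &
      forall d : R, 0 < d -> abs_power_opp D d = diag e (fun n => t n `^ d)].
Proof.
move=> saD crD D0 infH.
have [e [k [oe ce hk k0 hK]]] := inverse_spectral hH saD crD D0 infH.
have bk : exists M : R, forall n, `|k n| <= M.
  by exists `|k 0%N|; elim=> // n; apply: le_trans; have [] := hk n.
have bK := inverse_bounded hH saD crD D0.
have aK : adjoint ip (inverse_operator D) = inverse_operator D.
  by apply: (adjoint_unique hH) => x y; exact: (inverse_symmetric hH saD crD D0).
exists e, (fun n => `|k n|); split => //.
- by move=> c c0; have [N hN] := k0 c c0; exists N => n /hN; rewrite normr_id.
- move=> n; have [kn kS] := hk n; split => //; first by rewrite normr_gt0.
  apply: (singular_value_basis hH oe ce bK (c := fun n => `|k n|)) => // [j|j].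
    by have [] := hk j.
  have [Ke _ _] := hK j; rewrite aK Ke linZ; last exact: bo_lin.
  by rewrite Ke scalerA -rmorphM -normrX ger0_norm ?sqr_ge0// expr2.
- move=> d d0; apply: (abs_power_oppE hH saD oe ce) => // n; last by have [] := hk n.
  by have [] := hK n.
Qed.

Variables (e : nat -> H) (t : nat -> R).
Hypotheses (oe : orthonormal_seq ip e) (ce : complete_seq_basis ip e).
Arguments ce : clear implicits.
Hypothesis t0 : vanishing t.
Hypothesis ht : forall n, [/\ 0 < t n, t n.+1 <= t n & mu n.+1 = t n].
Hypothesis powE :
  forall d : R, 0 < d -> abs_power_opp D d = diag e (fun n => t n `^ d).

Let t_gt0 n : 0 < t n. Proof. by have [] := ht n. Qed.
Let t_noninc n : t n.+1 <= t n. Proof. by have [] := ht n. Qed.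
Let muE n : mu n.+1 = t n. Proof. by have [] := ht n. Qed.
Let mu_gt0 n : (0 < n)%N -> 0 < mu n.
Proof. by case: n => // n _; rewrite muE. Qed.
Let t_le m n : (m <= n)%N -> t n <= t m.
Proof. exact: noninc_le. Qed.
Let mu_noninc m n : (0 < m)%N -> (m <= n)%N -> mu n <= mu m.
Proof. by case: m => // m _; case: n => // n mn; rewrite !muE t_le. Qed.
Let mu_le1 : exists N, forall n, (N <= n)%N -> mu n <= 1.
Proof.
have [N hN] := t0 ltr01; exists N.+1 => -[//|n Nn]; rewrite muE.
by rewrite ltW// (le_lt_trans (ler_norm _))// hN.
Qed.

Section Powers.
Variables (d : R) (d0 : 0 < d).

Lemma power_gt0 n : 0 < t n `^ d. Proof. exact: powR_gt0. Qed.

Lemma power_noninc n : t n.+1 `^ d <= t n `^ d.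
Proof. by rewrite ge0_ler_powR ?nnegrE ?(ltW d0)//; exact: (ltW (t_gt0 _)). Qed.

Lemma power_bounded : bounded_coef (fun n => t n `^ d).
Proof.
exists (t 0%N `^ d) => n; rewrite ger0_norm ?powR_ge0//.
by rewrite ge0_ler_powR ?nnegrE ?(ltW d0)// ?t_le//; exact: (ltW (t_gt0 _)).
Qed.

Lemma power_vanishing : vanishing (fun n => t n `^ d).
Proof.
move=> c c0; have c1 : 0 < c `^ d^-1 by exact: powR_gt0.
have [N hN] := t0 c1; exists N => n /hN; rewrite !ger0_norm ?powR_ge0 ?(ltW (t_gt0 _))//.
move=> h; have := gt0_ltr_powR d0 _ _ h; rewrite -powRrM mulVf ?gt_eqF// powRr1 ?(ltW c0)//.
by apply; rewrite nnegrE ?(ltW c1)// (ltW (t_gt0 _)).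
Qed.

Lemma power_compact : compact_operator (abs_power_opp D d).
Proof.
rewrite powE//; apply: (compact_diag hH oe ce); [exact: power_bounded|exact: power_vanishing].
Qed.

Lemma power_positive : positive_operator ip (abs_power_opp D d).
Proof.
rewrite powE//; apply: (diag_positive hH oe ce) => [|n]; [exact: power_bounded|exact: powR_ge0].
Qed.

Lemma power_singular_value n : (0 < n)%N ->
  singular_value ip (abs_power_opp D d) n = mu n `^ d.
Proof.
case: n => // n _; rewrite powE// muE; apply: (singular_value_diag hH oe ce) => //.
- exact: power_bounded.
- by move=> k; exact: powR_ge0.
- exact: power_noninc.
Qed.

Lemma power_sumE : (fun n : nat => \sum_(1 <= k < n.+1) singular_value ip (abs_power_opp D d) k) =
  (fun n : nat => \sum_(1 <= k < n.+1) mu k `^ d).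
Proof.
apply/funext => n; apply: eq_big_nat => k /andP[k0 _].
by rewrite power_singular_value.
Qed.

End Powers.

(** |D|^-d lies in L^(1,oo)_0 for every d above 1/dl and for no d below it. *)
Lemma hausdorff_dim_limit (dl : R) : 0 < dl -> ln_ratio mu @ \oo --> dl ->
  hausdorff_dim ip D = (dl^-1)%:E.
Proof.
move=> dl0 hl; rewrite /hausdorff_dim; apply/eqP; rewrite eq_le; apply/andP; split.
  apply/lee_addgt0Pr => c c0; apply: ereal_inf_lbound; exists (dl^-1 + c) => //.
  have d0 : 0 < dl^-1 + c by rewrite addr_gt0// invr_gt0.
  split => //; split; first exact: power_compact.
  rewrite power_sumE//; apply: littleo_ln; apply: (powR_mu_small mu_gt0 hl) => //.
  by rewrite mulrDl mulVf ?gt_eqF// ltrDl mulr_gt0.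
apply: le_ereal_inf_tmp => _ [d [d0 [_ hd]] <-]; rewrite lee_fin leNgt; apply/negP => dd.
move: hd; rewrite power_sumE//; apply: not_littleo_ln => [n|]; first exact: powR_ge0.
by apply: (powR_mu_large mu_gt0 hl) => //; rewrite -ltr_pdivlMr// mul1r.
Qed.

(** A convergent sequence has its limit as lower limit. The limit is finite and
nonzero as the box dimension is, and nonnegative as the singular values are
eventually at most 1. *)
Lemma log_ratio_cvg : box_dim ip D \is a fin_num -> box_dim ip D != 0%E ->
  cvgn (log_ratio ip D) ->
  exists2 dl : R, 0 < dl & ln_ratio mu @ \oo --> dl /\ box_dim ip D = (dl^-1)%:E.
Proof.
move=> + + cv; rewrite /box_dim (is_cvg_limn_einfE cv).
move: cv; set l := limn _ => /[dup] cv; case: l cv => [dl||] cv _.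
- have near_fin : \forall n \near \oo, log_ratio ip D n = (ln_ratio mu n)%:E.
    by exists 2 => // n /= n2; rewrite log_ratioE// mu_gt0// (ltn_trans _ n2).
  have cl : ln_ratio mu @ \oo --> dl.
    have /fine_cvg h := cv; apply: cvg_trans h; apply: near_eq_cvg.
    by near=> n; rewrite /= (near near_fin n)//.
  have [->|dn] := eqVneq dl 0; first by rewrite inve0.
  rewrite inver (negbTE dn) => _ _; exists dl => //.
  by rewrite lt_neqAle eq_sym dn (ln_ratio_limit_ge0 mu_le1 cl).
(* +oo would give the dimension 0, and -oo an infinite one *)
- by rewrite invey eqxx.
- by rewrite inveNy.
Unshelve. all: by end_near.
Qed.

(** L = 1 would make the logarithmic ratio tend to 0, against the finiteness of
the box dimension. *)
Lemma doubling_cvg : cvgn (singular_value_ratio ip D) -> box_dim ip D \is a fin_num ->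
  box_dim ip D != 0%E ->
  exists L : R, [/\ 1 < L, singular_value_ratio ip D @ \oo --> L,
     ln_ratio mu @ \oo --> ln L / ln 2 & box_dim ip D = ((ln L / ln 2)^-1)%:E].
Proof.
move=> cv f0 n0; set L := limn (singular_value_ratio ip D).
have cL : singular_value_ratio ip D @ \oo --> (L : R) by [].
have [L1 hl] := ln_ratio_of_doubling mu_gt0 mu_noninc cL.
have ce' : log_ratio ip D @ \oo --> (ln L / ln 2)%:E.
  apply/fine_cvgP; split.
    by exists 2 => // n /= n2; rewrite log_ratioE// mu_gt0// (ltn_trans _ n2).
  apply: cvg_trans hl; apply: near_eq_cvg.
  by exists 2 => // n /= n2; rewrite log_ratioE// mu_gt0// (ltn_trans _ n2).
have [|dl dl0 [hl' bE]] := log_ratio_cvg f0 n0; first by apply/cvg_ex; exists (ln L / ln 2)%:E.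
have E : dl = ln L / ln 2 by exact: cvg_unique hl' hl.
exists L; rewrite -E; split => //.
rewrite lt_neqAle L1 andbT; apply: contraTneq dl0 => L1'.
by rewrite E -L1' ln1 mul0r ltxx.
Qed.

Section SingularTraces.
Variable L : R.
Hypotheses (L1 : 1 < L) (cL : singular_value_ratio ip D @ \oo --> L).
Variables (d : R) (d0 : 0 < d).

Let tt n := t n `^ d.
Let L0 : 0 < L. Proof. exact: lt_trans ltr01 L1. Qed.

Lemma ratio_powR (u v : R) : 0 < u -> 0 < v -> (u / v) `^ d = u `^ d / v `^ d.
Proof.
move=> u0 v0; rewrite powRM ?invr_ge0 ?(ltW u0) ?(ltW v0)//.
by rewrite -[v^-1]powR_inv1 ?(ltW v0)// powRAC powR_inv1// powR_ge0.
Qed.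

(** t n / t (2n+1) is the doubling ratio of the singular values at n+1. *)
Lemma power_doubling : (fun n => tt n / tt (2 * n).+1) @ \oo --> L `^ d.
Proof.
have h : (fun n => (singular_value_ratio ip D n.+1) `^ d) @ \oo --> L `^ d.
  by apply: powR_cvg L0; rewrite cvg_shiftS.
apply: cvg_trans h; apply: near_eq_cvg; apply: nearW => n.
by rewrite /singular_value_ratio -/mu mulnS !muE ratio_powR.
Qed.

(** The doubling ratio along powers of 2, normalized by its limit. *)
Lemma power_dyadic : L `^ d = 2 ->
  (fun k => 2 * tt (2 ^ k.+1).-1 / tt (2 ^ k).-1) @ \oo --> (1 : R).
Proof.
move=> L2.
pose f n := 2 / (singular_value_ratio ip D n) `^ d.
have h : f @ \oo --> (1 : R).
  have -> : (1 : R) = 2 / L `^ d by rewrite L2 divff.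
  apply: cvgM; first exact: cvg_cst.
  by apply: cvgV; [rewrite gt_eqF// powR_gt0|exact: powR_cvg].
apply/cvgn_eps => c c0; have [N hN] := proj1 (cvgn_eps _ _) h c c0.
exists N => k Nk; have := hN (2 ^ k)%N (leq_trans Nk (ltnW (ltn_expl _ _))) => /(_ isT).
rewrite /f /singular_value_ratio -/mu -expnS.
have E j : mu (2 ^ j)%N = t (2 ^ j).-1 by rewrite -muE prednK// expn_gt0.
by rewrite !E ratio_powR// invf_div mulrA.
Qed.

(** The ideal of |D|^-d is contained in the domain of the dyadic trace, which is a
nonzero singular trace on it when the doubling ratio of the coefficients is 2;
otherwise every singular trace vanishes. *)
Lemma singularly_traceable_power : singularly_traceable ip (abs_power_opp D d) <-> L `^ d = 2.
Proof.
split=> [[_ _ [tau st [S JS /eqP tS]]]|L2].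
  apply: contra_notP tS => /eqP L2.
  move: st JS; rewrite powE// => st JS.
  apply: (no_singular_trace hH oe ce _ _ st power_doubling) => //.
  - exact: power_gt0.
  - exact: power_noninc.
split; [exact: power_compact|exact: power_positive|].
have p0 := power_gt0 d; have pS := power_noninc d0.
have pl m n : (m <= n)%N -> tt n <= tt m.
  exact: noninc_le.
pose q k := tt (2 ^ k).-1.
have q0 k : 0 < q k by exact: p0.
have qS k : q k.+1 <= q k.
  by apply: pl; rewrite -!subn1 leq_sub2r// leq_exp2l.
have q1 := power_dyadic L2; have qE k : q k = tt (2 ^ k).-1 by [].
have [bT _] := diagP hH oe (power_bounded d0).
have [iJ JT] := ideal_generatedP bT.
have DT := diag_dyadic_ideal hH oe ce q0 p0 pS qE.
exists (dyadic_trace ip e q); rewrite powE//.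
  apply: (singular_trace_exists hH oe ce q0 qS q1) => //.
  apply: ideal_generated_min => //; exact: (dyadic_ideal_two_sided hH oe q0).
exists (diag e tt) => //; exact: (dyadic_trace_diag_neq0 hH oe ce q0 qS q1 p0 pS qE).
Qed.

Lemma powR_eq2 : L `^ d = 2 <-> d = (ln L / ln 2)^-1.
Proof.
have l2 : 0 < ln (2 : R) by rewrite ln_gt0// ltr1n.
have lL : 0 < ln L by rewrite ln_gt0.
rewrite invf_div; split=> [h|->].
  by rewrite -h ln_powR mulfK// gt_eqF.
by rewrite /powR gt_eqF// divfK ?gt_eqF// lnK// posrE.
Qed.

End SingularTraces.

End Spectrum.

Unset Implicit Arguments.
Local Close Scope complex_scope.

Theorem proposition2p7 (R : realType) (H : completeNormedModType R[i])
  (ip : {dot H for Num.conj}) (hH : is_hilbert ip)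
  (A : lmodType R[i]) (mul : {bilinear A -> A -> A}) (pi : A -> H -> H)
  (D : operator H) (hD : spectral_triple ip mul pi D)
  (hD0 : zero_not_eigenvalue D)
  (hfin : box_dim ip D \is a fin_num) (hnz : box_dim ip D != 0%E) :
  (cvgn (log_ratio ip D) -> box_dim ip D = hausdorff_dim ip D) /\
  (cvgn (singular_value_ratio ip D) ->
     (forall d : R, 0 < d ->
        (singularly_traceable ip (abs_power_opp D d) <-> d%:E = box_dim ip D)) /\
     box_dim ip D = hausdorff_dim ip D).
Proof.
have saD := triple_self_adjoint hD; have crD := triple_compact_resolvent hD.
have infH : infinite_dim ip.
  by apply: contrapT => /(finite_dim_box_dim hH D) E; rewrite E eqxx in hnz.
have [e [t [oe ce t0 ht powE]]] := inverse_operator_spectrum hH saD crD hD0 infH.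
split.
  move=> /(log_ratio_cvg t0 ht hfin hnz)[dl dl0 [cl ->]].
  by rewrite (hausdorff_dim_limit hH oe ce t0 ht powE dl0 cl).
move=> /(doubling_cvg t0 ht)/(_ hfin hnz)[L [L1 cL cl ->]].
have l2 : 0 < ln (2 : R) by rewrite ln_gt0// ltr1n.
have dl0 : 0 < ln L / ln 2 by rewrite divr_gt0// ln_gt0.
rewrite (hausdorff_dim_limit hH oe ce t0 ht powE dl0 cl); split => // d d0.
rewrite (singularly_traceable_power hH oe ce t0 ht powE L1 cL d0) powR_eq2//.
by split=> [->|[]].
Qed.
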